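(* Let $d\ge 2$, $\beta>0$ and $L\ge 2$, and consider $k^{\mathrm{FC}_\beta(L)}$ restricted to $\mathbb{S}^{d-1}\times\mathbb{S}^{d-1}$. Then: (1) $k^{\mathrm{FC}_\beta(L)}(\mathbf{x},\mathbf{z})=\sum_{k=0}^\infty\lambda_k\sum_{j=1}^{N(d,k)}Y_{k,j}(\mathbf{x})Y_{k,j}(\mathbf{z})$ with $\lambda_k>0$ for all $k\ge 0$; (2) there exist $k_0$ and constants $C_1,C_2,C_3>0$ (depending on $d$) such that for all $k>k_0$: (a) if $L=2$, $C_1k^{-d}\le\lambda_k\le C_2k^{-d}$; (b) if $L\ge 3$, $C_3k^{-d}\le\lambda_k$.
   Context: NTK definition: Fix $\beta\ge 0$. For nonzero $\mathbf{x},\mathbf{z}\in\mathbb{R}^d$ define recursively $\Sigma^{(0)}(\mathbf{x},\mathbf{z})=\mathbf{x}^T\mathbf{z}$, $\Theta^{(0)}(\mathbf{x},\mathbf{z})=\mathbf{x}^T\mathbf{z}+\beta^2$, and for $h\ge 1$, with $\lambda^{(h-1)}=\Sigma^{(h-1)}(\mathbf{x},\mathbf{z})/\sqrt{\Sigma^{(h-1)}(\mathbf{x},\mathbf{x})\Sigma^{(h-1)}(\mathbf{z},\mathbf{z})}$, $\Sigma^{(h)}(\mathbf{x},\mathbf{z})=\frac{\lambda^{(h-1)}(\pi-\arccos\lambda^{(h-1)})+\sqrt{1-(\lambda^{(h-1)})^2}}{\pi}\sqrt{\Sigma^{(h-1)}(\mathbf{x},\mathbf{x})\Sigma^{(h-1)}(\mathbf{z},\mathbf{z})}$,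 $\dot\Sigma^{(h)}(\mathbf{x},\mathbf{z})=\frac{\pi-\arccos\lambda^{(h-1)}}{\pi}$, $\Theta^{(h)}=\Theta^{(h-1)}\dot\Sigma^{(h)}+\Sigma^{(h)}+\beta^2$. For $L\ge2$, $k^{\mathrm{FC}_\beta(L)}:=\Theta^{(L-1)}$. Spherical harmonic expansion: $\{Y_{k,j}\}_{j=1}^{N(d,k)}$ is an orthonormal basis (in $L^2$ of the uniform surface measure on $\mathbb{S}^{d-1}$) of the space of spherical harmonics of degree $k$, of dimension $N(d,k)$. For a continuous positive definite zonal kernel, the $\lambda_k$ in this expansion are the eigenvalues of the associated integral operator with respect to the uniform measure on $\mathbb{S}^{d-1}$ (Mercer decomposition). *)

(* Defs.v *)
From HB Require Import structures.
From mathcomp Require Import all_boot all_order all_algebra.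
From mathcomp Require Import all_classical all_reals all_analysis.
Set Implicit Arguments. Unset Strict Implicit. Unset Printing Implicit Defensive.
Import Order.TTheory GRing.Theory Num.Theory.
Import numFieldNormedType.Exports.
Local Open Scope ring_scope.

Section NTK.
Variable R : realType.

Definition dotv (d : nat) (x z : 'I_d -> R) : R := \sum_(i < d) x i * z i.
Definition normv (d : nat) (x : 'I_d -> R) : R := Num.sqrt (dotv x x).
Definition on_sphere (d : nat) (x : 'I_d -> R) : Prop := dotv x x = 1.

Fixpoint Sigma (d : nat) (h : nat) (x z : 'I_d -> R) : R :=
  match h with
  | 0 => dotv x z
  | h'.+1 =>
    let s := Sigma h' x z in
    let q := Num.sqrt (Sigma h' x x * Sigma h' z z) in
    let lam := s / q in
    (lam * (pi - acos lam) + Num.sqrt (1 - lam ^+ 2)) / pi * q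
  end.

Definition Sigmadot (d : nat) (h : nat) (x z : 'I_d -> R) : R :=
  match h with
  | 0 => 0 (* unused: dot Sigma is only defined for h >= 1 *)
  | h'.+1 =>
    let lam := Sigma h' x z / Num.sqrt (Sigma h' x x * Sigma h' z z) in
    (pi - acos lam) / pi
  end.

Fixpoint Theta (d : nat) (beta : R) (h : nat) (x z : 'I_d -> R) : R :=
  match h with
  | 0 => dotv x z + beta ^+ 2
  | h'.+1 => Theta beta h' x z * Sigmadot h x z + Sigma h x z + beta ^+ 2
  end.

Definition kFC (d : nat) (beta : R) (L : nat) (x z : 'I_d -> R) : R :=
  Theta beta L.-1 x z.

(* Iterated Lebesgue integral over R^n of F : (nat -> R) -> R
   (coordinates 0..n-1; Fubini identifies it with the integral for
   Lebesgue measure on R^n for the continuous compactly supported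
   integrands used below). *)
Fixpoint iint (n : nat) (F : (nat -> R) -> R) : R :=
  match n with
  | 0 => F (fun _ => 0)
  | n'.+1 => Rintegral (@lebesgue_measure R) setT
      (fun t => iint n' (fun y => F (fun i => if i == n' then t else y i)))
  end.

Definition of_nat_fun (d : nat) (y : nat -> R) : 'I_d -> R := fun i => y i.

Definition ball_ind (d : nat) (y : 'I_d -> R) : R :=
  if dotv y y <= 1 then 1 else 0.

(* Integral w.r.t. the normalized uniform surface measure on S^{d-1},
   defined via the cone construction:
   sigma(A) = vol({r x | 0 < r <= 1, x in A}) / vol(B^d). *)
Definition sphere_int (d : nat) (f : ('I_d -> R) -> R) : R :=
  iint d (fun y => ball_ind (@of_nat_fun d y) *
                    f (fun i => @of_nat_fun d y i / normv (@of_nat_fun d y)))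
  / iint d (fun y => ball_ind (@of_nat_fun d y)).

Definition l2dot (d : nat) (f g : ('I_d -> R) -> R) : R :=
  sphere_int (fun x => f x * g x).

Definition monom (d : nat) (alpha : 'I_d -> nat) (x : 'I_d -> R) : R :=
  \prod_(i < d) x i ^+ alpha i.

Definition polyfun (d : nat) (c : seq (R * ('I_d -> nat))) (x : 'I_d -> R) : R :=
  \sum_(t <- c) t.1 * monom t.2 x.

(* the Laplacian of that polynomial function, computed termwise:
   d^2/dx_i^2 x^alpha = alpha_i (alpha_i - 1) x^(alpha - 2 e_i) *)
Definition polyfun_lap (d : nat) (c : seq (R * ('I_d -> nat))) (x : 'I_d -> R) : R :=
  \sum_(t <- c) t.1 * \sum_(i < d)
     ((t.2 i * (t.2 i).-1)%:R *
      monom (fun j => if j == i then (t.2 j).-2 else t.2 j) x).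

Definition sph_harm (d k : nat) (Y : ('I_d -> R) -> R) : Prop :=
  exists c : seq (R * ('I_d -> nat)),
    (forall t, t \in c -> (\sum_(i < d) t.2 i)%N = k) /\
    (forall x, polyfun_lap c x = 0) /\
    (forall x, on_sphere x -> Y x = polyfun c x).

Definition sph_harm_onb (d k : nat) (B : seq (('I_d -> R) -> R)) : Prop :=
  (forall Y, Y \in B -> sph_harm k Y) /\
  (forall i j, (i < size B)%N -> (j < size B)%N ->
     l2dot (nth (fun _ => 0) B i) (nth (fun _ => 0) B j)
       = (i == j)%:R) /\
  (forall Y, sph_harm k Y -> exists c : nat -> R, forall x, on_sphere x ->
     Y x = \sum_(j < size B) c j * nth (fun _ => 0) B j x).

End NTK.

(* Main.v *)
(** The kernel restricted to the sphere is [f (x . z)] with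
    [f t = \sum_n a_n t ^ n], [a_n >= 0]: the arcsine has nonnegative Maclaurin
    coefficients, summable up to the boundary, and such power series are closed under
    sums, products and composition.  The monomial kernel [(x . z) ^ n] acts on
    harmonics of degree [k] as an explicit scalar [lam n k]; this follows from
    Green's identity [m (m + d - 2) \int Q = \int \Delta Q] for homogeneous [Q] of
    degree [m], by induction on [n + k], since
    [\Delta ((x . z) ^ n Y) = n (n - 1) (x . z) ^ (n - 2) Y + 2 n (x . z) ^ (n - 1) \partial_x Y]
    on unit vectors [x] and harmonic [Y].  Hence the [k]-th eigenvalue is
    [\sum_n a_n lam n k > 0].  The expansion follows from
    [t ^ n = \sum_k lam n k G_k t], where the zonal polynomial [G_k] is the reproducing
    kernel of any orthonormal basis of degree-[k] harmonics, by exchanging two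
    absolutely convergent sums.  For the rate, [a_n] is compared with a sequence
    [b_n] of order [n ^ (-3/2)] chosen so that [T_k = \sum_n b_n lam n k] telescopes to
    [((k + d) ^ 2 - 1) T_(k+2) = (k ^ 2 - 1) T_k], whence [T_k] is of order [k ^ (-d)]. *)

Require Import Defs.
From HB Require Import structures.
From mathcomp Require Import all_boot all_order all_algebra.
From mathcomp Require Import all_classical all_reals all_analysis.
From mathcomp Require Import measurable_realfun zify ring lra.
Import Order.TTheory GRing.Theory Num.Theory.
Import numFieldNormedType.Exports.
Local Open Scope classical_set_scope.
Local Open Scope ring_scope.
Set Implicit Arguments.
Unset Strict Implicit.
Unset Printing Implicit Defensive.

(** * Iterated integrals *)

(** The sphere integral is a quotient of iterated one-dimensional integrals. No exchange of
    integrals and no polar coordinates enter: integrands stay measurable and dominated by a cube, so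
    every slice is integrable, and the passage from ball to sphere is a scaling argument on thin
    shells. Positivity in every degree hinges on [beta > 0]. At depth two the kernel is
    [(t + beta^2) kap0 t + kap1 t + beta^2]: terms such as [t asin t] feed even powers, and odd
    powers above 1 come only from [beta^2 asin t]. Deeper kernels inherit the lower bound because
    [kap0 (sig h t) = 1/2 + asin (sig h t) / pi], so half of the previous kernel survives and the
    rest has nonnegative coefficients. The upper bound is kept where the coefficients are explicit.
    Arcsine coefficients live on odd indices only, and the shifted ones follow another recurrence;
    [bq] replaces both by one recurrence of step two, which is what telescopes. Summability is
    needed at [t = 1], where the derivative of arcsine blows up; hence its series is studied in the
    angle. *)

Lemma cvg_finsum {R : realType} {T I : Type} (F : set_system T) {FF : Filter F}
    (r : seq I) (f : I -> T -> R) (a : I -> R) :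
  (forall i, f i x @[x --> F] --> a i) ->
  \sum_(i <- r) f i x @[x --> F] --> \sum_(i <- r) a i.
Proof.
move=> fa; elim: r => [|i r IH].
  by rewrite big_nil; under eq_fun do rewrite big_nil; exact: cvg_cst.
by rewrite big_cons; under eq_fun do rewrite big_cons; exact: cvgD.
Qed.

Section IteratedIntegral.
Context {R : realType}.
Notation mu := (@lebesgue_measure R).
Implicit Types (F G : (nat -> R) -> R) (y : nat -> R).

(** The update by which [iint] binds variables: the last coordinate is outermost and coordinate 0
    innermost. *)
Definition upd y (n : nat) (t : R) : nat -> R := fun i => if i == n then t else y i.

(* Quantifying over all measurable families of coordinates avoids putting a
   sigma-algebra on [nat -> R]. *)
Definition mfam F : Prop :=
  forall (disp : measure_display) (T : measurableType disp) (g : nat -> T -> R),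
    (forall i, measurable_fun setT (g i)) ->
    measurable_fun setT (fun t => F (g ^~ t)).

Lemma mfam_cst (c : R) : mfam (fun=> c).
Proof. by move=> ? ? g mg; exact: measurable_cst. Qed.

Lemma mfam_coord i : mfam (fun y => y i).
Proof. by move=> ? ? g mg; exact: mg. Qed.

Lemma mfamD F G : mfam F -> mfam G -> mfam (fun y => F y + G y).
Proof. by move=> mF mG ? ? g mg; apply: measurable_funD; [exact: mF|exact: mG]. Qed.

Lemma mfamM F G : mfam F -> mfam G -> mfam (fun y => F y * G y).
Proof. by move=> mF mG ? ? g mg; apply: measurable_funM; [exact: mF|exact: mG]. Qed.

Lemma mfamX F n : mfam F -> mfam (fun y => F y ^+ n).
Proof. by move=> mF ? ? g mg; apply: measurable_funX; exact: mF. Qed.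

Lemma mfam_sum (I : Type) (r : seq I) (P : pred I) (F : I -> (nat -> R) -> R) :
  (forall i, mfam (F i)) -> mfam (fun y => \sum_(i <- r | P i) F i y).
Proof.
move=> mF; elim: r => [|i r IH].
  by under eq_fun do rewrite big_nil; exact: mfam_cst.
under eq_fun do rewrite big_cons.
by case: (P i) => //; exact: (mfamD (mF i) IH).
Qed.

Lemma mfam_prod (I : Type) (r : seq I) (P : pred I) (F : I -> (nat -> R) -> R) :
  (forall i, mfam (F i)) -> mfam (fun y => \prod_(i <- r | P i) F i y).
Proof.
move=> mF; elim: r => [|i r IH].
  by under eq_fun do rewrite big_nil; exact: mfam_cst.
under eq_fun do rewrite big_cons.
by case: (P i) => //; exact: (mfamM (mF i) IH).
Qed.

Lemma mfam_comp (h : R -> R) F : measurable_fun setT h -> mfam F -> mfam (fun y => h (F y)).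
Proof. by move=> mh mF ? ? g mg; apply: measurableT_comp => //; exact: mF. Qed.

Lemma mfam_sqrt F : mfam F -> mfam (fun y => Num.sqrt (F y)).
Proof.
move=> mF; apply: mfam_comp => //.
have -> : Num.sqrt = (fun x : R => (Num.max x 0) `^ 2^-1).
  apply/funext => x; rewrite powR12_sqrt ?le_max ?lexx ?orbT//.
  by have [x0|x0] := leP 0 x => //; rewrite ltr0_sqrtr// sqrtr0.
have mm : measurable_fun setT (fun x : R => Num.max x 0).
  by apply: measurable_maxr => //; exact: measurable_id.
exact: (measurableT_comp (@measurable_powR R 2^-1) mm).
Qed.

Lemma mfam_inv_ge0 F : (forall y, 0 <= F y) -> mfam F -> mfam (fun y => (F y)^-1).
Proof.
move=> F0 mF.
under eq_fun do rewrite -powR_inv1//.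
apply: (mfam_comp (h := fun x => x `^ (-1))) => //; exact: measurable_powR.
Qed.

Lemma mfam_ler F G : mfam F -> mfam G -> mfam (fun y => (F y <= G y)%R%:R).
Proof.
move=> mF mG ? ? g mg.
have -> : (fun x => (F (g^~ x) <= G (g^~ x))%R%:R) =
  (fun x => if F (g^~ x) <= G (g^~ x) then (1:R) else 0).
  by apply/funext => x; case: ifP.
by apply: measurable_fun_ifT => //; apply: measurable_fun_ler; [exact: mF|exact: mG].
Qed.

Lemma mfam_cvg (H : nat -> (nat -> R) -> R) F :
  (forall n, mfam (H n)) -> (forall y, H ^~ y @ \oo --> F y) -> mfam F.
Proof.
move=> mH cH ? T g mg.
apply: (@measurable_fun_cvg _ T R setT (fun n t => H n (g^~ t))) => [n|x _].
  exact: mH.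
exact: cH.
Qed.

Lemma mfam_subst F (h : nat -> (nat -> R) -> R) :
  mfam F -> (forall i, mfam (h i)) -> mfam (fun y => F (fun i => h i y)).
Proof. by move=> mF mh ? ? g mg; apply: mF => i; exact: mh. Qed.

Lemma mfam_upd F n (t : R) : mfam F -> mfam (fun y => F (upd y n t)).
Proof.
move=> mF; apply: (@mfam_subst F (fun i y => upd y n t i)) => // i; rewrite /upd.
by case: (i == n); [exact: mfam_cst|exact: mfam_coord].
Qed.

Lemma mfam_slice F y n : mfam F -> measurable_fun setT (fun t => F (upd y n t)).
Proof.
move=> mF; apply: (mF _ _ (fun i t => upd y n t i)) => i; rewrite /upd.
by case: (i == n) => //; exact: measurable_id.
Qed.

(** The parameter space in [mfam] is instantiated with the product of [T] and the line, where
    Tonelli makes the partial integrals of the positive and negative parts measurable. *)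
Lemma mfam_int n G : mfam G ->
  mfam (fun y => Rintegral mu setT (fun t => G (upd y n t))).
Proof.
move=> mG d T g mg; rewrite /Rintegral.
pose Q : T * measurableTypeR R -> R := fun p => G (upd (g^~ p.1) n p.2).
have mQ : measurable_fun setT Q.
  apply: (mG _ _ (fun i p => upd (g^~ p.1) n p.2 i)) => i; rewrite /upd.
  case: (i == n); first exact: measurable_snd.
  exact: (measurableT_comp (mg i) measurable_fst).
apply: measurableT_comp => //.
have mQE : measurable_fun setT (EFin \o Q) by exact/measurable_EFinP.
have -> : (fun x => (\int[mu]_t (G (upd (g^~ x) n t))%:E)%E) =
  (fun x => (\int[mu]_t ((EFin \o Q)^\+ (x, t)) - \int[mu]_t ((EFin \o Q)^\- (x, t)))%E).
  apply/funext => x; rewrite (integralE mu setT (fun t => (G (upd (g^~ x) n t))%:E)).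
  by congr (_ - _)%E; apply: eq_integral => t _; rewrite ?funeposE ?funenegE.
apply: emeasurable_funB.
- have := @measurable_fun_fubini_tonelli_F _ _ _ _ R mu (EFin \o Q)^\+%E.
  by apply => //; exact: measurable_funepos.
- have := @measurable_fun_fubini_tonelli_F _ _ _ _ R mu (EFin \o Q)^\-%E.
  by apply => //; exact: measurable_funeneg.
Qed.

Lemma box_integrable (h : R -> R) (C K : R) : measurable_fun setT h ->
  (forall t, `|h t| <= C * (`|t| <= K)%R%:R) -> mu.-integrable setT (EFin \o h).
Proof.
move=> mh bh.
apply: (@le_integrable _ _ _ mu setT _ _
  (fun t => (C%:E * (\1_(`[(- K), K] : set R) t)%:E)%E)) => //.
- exact/measurable_EFinP.
- move=> t _ /=; rewrite lee_fin; apply: le_trans (bh t) _.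
  apply: le_trans (ler_norm _) _; rewrite !normrM.
  rewrite indicE mem_setE in_itv/= ler_norml.
  by case: (_ && _); rewrite ?normr1 ?normr0.
- apply: integrableZl => //; exact: integrable_indic_itv.
Qed.

End IteratedIntegral.

(** * Dilations of the real line *)

Section Scaling.
Context {R : realType}.
Notation mu := (@lebesgue_measure R).

(** Half-open intervals determine Lebesgue measure, and on them the scaling is explicit. *)
Lemma lebesgue_measure_scale (c : R) (c0 : 0 < c) (A : set R) : measurable A ->
  mu A = (c%:E * mu ((fun t : R => (c * t)%R : measurableTypeR R) @^-1` A))%E.
Proof.
move=> mA.
have mf : measurable_fun setT (fun t : R => (c * t)%R : measurableTypeR R).
  exact: measurable_funM.
pose m := mscale (NngNum (ltW c0)) (pushforward mu (fun t : R => (c * t)%R : measurableTypeR R)).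
suff : mu A = m mf A by [].
apply: lebesgue_measure_unique => // _ [[a b]] _ <-.
change (mu `]a, b] = (c%:E * mu ((fun t : R => (c * t)%R) @^-1` `]a, b]))%E).
rewrite (_ : _ @^-1` _ = `]a / c, b / c]%classic); last first.
  apply/seteqP; split => t /=; rewrite !in_itv/= ltr_pdivrMr// ler_pdivlMr//.
    by rewrite mulrC.
  by rewrite mulrC.
rewrite !lebesgue_measure_itv /= !lte_fin ltr_pM2r ?invr_gt0//.
case: ifPn => _; last by rewrite mule0.
by rewrite -!EFinB -EFinM -mulrBl mulrC divfK// gt_eqF.
Qed.

Lemma ge0_integral_scale (c : R) (f : R -> \bar R) : 0 < c ->
  measurable_fun setT f -> (forall t, 0 <= f t)%E ->
  (\int[mu]_t f t = c%:E * \int[mu]_t f (c * t)%R)%E.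
Proof.
move=> c0 mf f0.
pose g : measurableTypeR R -> measurableTypeR R := fun t => (c * t)%R.
have mg : measurable_fun setT g by exact: measurable_funM.
have P := @ge0_integral_pushforward _ _ _ _ R g mg mu setT f measurableT mf (fun y _ => f0 y).
rewrite preimage_setT in P; rewrite -[X in (_ * X)%E]P.
have S := @ge0_integral_mscale _ _ R (pushforward mu g) _ measurableT (NngNum (ltW c0)) f.
rewrite -(S mg mf (fun y _ => f0 y)).
by apply: eq_measure_integral => A mA _; exact: lebesgue_measure_scale.
Qed.

Lemma Rintegral_scale (c : R) (h : R -> R) : 0 < c ->
  mu.-integrable setT (EFin \o h) ->
  Rintegral mu setT h = c * Rintegral mu setT (fun t => h (c * t)).
Proof.
move=> c0 ih; have mE := measurable_int mu ih.
(* Distributing [fine] needs finiteness of the rescaled integrals too; it is pulled back through the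
   factor [c]. *)
have cfin (z : \bar R) : (c%:E * z)%E \is a fin_num -> z \is a fin_num.
  by case: z => //=; rewrite ?gt0_muley ?gt0_muleNy.
have Sp := @ge0_integral_scale c (EFin \o h)^\+%E c0 (measurable_funepos mE) (fun t => funepos_ge0 _ t).
have Sn := @ge0_integral_scale c (EFin \o h)^\-%E c0 (measurable_funeneg mE) (fun t => funeneg_ge0 _ t).
have fp := integrable_pos_fin_num measurableT ih.
have fn := integrable_neg_fin_num measurableT ih.
rewrite Sp in fp; rewrite Sn in fn.
rewrite /Rintegral (integralE mu setT (fun t => (h (c * t))%:E)) integralE.
rewrite Sp Sn fineB// !fineM// ?(cfin _ fp) ?(cfin _ fn)// -mulrBr; congr (_ * _).
rewrite -fineB ?(cfin _ fp) ?(cfin _ fn)//.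
by congr (fine (_ - _)%E); apply: eq_integral => t _; rewrite ?funeposE ?funenegE.
Qed.

End Scaling.

(** * Linearity, monotonicity and scaling of iterated integrals *)

Section Iint.
Context {R : realType}.
Notation mu := (@lebesgue_measure R).
Implicit Types (F G : (nat -> R) -> R) (y : nat -> R).

(** A cube indicator in product form, so that fixing the last coordinate splits off exactly one
    factor. *)
Definition box (n : nat) (K : R) y : R := \prod_(i < n) (`|y i| <= K)%R%:R.

Definition bdby (n : nat) (C K : R) F := forall y, `|F y| <= C * box n K y.

(** Measurable, bounded, and supported in a cube in the first [n] coordinates: stable under slicing,
    hence integrable at each level of the iteration. *)
Definition nice (n : nat) F := mfam F /\ exists C K : R, bdby n C K F.

Lemma box_ge0 n K y : 0 <= box n K y.
Proof. by apply: prodr_ge0 => i _; rewrite ler0n. Qed.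

Lemma box_le n K K' y : K <= K' -> box n K y <= box n K' y.
Proof.
move=> KK'; apply: ler_prod => i _; rewrite ler0n/= ler_nat.
by case: (leP _ K) => //= h; rewrite (le_trans h KK').
Qed.

Lemma box_upd n K y t : box n.+1 K (upd y n t) = (`|t| <= K)%R%:R * box n K y.
Proof.
rewrite /box big_ord_recr/= mulrC {1}/upd eqxx; congr (_ * _).
by apply: eq_bigr => i _; rewrite /upd ltn_eqF.
Qed.

Lemma bdby_slice n C K F t : bdby n.+1 C K F ->
  bdby n (C * (`|t| <= K)%R%:R) K (fun y => F (upd y n t)).
Proof. by move=> bF y; apply: le_trans (bF _) _; rewrite box_upd mulrA. Qed.

Lemma nice_slice n F t : nice n.+1 F -> nice n (fun y => F (upd y n t)).
Proof.
move=> [mF [C [K bF]]]; split; first exact: mfam_upd.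
by eexists; eexists; exact: bdby_slice bF.
Qed.

Lemma niceD n F G : nice n F -> nice n G -> nice n (fun y => F y + G y).
Proof.
move=> [mF [C [K bF]]] [mG [C' [K' bG]]]; split; first exact: mfamD.
exists (`|C| + `|C'|), (Num.max K K') => y.
apply: le_trans (ler_normD _ _) _; rewrite mulrDl; apply: lerD.
  apply: le_trans (bF y) (le_trans (ler_wpM2r (box_ge0 _ _ _) (ler_norm C)) _).
  by apply: ler_wpM2l => //; apply: box_le; rewrite le_max lexx.
apply: le_trans (bG y) (le_trans (ler_wpM2r (box_ge0 _ _ _) (ler_norm C')) _).
by apply: ler_wpM2l => //; apply: box_le; rewrite le_max lexx orbT.
Qed.

Lemma niceM n F G (B : R) : nice n F -> mfam G -> (forall y, `|G y| <= B) ->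
  nice n (fun y => F y * G y).
Proof.
move=> [mF [C [K bF]]] mG bG; split; first exact: mfamM.
exists (C * B), K => y; rewrite normrM -mulrA (mulrC B) mulrA.
by apply: ler_pM.
Qed.

Lemma niceZ n F (c : R) : nice n F -> nice n (fun y => c * F y).
Proof.
move=> nF; have := niceM nF (mfam_cst c) (fun _ => lexx `|c|).
by congr nice; apply/funext => y; rewrite mulrC.
Qed.

Lemma iintS n F : iint n.+1 F = Rintegral mu setT (fun t => iint n (fun y => F (upd y n t))).
Proof. by []. Qed.

(** [iint] starts from the zero sequence, so the coordinates from [n] on are read as 0. *)
Definition trunc (n : nat) y : nat -> R := fun i => if (i < n)%N then y i else 0.

Lemma iint_trunc n F : iint n F = iint n (fun y => F (trunc n y)).
Proof.
elim: n F => [F|n IH F].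
  by rewrite /=; congr F; apply/funext => i.
rewrite !iintS; apply: eq_Rintegral => t _; rewrite IH; congr iint.
apply/funext => y; congr F; apply/funext => i; rewrite /upd /trunc ltnS.
by case: ltngtP.
Qed.

(** The free coordinates stay as parameters so that each induction step can integrate coordinate [n]
    of a family already known to be measurable. *)
Lemma mfam_iint_params n F : mfam F ->
  mfam (fun y => iint n (fun z => F (fun i => if (i < n)%N then z i else y i))).
Proof.
move=> mF; elim: n => [|n IH].
  by move=> ? ? g mg /=; exact: mF.
have := mfam_int n IH; congr mfam; apply/funext => y; rewrite iintS.
apply: eq_Rintegral => t _; congr iint; apply/funext => z; congr F.
by apply/funext => i; rewrite /upd ltnS; case: ltngtP.
Qed.

Lemma measurable_iint_slice n F : mfam F ->
  measurable_fun setT (fun t => iint n (fun y => F (upd y n t))).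
Proof.
move=> mF; have := mfam_slice (fun=> 0) n (mfam_iint_params n mF).
congr measurable_fun; apply/funext => t; rewrite [RHS]iint_trunc; congr iint.
apply/funext => z; congr F; apply/funext => i; rewrite /upd /trunc.
by case: ltngtP.
Qed.

Definition width (K : R) := Rintegral mu setT (fun t => (`|t| <= K)%R%:R).

Lemma measurable_box (K : R) : measurable_fun setT (fun t : R => (`|t| <= K)%R%:R : R).
Proof.
have : mfam (fun y => (`|y 0%N| <= K)%R%:R).
  apply: mfam_ler; last exact: mfam_cst.
  by apply: mfam_comp; [exact: normr_measurable|exact: mfam_coord].
by move=> /(_ _ _ (fun=> id)); apply => i; exact: measurable_id.
Qed.

Lemma iint_bound n F C K : mfam F -> bdby n C K F -> `|iint n F| <= C * width K ^+ n.
Proof.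
elim: n F C => [F C mF bF|n IH F C mF bF].
  by have := bF (fun=> 0); rewrite /box big_ord0 /= expr0.
have bt t : `|iint n (fun y => F (upd y n t))| <= (C * width K ^+ n) * (`|t| <= K)%R%:R.
  rewrite mulrAC; apply: IH; [exact: mfam_upd|exact: bdby_slice].
have i1 := box_integrable (measurable_iint_slice n mF) bt.
rewrite iintS; apply: le_trans (le_normr_Rintegral _ i1) _ => //.
have ib : mu.-integrable setT (EFin \o (fun t : R => (`|t| <= K)%R%:R)).
  apply: (@box_integrable _ _ 1 K) => [|t]; first exact: measurable_box.
  by rewrite mul1r ger0_norm ?ler0n.
rewrite exprSr mulrA -RintegralZl//; apply: le_Rintegral => //.
- exact: (integrable_norm i1).
- apply: (@box_integrable _ _ `|C * width K ^+ n| K) => [|t].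
    by apply: measurable_funM => //; exact: measurable_box.
  by rewrite normrM [X in _ * X]ger0_norm ?ler0n.
Qed.

Lemma iint_integrable n F : nice n.+1 F ->
  mu.-integrable setT (EFin \o (fun t => iint n (fun y => F (upd y n t)))).
Proof.
move=> [mF [C [K bF]]].
apply: (@box_integrable _ _ (C * width K ^+ n) K) => [|t].
  exact: measurable_iint_slice.
by rewrite mulrAC; apply: iint_bound; [exact: mfam_upd|exact: bdby_slice].
Qed.

Lemma eq_iint n F G : F =1 G -> iint n F = iint n G.
Proof. by move=> /funext ->. Qed.

Lemma iintD n F G : nice n F -> nice n G ->
  iint n (fun y => F y + G y) = iint n F + iint n G.
Proof.
elim: n F G => [//|n IH] F G nF nG; rewrite !iintS -RintegralD//.
- by apply: eq_Rintegral => t _; apply: IH; exact: nice_slice.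
- exact: iint_integrable.
- exact: iint_integrable.
Qed.

Lemma iintZ n F (c : R) : nice n F -> iint n (fun y => c * F y) = c * iint n F.
Proof.
elim: n F => [//|n IH] F nF; rewrite !iintS -RintegralZl//.
- by apply: eq_Rintegral => t _; apply: IH; exact: nice_slice.
- exact: iint_integrable.
Qed.

Lemma iint_ge0 n F : (forall y, 0 <= F y) -> 0 <= iint n F.
Proof.
elim: n F => [|n IH] F F0; first exact: F0.
by rewrite iintS; apply: Rintegral_ge0 => t _; apply: IH.
Qed.

Lemma niceB n F G : nice n F -> nice n G -> nice n (fun y => F y - G y).
Proof.
move=> nF nG; have := niceD nF (niceZ (-1) nG).
by congr nice; apply/funext => y; rewrite mulN1r.
Qed.

Lemma iintB n F G : nice n F -> nice n G ->
  iint n (fun y => F y - G y) = iint n F - iint n G.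
Proof.
move=> nF nG; rewrite -mulN1r -iintZ// -iintD//; last exact: niceZ.
by apply: eq_iint => y; rewrite mulN1r.
Qed.

Lemma iint_le n F G : nice n F -> nice n G -> (forall y, F y <= G y) ->
  iint n F <= iint n G.
Proof.
by move=> nF nG FG; rewrite -subr_ge0 -iintB//; apply: iint_ge0 => y; rewrite subr_ge0.
Qed.

Lemma iint_norm_le n F G : nice n F -> nice n G -> (forall y, `|F y| <= G y) ->
  `|iint n F| <= iint n G.
Proof.
move=> nF nG FG; rewrite ler_norml; apply/andP; split.
  rewrite -mulN1r -iintZ//; apply: iint_le => // [|y]; first exact: niceZ.
  by rewrite mulN1r; have := FG y; rewrite ler_norml => /andP[].
by apply: iint_le => // y; exact: le_trans (ler_norm _) (FG y).
Qed.

Lemma nice0 n : nice n (fun=> 0).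
Proof. by split; [exact: mfam_cst|exists 0, 0 => y; rewrite normr0 mul0r]. Qed.

Lemma nice_sum n (I : Type) (r : seq I) (F : I -> (nat -> R) -> R) :
  (forall i, nice n (F i)) -> nice n (fun y => \sum_(i <- r) F i y).
Proof.
move=> nF; elim: r => [|i r IH].
  by under eq_fun do rewrite big_nil; exact: nice0.
by under eq_fun do rewrite big_cons; exact: niceD.
Qed.

Lemma iint_sum n (I : Type) (r : seq I) (F : I -> (nat -> R) -> R) :
  (forall i, nice n (F i)) ->
  iint n (fun y => \sum_(i <- r) F i y) = \sum_(i <- r) iint n (F i).
Proof.
move=> nF; elim: r => [|i r IH].
  under eq_fun do rewrite big_nil.
  rewrite big_nil -[RHS](mul0r (iint n (fun=> 0))) -iintZ; last exact: nice0.
  by apply: eq_iint => y; rewrite mul0r.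
under eq_fun do rewrite big_cons.
by rewrite big_cons -IH iintD//; exact: nice_sum.
Qed.

Lemma nice_scale n F (c : R) : 0 < c -> nice n F -> nice n (fun y => F (fun i => c * y i)).
Proof.
move=> c0 [mF [C [K bF]]]; split.
  apply: (mfam_subst (h := fun i y => c * y i)) => // i.
  by apply: mfamM; [exact: mfam_cst|exact: mfam_coord].
exists C, (K / c) => y; apply: le_trans (bF _) _; rewrite le_eqVlt; apply/orP; left.
apply/eqP; congr (_ * _); apply: eq_bigr => i _; congr (nat_of_bool _)%:R.
by rewrite normrM gtr0_norm// ler_pdivlMr// mulrC.
Qed.

Lemma iint_scale n F (c : R) : 0 < c -> nice n F ->
  iint n F = c ^+ n * iint n (fun y => F (fun i => c * y i)).
Proof.
move=> c0; elim: n F => [F _|n IH F nF].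
  by rewrite /= expr0 mul1r; congr F; apply/funext => i; rewrite mulr0.
rewrite !iintS (Rintegral_scale c0 (iint_integrable nF)) exprS -mulrA; congr (_ * _).
rewrite -RintegralZl//; last exact: iint_integrable (nice_scale c0 nF).
apply: eq_Rintegral => t _; rewrite IH; last exact: nice_slice.
congr (_ * _); apply: eq_iint => y; congr F; apply/funext => i.
by rewrite /upd; case: eqP.
Qed.

(** Coordinate 0 is innermost and a point is null on the line, so a coordinate hyperplane is
    negligible. This is how the origin, which has no direction, is discarded. *)
Lemma eq_iint_off0 n F G : mfam F -> mfam G ->
  (forall y, y 0%N != 0 -> F y = G y) -> iint n.+1 F = iint n.+1 G.
Proof.
elim: n F G => [F G mF mG FG|n IH F G mF mG FG]; last first.
  rewrite !(@iintS n.+1); apply: eq_Rintegral => t _.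
  by apply: IH => [||y y0]; [exact: mfam_upd|exact: mfam_upd|exact: FG].
rewrite !iintS /Rintegral; congr fine; apply: ae_eq_integral => //.
- by apply/measurable_EFinP; exact: mfam_slice.
- by apply/measurable_EFinP; exact: mfam_slice.
- exists [set 0]; split => //; first exact: lebesgue_measure_set1.
  move=> t /= /not_implyP[_] /eqP; apply: contraNP => /eqP t0; apply/eqP; congr EFin.
  exact: FG.
Qed.

End Iint.

(** * Monomials on the ball *)

Section Beta.
Context {R : realType}.
Notation mu := (@lebesgue_measure R).

Definition betaf (p q : nat) (t : R) : R := t ^+ p * Num.sqrt (1 - t ^+ 2) ^+ q.

(** A Beta integral with half-integer exponent: [q] counts square roots, so slices of balls of every
    dimension are covered. *)
Definition Bint (p q : nat) : R := Rintegral mu `[(-1), 1] (betaf p q).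

Lemma betaf_continuous p q : continuous (betaf p q).
Proof.
move=> t; apply: cvgM; first exact: exprn_continuous.
apply: (@continuous_comp _ _ _ (fun t : R => Num.sqrt (1 - t ^+ 2)) (fun x => x ^+ q)).
  apply: (@continuous_comp _ _ _ (fun t : R => 1 - t ^+ 2) Num.sqrt).
    by apply: cvgB; [exact: cvg_cst|exact: exprn_continuous].
  exact: sqrt_continuous.
exact: exprn_continuous.
Qed.

Lemma betaf_integrable p q : mu.-integrable `[(-1), 1] (EFin \o betaf p q).
Proof.
apply: continuous_compact_integrable; first exact: segment_compact.
exact/continuous_subspaceT/betaf_continuous.
Qed.

Lemma betaf_derive p q (t : R) : t \in `](-1), 1[ ->
  is_derive t 1 (betaf p q.+2) (p%:R * betaf p.-1 q.+2 t - q.+2%:R * betaf p.+1 q t).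
Proof.
rewrite in_itv/= => /andP[t1 t2].
have w0 : 0 < 1 - t ^+ 2 by nra.
have ds := is_derive1_sqrt w0.
have di : is_derive t 1 (fun t : R => 1 - t ^+ 2) (- (2 * t)).
  apply: is_derive_eq; rewrite /GRing.scale/=; ring.
have dc := @is_derive1_comp _ Num.sqrt (fun t : R => 1 - t ^+ 2) t _ _ ds di.
have dX := @is_deriveX _ _ _ q.+2 _ _ _ dc.
have dP := @is_deriveX _ _ (id : R -> R) p t 1 _ (is_derive_id _ _).
have -> : betaf p q.+2 = (id : R -> R) ^+ p * (Num.sqrt \o (fun t : R => 1 - t ^+ 2)) ^+ q.+2.
  by apply/funext => x; rewrite /betaf mulrfctE !exprfctE.
apply: (is_derive_eq (is_deriveM dP dX)).
rewrite /betaf !exprfctE /GRing.scale /=.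
have sn0 : Num.sqrt (1 - t ^+ 2) != 0 by rewrite gt_eqF// sqrtr_gt0.
rewrite mulr1; set w := Num.sqrt _ in sn0 *.
rewrite !exprS. field.
exact: sn0.
Qed.

(** Integrates the derivative of [betaf p q.+2], which vanishes at both endpoints. *)
Lemma Bint_parts p q : p%:R * Bint p.-1 q.+2 = q.+2%:R * Bint p.+1 q.
Proof.
apply/eqP; rewrite -subr_eq0; apply/eqP.
have I1 := betaf_integrable p.-1 q.+2; have I2 := betaf_integrable p.+1 q.
rewrite /Bint -!RintegralZl// -RintegralB//; last 2 first.
- exact: (integrableZl _ _ I1).
- exact: (integrableZl _ _ I2).
rewrite /Rintegral (@continuous_FTC2 _ _ (betaf p q.+2)) ?ltrN1//.
- have E (x : R) : x ^+ 2 = 1 -> betaf p q.+2 x = 0.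
    by move=> h; rewrite /betaf h subrr sqrtr0 exprS mul0r mulr0.
  by rewrite !E ?sqrrN ?expr1n//= subrr.
- apply: continuous_subspaceT => t; apply: cvgB; apply: cvgM; try exact: cvg_cst;
    exact: betaf_continuous.
- split.
  + by move=> x xI; have [] := betaf_derive p q xI.
  + exact/cvg_at_right_filter/betaf_continuous.
  + exact/cvg_at_left_filter/betaf_continuous.
- move=> x xI; have := betaf_derive p q xI => D.
  by rewrite derive1E derive_val.
Qed.

Lemma Bint_split p q : Bint p q.+2 = Bint p q - Bint p.+2 q.
Proof.
rewrite /Bint -RintegralB//; try exact: betaf_integrable.
apply: eq_Rintegral => t; rewrite inE/= in_itv/= => /andP[t1 t2].
have E : Num.sqrt (1 - t ^+ 2) ^+ q.+2 = (1 - t ^+ 2) * Num.sqrt (1 - t ^+ 2) ^+ q.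
  by rewrite -(addn2 q) exprD sqr_sqrtr; [rewrite mulrC|nra].
rewrite /betaf E. rewrite (exprS t p.+1) (exprS t p). set a := t ^+ p. set b := _ ^+ q. by ring.
Qed.

Lemma Bint_rec p q : (p + q + 2)%:R * Bint p.+1 q = p%:R * Bint p.-1 q.
Proof.
have := Bint_parts p q; case: p => [|p] /=.
  rewrite mul0r => /eqP; rewrite eq_sym mulf_eq0 pnatr_eq0/= => /eqP ->.
  by rewrite mulr0 mul0r.
rewrite Bint_split mulrBr => H.
rewrite [LHS](_ : _ = p.+1%:R * Bint p.+2 q + q.+2%:R * Bint p.+2 q); last first.
  by rewrite -mulrDl -natrD; congr (_%:R * _); lia.
by rewrite -H addrC subrK.
Qed.

Lemma Bint_rec2 p q : (p + q + 3)%:R * Bint p q.+2 = q.+2%:R * Bint p q.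
Proof.
have := Bint_rec p.+1 q; rewrite Bint_split mulrBr /=.
rewrite (_ : p.+1 + q + 2 = p + q + 3)%N; last by lia.
move=> ->; rewrite -mulrBl -natrB; last by lia.
by congr (_%:R * _); lia.
Qed.

Lemma Bint00 : Bint 0 0 = 2.
Proof.
have E : mu (`[(-1), 1]%classic : set R) = 2%:E.
  rewrite lebesgue_measure_itv/= lte_fin -subr_gt0 opprK addr_gt0//.
transitivity (1 * fine (mu (`[(-1), 1]%classic : set R))); last by rewrite E mul1r.
rewrite -Rintegral_cst//; apply: eq_Rintegral => t _.
by rewrite /betaf !expr0 mulr1.
Qed.

Lemma Bint_gt0 q : 0 < Bint 0 q.
Proof.
have step q' : 0 < Bint 0 q' -> 0 < Bint 0 q'.+2.
  move=> h; have c0 : 0 < (0 + q' + 3)%:R :> R by rewrite ltr0n addn3.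
  by rewrite -(pmulr_rgt0 _ c0) Bint_rec2 mulr_gt0.
have B0 : 0 < Bint 0 0 by rewrite Bint00.
elim/ltn_ind: q => -[//|[_|q IH]]; last by apply: step; apply: IH.
(* The odd case starts at [q = 1], which is compared with [q = 2]: the root lies between 0 and 1, so
   its square is smaller. *)
apply: lt_le_trans (step _ B0) _.
apply: le_Rintegral => //; try exact: betaf_integrable.
move=> t; rewrite /= in_itv/= => /andP[t1 t2]; rewrite /betaf !expr0 !mul1r expr1.
have w0 : 0 <= 1 - t ^+ 2 by nra.
rewrite -[X in _ <= X]mulr1 expr2 ler_wpM2l ?sqrtr_ge0//.
by rewrite -[leRHS]sqrtr1 ler_wsqrtr// gerBl sqr_ge0.
Qed.
End Beta.

(** * Moments of monomials over balls *)

Section Ball.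
Context {R : realType}.
Notation mu := (@lebesgue_measure R).
Implicit Types (y : nat -> R) (al : nat -> nat).

Definition r2 (n : nat) y : R := \sum_(i < n) y i ^+ 2.
Definition mono (n : nat) al y : R := \prod_(i < n) y i ^+ al i.
Definition deg (n : nat) al : nat := (\sum_(i < n) al i)%N.
(** [s] is the squared radius, so that the slice of the unit ball at height [t] has parameter
    [1 - t^2]. *)
Definition ballm (n : nat) al (s : R) : R :=
  iint n (fun y => (r2 n y <= s)%R%:R * mono n al y).

Lemma r2_ge0 n y : 0 <= r2 n y.
Proof. by apply: sumr_ge0 => i _; exact: sqr_ge0. Qed.

Lemma r2_coord n y (i : 'I_n) : y i ^+ 2 <= r2 n y.
Proof. by rewrite /r2 (bigD1 i)//= lerDl sumr_ge0// => j _; exact: sqr_ge0. Qed.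

Lemma mfam_r2 n : mfam (r2 n).
Proof. by apply: mfam_sum => i; apply: mfamX; exact: mfam_coord. Qed.

Lemma mfam_mono n al : mfam (mono n al).
Proof. by apply: mfam_prod => i; apply: mfamX; exact: mfam_coord. Qed.

Lemma box_ball n (s : R) y : r2 n y <= s -> box n (1 + `|s|) y = 1.
Proof.
move=> ys; rewrite /box big1// => i _.
suff -> : `|y i| <= 1 + `|s| by [].
have := le_trans (r2_coord y i) ys; rewrite -real_normK ?num_real// => h.
have := normr_ge0 (y i); have := ler_norm s; have := normr_ge0 s; nra.
Qed.

Lemma nice_ball n (s B : R) G : mfam G -> (forall y, r2 n y <= s -> `|G y| <= B) ->
  nice n (fun y => (r2 n y <= s)%R%:R * G y).
Proof.
move=> mG bG; split.
  by apply: mfamM => //; apply: mfam_ler; [exact: mfam_r2|exact: mfam_cst].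
exists `|B|, (1 + `|s|) => y; case: (leP (r2 n y) s) => ys.
  by rewrite mulr1n mul1r box_ball// mulr1 (le_trans (bG _ ys))// ler_norm.
by rewrite mulr0n mul0r normr0 mulr_ge0// box_ge0.
Qed.

Lemma mono_bound n al (s : R) y : r2 n y <= s -> `|mono n al y| <= (1 + `|s|) ^+ deg n al.
Proof.
move=> ys; rewrite /mono normr_prod /deg expr_sum; apply: ler_prod => i _.
rewrite normr_ge0/= normrX lerXn2r ?nnegrE// ?addr_ge0//.
have := le_trans (r2_coord y i) ys; rewrite -real_normK ?num_real// => h.
have := normr_ge0 (y i); have := ler_norm s; have := normr_ge0 s; nra.
Qed.

Lemma nice_ballm n al s : nice n (fun y => (r2 n y <= s)%R%:R * mono n al y).
Proof. by apply: nice_ball; [exact: mfam_mono|exact: mono_bound]. Qed.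

Lemma r2_scale n (c : R) y : r2 n (fun i => c * y i) = c ^+ 2 * r2 n y.
Proof. by rewrite /r2 mulr_sumr; apply: eq_bigr => i _; rewrite exprMn. Qed.

Lemma mono_scale n al (c : R) y : mono n al (fun i => c * y i) = c ^+ deg n al * mono n al y.
Proof.
by rewrite /mono /deg expr_sum -big_split/=; apply: eq_bigr => i _; rewrite exprMn.
Qed.

Lemma ballm_scale n al (s : R) : 0 <= s ->
  ballm n al s = Num.sqrt s ^+ (deg n al + n) * ballm n al 1.
Proof.
rewrite le_eqVlt => /predU1P[<-|s0].
  rewrite sqrtr0; case: n => [|n].
    by rewrite /ballm /deg /r2 /= !big_ord0 expr0 mul1r lexx ler01.
  rewrite addnS exprS !mul0r /ballm -[RHS](mul0r (iint n.+1 (fun=> 0))) -iintZ; last exact: nice0.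
  apply: eq_iint_off0.
  - by have [] := nice_ballm n.+1 al 0.
  - exact: mfam_cst.
  - move=> y y0; rewrite mul0r.
    suff -> : (r2 n.+1 y <= 0) = false by rewrite mul0r.
    apply/negbTE; rewrite -ltNge; apply: lt_le_trans (r2_coord y ord0).
    by rewrite exprn_even_gt0.
have c0 : 0 < Num.sqrt s by rewrite sqrtr_gt0.
rewrite /ballm (iint_scale c0 (nice_ballm n al s)) addnC exprD -mulrA; congr (_ * _).
rewrite -iintZ; last exact: nice_ballm.
apply: eq_iint => y; rewrite r2_scale mono_scale sqr_sqrtr; last exact: ltW.
have -> : (s * r2 n y <= s) = (r2 n y <= 1) by rewrite -[X in _ <= X]mulr1 ler_pM2l.
by rewrite mulrCA.
Qed.

Lemma r2_upd n y t : r2 n.+1 (upd y n t) = r2 n y + t ^+ 2.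
Proof.
rewrite /r2 big_ord_recr/= {2}/upd eqxx; congr (_ + _).
by apply: eq_bigr => i _; rewrite /upd ltn_eqF.
Qed.

Lemma mono_upd n al y t : mono n.+1 al (upd y n t) = t ^+ al n * mono n al y.
Proof.
rewrite /mono big_ord_recr/= {2}/upd eqxx mulrC; congr (_ * _).
by apply: eq_bigr => i _; rewrite /upd ltn_eqF.
Qed.

Lemma ballm_lt0 n al (s : R) : s < 0 -> ballm n al s = 0.
Proof.
move=> s0; rewrite /ballm -[RHS](mul0r (iint n (fun=> 0))) -iintZ; last exact: nice0.
apply: eq_iint => y.
by rewrite mul0r (lt_geF (lt_le_trans s0 (r2_ge0 n y))) mul0r.
Qed.

Definition ball1 n al := ballm n al 1.

(** Each slice is a smaller ball; homogeneity of the monomial pulls out the power of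
    [sqrt (1 - t^2)] that [betaf] integrates. *)
Lemma ball1S n al : ball1 n.+1 al = Bint (al n) (deg n al + n) * ball1 n al.
Proof.
have I : mu.-integrable setT (EFin \o (betaf (al n) (deg n al + n) \_ `[(-1), 1])).
  rewrite -restrict_EFin; apply/integrable_restrict => //=.
  by rewrite setTI; exact: betaf_integrable.
rewrite /Bint Rintegral_mkcond -(RintegralZr _ _ I)//.
rewrite {1}/ball1 /ballm iintS.
apply: eq_Rintegral => t _.
transitivity (t ^+ al n * ballm n al (1 - t ^+ 2)).
  rewrite -iintZ; last exact: nice_ballm.
  by apply: eq_iint => y; rewrite r2_upd mono_upd -lerBrDr mulrCA.
rewrite patchE mem_setE in_itv/= -ler_norml.
have E : (`|t| <= 1) = (0 <= 1 - t ^+ 2).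
  by rewrite subr_ge0 -[t ^+ 2]real_normK ?num_real// expr_le1.
rewrite E; case: leP => h; last by rewrite ballm_lt0// mulr0 mul0r.
by rewrite ballm_scale// /betaf mulrA.
Qed.

Definition upda al (i v : nat) : nat -> nat := fun j => if j == i then v else al j.

Lemma deg_upda n al (i : 'I_n) v : (deg n (upda al i v) + al i = deg n al + v)%N.
Proof.
rewrite /deg (bigD1 i)//= [in RHS](bigD1 i)//= /upda eqxx.
rewrite (eq_bigr (fun j : 'I_n => al j)); first by lia.
by move=> j ji; rewrite (inj_eq val_inj) (negbTE ji).
Qed.

Lemma eq_ball1 n al al' : (forall i, (i < n)%N -> al i = al' i) -> ball1 n al = ball1 n al'.
Proof.
move=> E; apply: eq_iint => y; congr (_ * _); apply: eq_bigr => i _; by rewrite E.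
Qed.

(** Slice off the last coordinate. If it is [i], the Beta recurrence in [p] applies; otherwise
    induction lowers the degree of the other factor by two and the Beta recurrence in [q]
    compensates. For [al i = 1] both sides are zero. *)
Lemma ball1_rec n al i : (i < n)%N -> (0 < al i)%N ->
  (deg n al + n)%:R * ball1 n al = (al i).-1%:R * ball1 n (upda al i (al i).-2).
Proof.
elim: n => [//|n IH] /= /[!ltnS] lin ai.
rewrite !ball1S; move: lin; rewrite leq_eqVlt => /predU1P[iE|lin].
  subst i; rewrite [in RHS]/upda eqxx.
  have dE : deg n (upda al n (al n).-2) = deg n al.
    by apply: eq_bigr => j _; rewrite /upda ltn_eqF.
  rewrite dE (@eq_ball1 n (upda al n (al n).-2) al); last first.
    by move=> j jn; rewrite /upda ltn_eqF.
  rewrite !mulrA; congr (_ * _).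
  have := Bint_rec (al n).-1 (deg n al + n).
  rewrite prednK// => <-; congr (_%:R * _).
  by rewrite /deg big_ord_recr /= -/(deg n al); lia.
have {}IH := IH lin ai.
have dE := deg_upda al (Ordinal lin) (al i).-2.
have -> : upda al i (al i).-2 n = al n by rewrite /upda gtn_eqF.
have dS : (deg n.+1 al + n.+1 = al n + (deg n al + n) + 1)%N.
  by rewrite /deg big_ord_recr /= -/(deg n al); lia.
rewrite dS; move: IH dE => /=; case: (al i) ai => [//|[|a]] _ /=.
  rewrite mul0r => /eqP; rewrite mulf_eq0 => /predU1P[|/eqP -> _]; last by rewrite !mulr0 mul0r.
  move=> /eqP; rewrite pnatr_eq0 addn_eq0 => /andP[_ /eqP n0].
  by rewrite n0 in lin.
set q' := deg n (upda _ _ _) => IH dE.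
have qE : (deg n al + n = (q' + n).+2)%N by lia.
rewrite qE in IH *.
have B2 := Bint_rec2 (al n) (q' + n).
rewrite [RHS]mulrCA -IH [RHS]mulrCA [RHS]mulrA -B2 -mulrA; congr (_%:R * _).
by lia.
Qed.

Lemma ball1_gt0 n al : (forall i, (i < n)%N -> al i = 0%N) -> 0 < ball1 n al.
Proof.
elim: n => [_|n IH al0].
  by rewrite /ball1 /ballm /= /r2 /mono !big_ord0 ler01 mul1r.
by rewrite ball1S al0// mulr_gt0// ?Bint_gt0// IH// => i lin; rewrite al0// ltnW.
Qed.

End Ball.

(** * Integration over the sphere *)

Section Sphere.
Context {R : realType} (d : nat) (d0 : (0 < d)%N).
Implicit Types (f g : ('I_d -> R) -> R) (y : nat -> R) (al : 'I_d -> nat).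

(** At the origin, division by zero yields the zero vector, the only value of [dirv] off the
    sphere. *)
Definition dirv y : 'I_d -> R := fun i => y i / Num.sqrt (r2 d y).
Definition vball : R := ball1 (R := R) d (fun=> 0%N).

Lemma vball_gt0 : 0 < vball. Proof. exact: ball1_gt0. Qed.

Lemma dotv_r2 y : dotv (@of_nat_fun R d y) (@of_nat_fun R d y) = r2 d y.
Proof. by apply: eq_bigr => i _; rewrite expr2. Qed.

Lemma sphere_intE f :
  sphere_int f = iint d (fun y => (r2 d y <= 1)%R%:R * f (dirv y)) / vball.
Proof.
rewrite /sphere_int /vball /ball1 /ballm; congr (_ / _); apply: eq_iint => y.
  rewrite /ball_ind /dirv /normv dotv_r2; congr (_ * _); by case: ifP.
rewrite /ball_ind dotv_r2 /mono big1 ?mulr1//; by case: ifP.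
Qed.

Definition snice f := mfam (fun y => f (dirv y)) /\ exists B, forall y, `|f (dirv y)| <= B.

Lemma snice_ball f (s : R) : snice f -> nice d (fun y => (r2 d y <= s)%R%:R * f (dirv y)).
Proof. by move=> [mf [B bf]]; apply: (@nice_ball _ _ _ B). Qed.

Lemma dirv_cases y : (r2 d y = 0 /\ dirv y = (fun=> 0)) \/ (0 < r2 d y /\ on_sphere (dirv y)).
Proof.
have := r2_ge0 d y; rewrite le_eqVlt => /predU1P[E|r0]; [left|right]; split => //.
  by apply/funext => i; rewrite /dirv -E sqrtr0 invr0 mulr0.
rewrite /on_sphere /dotv /dirv.
under eq_bigr do rewrite mulrACA -expr2 -expr2 exprVn sqr_sqrtr ?(ltW r0)//.
by rewrite -mulr_suml -/(r2 d y) divff// gt_eqF.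
Qed.

Lemma dotv_dirv_le1 y : dotv (dirv y) (dirv y) <= 1.
Proof.
case: (dirv_cases y) => [[_ ->]|[_ ->]]//.
by rewrite /dotv big1// => i _; rewrite mulr0.
Qed.

(** Off the sphere [dirv] takes only the value 0, so the two compositions differ by a constant on
    the set [r2 d y <= 0]. *)
Lemma snice_eq f g : (forall x, on_sphere x -> f x = g x) -> snice g -> snice f.
Proof.
move=> fg [mg [B bg]].
pose c : R := f (fun=> 0) - g (fun=> 0).
have E y : f (dirv y) = g (dirv y) + (r2 d y <= 0)%R%:R * c.
  case: (dirv_cases y) => [[E ->]|[r0 /fg ->]].
    by rewrite E lexx mul1r /c addrC subrK.
  by rewrite (lt_geF r0) mulr0n mul0r addr0.
split.
  rewrite (_ : (fun y => _) = (fun y => g (dirv y) + (r2 d y <= 0)%R%:R * c)); last exact/funext.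
  apply: mfamD => //; apply: mfamM; last exact: mfam_cst.
  by apply: mfam_ler; [exact: mfam_r2|exact: mfam_cst].
exists (B + `|c|) => y; rewrite E; apply: le_trans (ler_normD _ _) _; apply: lerD => //.
by case: (r2 d y <= 0); rewrite ?mul1r// mulr0n mul0r normr0.
Qed.

Lemma sphere_int_eq f g : (forall x, on_sphere x -> f x = g x) -> snice g ->
  sphere_int f = sphere_int g.
Proof.
move=> fg ng; rewrite !sphere_intE; congr (_ / _).
have gen n F G : (0 < n)%N -> mfam F -> mfam G ->
    (forall y : nat -> R, y 0%N != 0 -> F y = G y) -> iint n F = iint n G.
  by case: n => // n _; exact: eq_iint_off0.
apply: gen => //.
- by have [] := snice_ball 1 (snice_eq fg ng).
- by have [] := snice_ball 1 ng.
move=> y y0; case: (dirv_cases y) => [[E _]|[_ /fg ->//]].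
have := r2_coord y (Ordinal d0); rewrite E /= => h.
by have : 0 < y 0%N ^+ 2; [rewrite exprn_even_gt0|rewrite ltNge h].
Qed.

Lemma snice_cst (c : R) : snice (fun=> c).
Proof. by split; [exact: mfam_cst|exists `|c|]. Qed.

Lemma sniceD f g : snice f -> snice g -> snice (fun x => f x + g x).
Proof.
move=> [mf [B bf]] [mg [C bg]]; split; first exact: mfamD.
by exists (B + C) => y; apply: le_trans (ler_normD _ _) (lerD _ _).
Qed.

Lemma sniceM f g : snice f -> snice g -> snice (fun x => f x * g x).
Proof.
move=> [mf [B bf]] [mg [C bg]]; split; first exact: mfamM.
by exists (B * C) => y; rewrite normrM; apply: ler_pM.
Qed.

Lemma sniceX f n : snice f -> snice (fun x => f x ^+ n).
Proof.
move=> nf; elim: n => [|n IH]; first by under eq_fun do rewrite expr0; exact: snice_cst.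
by under eq_fun do rewrite exprS; exact: sniceM.
Qed.

Lemma snice_sum (I : Type) (r : seq I) (F : I -> ('I_d -> R) -> R) :
  (forall i, snice (F i)) -> snice (fun x => \sum_(i <- r) F i x).
Proof.
move=> nF; elim: r => [|i r IH].
  by under eq_fun do rewrite big_nil; exact: snice_cst.
by under eq_fun do rewrite big_cons; exact: sniceD.
Qed.

Lemma snice_prod (I : Type) (r : seq I) (F : I -> ('I_d -> R) -> R) :
  (forall i, snice (F i)) -> snice (fun x => \prod_(i <- r) F i x).
Proof.
move=> nF; elim: r => [|i r IH].
  by under eq_fun do rewrite big_nil; exact: snice_cst.
by under eq_fun do rewrite big_cons; exact: sniceM.
Qed.

Lemma ball_coord (x : 'I_d -> R) i : dotv x x <= 1 -> `|x i| <= 1.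
Proof.
move=> x1; rewrite -(@expr_le1 _ 2)// real_normK ?num_real//.
apply: le_trans x1; rewrite /dotv (bigD1 i)//= -expr2 lerDl sumr_ge0// => j _.
by rewrite -expr2 sqr_ge0.
Qed.

Lemma snice_coord i : snice (fun x => x i).
Proof.
split.
  apply: mfamM; first exact: mfam_coord.
  apply: mfam_inv_ge0 => [y|]; first exact: sqrtr_ge0.
  exact/mfam_sqrt/mfam_r2.
by exists 1 => y; apply: ball_coord; exact: dotv_dirv_le1.
Qed.

Lemma snice_monom al : snice (monom al).
Proof. by apply: snice_prod => i; apply: sniceX; exact: snice_coord. Qed.

Lemma snice_polyfun c : snice (polyfun (R := R) (d := d) c).
Proof.
by apply: snice_sum => t; apply: sniceM; [exact: snice_cst|exact: snice_monom].
Qed.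

Lemma snice_dot (x : 'I_d -> R) : snice (dotv x).
Proof. by apply: snice_sum => i; apply: sniceM; [exact: snice_cst|exact: snice_coord]. Qed.

Lemma sphere_intD f g : snice f -> snice g ->
  sphere_int (fun x => f x + g x) = sphere_int f + sphere_int g.
Proof.
move=> nf ng; rewrite !sphere_intE -mulrDl; congr (_ / _).
rewrite -iintD; try exact: snice_ball.
by apply: eq_iint => y; rewrite mulrDr.
Qed.

Lemma sphere_intZ f (c : R) : snice f -> sphere_int (fun x => c * f x) = c * sphere_int f.
Proof.
move=> nf; rewrite !sphere_intE mulrA; congr (_ / _).
rewrite -iintZ; try exact: snice_ball.
by apply: eq_iint => y; rewrite mulrCA.
Qed.

Lemma sphere_int_cst (c : R) : sphere_int (d := d) (fun=> c) = c.
Proof.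
have -> : sphere_int (d := d) (fun=> c) = c * sphere_int (d := d) (fun=> 1).
  by rewrite -sphere_intZ ?mulr1//; exact: snice_cst.
rewrite sphere_intE [X in X / _](_ : _ = vball) ?divff ?mulr1 ?gt_eqF ?vball_gt0//.
by apply: eq_iint => y; rewrite /mono big1.
Qed.

Lemma sphere_int_sum (I : Type) (r : seq I) (F : I -> ('I_d -> R) -> R) :
  (forall i, snice (F i)) ->
  sphere_int (fun x => \sum_(i <- r) F i x) = \sum_(i <- r) sphere_int (F i).
Proof.
move=> nF; elim: r => [|i r IH].
  under eq_fun do rewrite big_nil.
  by rewrite big_nil sphere_int_cst.
under eq_fun do rewrite big_cons.
by rewrite big_cons sphere_intD// ?IH//; exact: snice_sum.
Qed.

Lemma sphere_int_ge0 f : (forall y, 0 <= f (dirv y)) -> 0 <= sphere_int f.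
Proof.
move=> f0; rewrite sphere_intE divr_ge0//; last exact/ltW/vball_gt0.
by apply: iint_ge0 => y; rewrite mulr_ge0.
Qed.

Lemma sphere_int_bound f (B : R) : snice f ->
  (forall x, dotv x x <= 1 -> `|f x| <= B) -> `|sphere_int f| <= B.
Proof.
move=> nf bf; rewrite ler_norml; apply/andP; split.
  rewrite -subr_ge0 opprK -[B in X in _ <= X]sphere_int_cst -sphere_intD//; last exact: snice_cst.
  apply: sphere_int_ge0 => y; have := bf _ (dotv_dirv_le1 y).
  by rewrite ler_norml -subr_ge0 opprK => /andP[].
rewrite -subr_ge0 -mulN1r -sphere_intZ// -[B in X in _ <= X]sphere_int_cst -sphere_intD//.
- apply: sphere_int_ge0 => y; have := bf _ (dotv_dirv_le1 y).
  by rewrite ler_norml mulN1r subr_ge0 => /andP[].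
- exact: snice_cst.
- by apply: sniceM => //; exact: snice_cst.
Qed.

Lemma dirv_scale (c : R) y : 0 < c -> dirv (fun i => c * y i) = dirv y.
Proof.
move=> c0; apply/funext => i; rewrite /dirv r2_scale sqrtrM ?sqr_ge0// sqrtr_sqr gtr0_norm//.
by rewrite -mulf_div divff ?mul1r// gt_eqF.
Qed.

(** Dilation by [c] multiplies the two ball integrals by [c^(m+d)] and [c^d], so the shell
    [1 < |y| <= c] carries [(c^(m+d) - 1) N] and [(c^d - 1) F]. On it the integrands differ by at
    most [(c^m - 1) B], which makes the difference of second order in [c - 1]. Dividing by [c - 1]
    and letting [c] tend to 1 leaves the identity. *)
Lemma polar f m : snice f ->
  (m + d)%:R * iint d (fun y => (r2 d y <= 1)%R%:R * (Num.sqrt (r2 d y) ^+ m * f (dirv y)))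
  = d%:R * iint d (fun y => (r2 d y <= 1)%R%:R * f (dirv y)).
Proof.
move=> nf; have [mf [B bf]] := nf.
set N := iint d _; set F := iint d _.
have B0 : 0 <= B := le_trans (normr_ge0 _) (bf (fun=> 0)).
pose h y := Num.sqrt (r2 d y) ^+ m * f (dirv y).
have mh : mfam h by apply: mfamM => //; apply/mfamX/mfam_sqrt/mfam_r2.
have nh s : nice d (fun y => (r2 d y <= s)%R%:R * h y).
  apply: (@nice_ball _ _ _ (Num.sqrt s ^+ m * B)) => // y ys.
  rewrite normrM; apply: ler_pM => //; rewrite normrX ger0_norm ?sqrtr_ge0//.
  by rewrite lerXn2r ?nnegrE ?sqrtr_ge0// ler_wsqrtr.
have n1 s : nice d (fun y : nat -> R => (r2 d y <= s)%R%:R * 1).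
  by apply: (@nice_ball _ _ _ 1) => [|y _]; [exact: mfam_cst|rewrite normr1].
have VE : iint d (fun y : nat -> R => (r2 d y <= 1)%R%:R * 1) = vball.
  by apply: eq_iint => y; rewrite /mono big1.
have r2c (c : R) y : 0 < c -> (r2 d (fun i => c * y i) <= c ^+ 2) = (r2 d y <= 1).
  by move=> c0; rewrite r2_scale -[X in _ <= X]mulr1 ler_pM2l// exprn_gt0.
have Nc (c : R) : 0 < c -> iint d (fun y => (r2 d y <= c ^+ 2)%R%:R * h y) = c ^+ (m + d) * N.
  move=> c0; rewrite (iint_scale c0 (nh _)) addnC exprD -mulrA; congr (_ * _).
  rewrite -iintZ; last exact: nh.
  apply: eq_iint => y; rewrite r2c// /h dirv_scale// r2_scale sqrtrM ?sqr_ge0//.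
  by rewrite sqrtr_sqr gtr0_norm// exprMn; ring.
have Fc (c : R) : 0 < c -> iint d (fun y => (r2 d y <= c ^+ 2)%R%:R * f (dirv y)) = c ^+ d * F.
  move=> c0; rewrite (iint_scale c0 (snice_ball _ nf)); congr (_ * _).
  by apply: eq_iint => y; rewrite r2c// dirv_scale.
have Vc (c : R) : 0 < c -> iint d (fun y => (r2 d y <= c ^+ 2)%R%:R * 1) = c ^+ d * vball.
  move=> c0; rewrite (iint_scale c0 (n1 _)) -VE; congr (_ * _).
  by apply: eq_iint => y; rewrite r2c.
have key (c : R) : 1 < c ->
    `|(c ^+ (m + d) - 1) * N - (c ^+ d - 1) * F| <= (c ^+ m - 1) * B * ((c ^+ d - 1) * vball).
  move=> c1; have c0 : 0 < c := lt_trans ltr01 c1.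
  pose S G : R := iint d (fun y => (r2 d y <= c ^+ 2)%R%:R * G y - (r2 d y <= 1)%R%:R * G y).
  have -> : (c ^+ (m + d) - 1) * N = S h by rewrite mulrBl mul1r -Nc// -iintB.
  have -> : (c ^+ d - 1) * F = S (fun y => f (dirv y)).
    by rewrite mulrBl mul1r -Fc// -iintB//; exact: snice_ball.
  have -> : (c ^+ d - 1) * vball = S (fun=> 1) by rewrite mulrBl mul1r -Vc// -VE -iintB.
  have nS := niceB (nh (c ^+ 2)) (nh 1).
  have nT := niceB (snice_ball (c ^+ 2) nf) (snice_ball 1 nf).
  have nU := niceB (n1 (c ^+ 2)) (n1 1).
  have pw y : `|((r2 d y <= c ^+ 2)%R%:R * h y - (r2 d y <= 1)%R%:R * h y) -
      ((r2 d y <= c ^+ 2)%R%:R * f (dirv y) - (r2 d y <= 1)%R%:R * f (dirv y))| <=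
      (c ^+ m - 1) * B * ((r2 d y <= c ^+ 2)%R%:R * 1 - (r2 d y <= 1)%R%:R * 1).
    case: (leP (r2 d y) 1) => y1.
      have -> : r2 d y <= c ^+ 2 by apply: le_trans y1 _; apply: exprn_ege1; exact: ltW.
      by rewrite !mul1r !subrr normr0 mulr0.
    case: (leP (r2 d y) (c ^+ 2)) => yc; last first.
      by rewrite !mulr0n !mul0r !subrr normr0 mulr0.
    rewrite !mulr0n !mul0r !subr0 !mulr1n !mul1r mulr1 /h -[X in _ - X]mul1r -mulrBl normrM.
    have s1 : 1 <= Num.sqrt (r2 d y) by rewrite -sqrtr1 ler_wsqrtr// ltW.
    have sc : Num.sqrt (r2 d y) <= c.
      by rewrite -[leRHS]gtr0_norm// -sqrtr_sqr ler_wsqrtr.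
    apply: ler_pM => //; rewrite ger0_norm; last by rewrite subr_ge0 exprn_ege1.
    by rewrite lerD2r lerXn2r// nnegrE ?sqrtr_ge0// ltW.
  rewrite /S -iintB// -iintZ//; apply: iint_norm_le => //; [exact: niceB|exact: niceZ].
apply/eqP; rewrite -subr_eq0 -normr_le0.
(* The inequality [key] divided by [c - 1] by means of geometric sums; its limit at 1 is minus the
   absolute value to be shown zero. *)
pose g (c : R) := (c ^+ m - 1) * B * ((\sum_(i < d) c ^+ i) * vball) -
  `|(\sum_(i < m + d) c ^+ i) * N - (\sum_(i < d) c ^+ i) * F|.
have g0 c : 1 < c -> 0 <= g c.
  move=> c1; rewrite subr_ge0; have c10 : 0 < c - 1 by rewrite subr_gt0.
  have := key c c1; rewrite (subrX1 c d) (subrX1 c (m + d)).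
  rewrite -![(c - 1) * _ * _]mulrA -mulrBr normrM gtr0_norm// mulrCA.
  by rewrite ler_pM2l.
have cX n : (fun c : R => \sum_(i < n) c ^+ i) @ 1^'+ --> (n%:R : R).
  have -> : n%:R = \sum_(i < n) (1 : R) ^+ i.
    by rewrite (eq_bigr (fun=> 1)) ?sumr_const ?card_ord// => i _; rewrite expr1n.
  by apply: cvg_finsum => i; apply: cvg_at_right_filter; exact: exprn_continuous.
have cg : g @ 1^'+ --> (1 ^+ m - 1) * B * (d%:R * vball) - `|(m + d)%:R * N - d%:R * F|.
  apply: cvgB.
    apply: cvgM; last by apply: cvgM => //; exact: cvg_cst.
    apply: cvgM; last exact: cvg_cst.
    by apply: cvgB; [apply: cvg_at_right_filter; exact: exprn_continuous|exact: cvg_cst].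
  by apply: cvg_norm; apply: cvgB; apply: cvgM => //; exact: cvg_cst.
rewrite expr1n subrr !mul0r sub0r in cg.
rewrite -oppr_ge0; apply: (@cvgr_to_ge _ _ _ _ _ _ _ cg).
by near=> c; apply: g0; near: c; exact: nbhs_right_gt.
Unshelve. all: by end_near. Qed.

Definition extal al : nat -> nat := fun i => if insub i is Some j then al j else 0%N.

Lemma extalE al (i : 'I_d) : extal al i = al i.
Proof. by rewrite /extal valK. Qed.

Lemma sphere_int_monom al :
  sphere_int (monom al) = (\sum_i al i + d)%:R * ball1 d (extal al) / (d%:R * vball).
Proof.
have := polar (\sum_i al i)%N (snice_monom al).
set F := iint d (fun y => _ * monom al (dirv y)) => P.
rewrite sphere_intE -/F invfM mulrA; congr (_ / _).
have dn0 : d%:R != 0 :> R by rewrite pnatr_eq0 -lt0n.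
apply: (mulfI dn0); rewrite -P mulrCA mulfV// mulr1; congr (_ * _).
apply: eq_iint => y; congr (_ * _).
rewrite /monom /mono expr_sum -big_split/=; apply: eq_bigr => i _.
rewrite extalE -exprMn /dirv; congr (_ ^+ _).
have := r2_ge0 d y; rewrite le_eqVlt => /predU1P[E|r0].
  rewrite -E sqrtr0 mul0r; apply/esym/eqP; rewrite -sqrf_eq0 eq_le sqr_ge0 andbT.
  by rewrite E; exact: r2_coord.
by rewrite mulrC divfK// gt_eqF// sqrtr_gt0.
Qed.

Definition lowal al (i : 'I_d) : 'I_d -> nat := fun j => if j == i then (al j).-2 else al j.

(** Sphere moments are ball moments times [|al| + d]. This cancels the factor in [ball1_rec], and
    the lowered exponent, of degree smaller by two, brings in [|al| + d - 2]. *)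
Lemma sphere_int_monom_rec al (i : 'I_d) : (0 < al i)%N ->
  (\sum_j al j + d - 2)%:R * sphere_int (monom (R := R) al) =
  (al i).-1%:R * sphere_int (monom (lowal al i)).
Proof.
move=> ai; rewrite !sphere_int_monom !mulrA.
congr (_ / _).
have D a : deg d (extal a) = (\sum_j a j)%N by apply: eq_bigr => j _; rewrite extalE.
have := @ball1_rec R d (extal al) i (ltn_ord i); rewrite extalE D => /(_ ai) E.
have lE : ball1 d (extal (lowal al i)) = ball1 (R := R) d (upda (extal al) i (al i).-2).
  apply: eq_ball1 => j jd; rewrite -[j]/(val (Ordinal jd)) extalE /lowal /upda extalE.
  by rewrite (inj_eq val_inj (Ordinal jd) i); case: eqP => // ->.
have := deg_upda (extal al) i (al i).-2.
have -> : deg d (upda (extal al) i (al i).-2) = (\sum_j lowal al i j)%N.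
  rewrite -D; apply: eq_bigr => j _; rewrite extalE /lowal /upda extalE (inj_eq val_inj).
  by case: eqP => // ->.
rewrite extalE D lE -mulrA E => dE.
case: (al i) ai E dE => [//|[|a]] _ /= E dE; first by rewrite mul0r mulr0 !mul0r.
move: dE; set A := (\sum_j lowal al i j)%N; set A' := (\sum_j al j)%N => dE.
have -> : (A' + d - 2 = A + d)%N by lia.
by rewrite mulrCA mulrA.
Qed.

End Sphere.

(** * Eigenvalues of the monomial kernels *)

Section Lam.
Context {R : realType} (d : nat) (hd : (1 < d)%N).

(** With [n = k + 2j], the solution of the recurrence [lam_green] is
    [n! / (2^j j! d (d+2) ... (d + 2(k+j-1)))]; for [k = 0], [j = 1] it is the mean [1/d] of a
    squared coordinate. *)
Definition lamden (k j : nat) : nat := (2 ^ j * j`! * \prod_(i < k + j) (d + i.*2))%N.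

Definition lamj (k j : nat) : R := (k + j.*2)`!%:R / (lamden k j)%:R.

(* The eigenvalue of the zonal kernel [t ^ n] on spherical harmonics of degree [k]. *)
Definition lam (n k : nat) : R :=
  if (k <= n)%N && ~~ odd (n - k) then lamj k (n - k)./2 else 0.

Let dpos (m : nat) : (d + m)%:R != 0 :> R.
Proof. by rewrite pnatr_eq0 addn_eq0 negb_and -lt0n (ltn_trans _ hd). Qed.

Lemma lamj_gt0 k j : 0 < lamj k j.
Proof.
rewrite /lamj divr_gt0 ?ltr0n ?fact_gt0// !muln_gt0 expn_gt0 fact_gt0/=.
by rewrite prodn_gt0// => i; rewrite addn_gt0 (ltn_trans _ hd).
Qed.

Lemma lamden_neq0 k j : (lamden k j)%:R != 0 :> R.
Proof.
rewrite pnatr_eq0 -lt0n !muln_gt0 expn_gt0 fact_gt0/=.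
by rewrite prodn_gt0// => i; rewrite addn_gt0 (ltn_trans _ hd).
Qed.

Lemma lamjSl k j : (d + (k + j).*2)%:R * lamj k.+1 j = (k + j.*2).+1%:R * lamj k j.
Proof.
rewrite /lamj addSn factS.
have -> : lamden k.+1 j = (lamden k j * (d + (k + j).*2))%N.
  by rewrite /lamden addSn big_ord_recr/= mulnA.
move: (dpos (k + j).*2) (lamden_neq0 k j).
move: (d + (k + j).*2)%N (lamden k j) => a b a0 b0; rewrite !natrM; field.
by rewrite ?a0 ?b0.
Qed.

Lemma lamjSr k j : (j.+1.*2)%:R * (d + (k + j).*2)%:R * lamj k j.+1 =
  (k + j.*2).+1%:R * (k + j.*2).+2%:R * lamj k j.
Proof.
rewrite /lamj.
have -> : (k + j.+1.*2 = (k + j.*2).+2)%N by lia.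
have -> : lamden k j.+1 = (j.+1.*2 * (d + (k + j).*2) * lamden k j)%N.
  rewrite /lamden addnS factS big_ord_recr/= expnS -muln2.
  by move: (2 ^ j)%N j`! (\prod_(_ < _) _)%N (d + _)%N j.+1 => x y z u v; lia.
rewrite !factS; move: (dpos (k + j).*2) (lamden_neq0 k j).
have : j.+1.*2%:R != 0 :> R by rewrite pnatr_eq0.
move: (d + (k + j).*2)%N (lamden k j) j.+1.*2 => a b c c0 a0 b0; rewrite !natrM; field.
by rewrite ?a0 ?b0 ?c0.
Qed.

Lemma lam_ge0 n k : 0 <= lam n k.
Proof. by rewrite /lam; case: ifP => // _; exact/ltW/lamj_gt0. Qed.

Lemma lamE k j : lam (k + j.*2) k = lamj k j.
Proof. by rewrite /lam leq_addr addKn odd_double doubleK. Qed.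

Lemma lam_diag_gt0 k : 0 < lam k k.
Proof. by rewrite -[X in lam X]addn0 -double0 lamE lamj_gt0. Qed.

Lemma lam_lt n k : (n < k)%N -> lam n k = 0.
Proof. by rewrite /lam ltnNge => /negbTE ->. Qed.

Lemma lam_odd n k : odd (n + k) -> lam n k = 0.
Proof.
by move=> o; rewrite /lam; case: leqP => //= kn; rewrite oddB// -oddD o.
Qed.

Lemma lam_cases n k : (exists j, n = (k + j.*2)%N) \/ (n < k)%N \/ odd (n + k).
Proof.
case: (ltnP n k) => kn; first by right; left.
case: (boolP (odd (n + k))) => o; first by right; right.
left; exists (n - k)./2; rewrite -[X in (_ + X)%N]odd_double_half.
lia.
Qed.

Lemma lam00 : lam 0 0 = 1.
Proof. by rewrite -[X in lam X]addn0 -double0 lamE /lamj /lamden big_ord0 divff// pnatr_eq0. Qed.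

(** For [n = k + 2j] the two terms on the right are the shares [2j] and [2k] of the factor
    [n + k]. *)
Lemma lam_green n k : (n + k)%:R * (n + k + d - 2)%:R * lam n k =
  (n * n.-1)%:R * lam n.-2 k + (n * k).*2%:R * lam n.-1 k.-1.
Proof.
case: (lam_cases n k) => [[j ->]|H]; last first.
  have -> : lam n k = 0 by case: H => [/lam_lt//|/lam_odd//].
  rewrite mulr0; case: n H => [|n] H; first by rewrite !mul0r addr0.
  have -> : (n.+1 * k).*2%:R * lam n.+1.-1 k.-1 = 0.
    case: k H => [|k] H; first by rewrite muln0 double0 mul0r.
    rewrite /= [lam n k](_ : _ = 0) ?mulr0//.
    case: H => [?|H]; [exact: lam_lt|apply: lam_odd; lia].
  case: n H => [|n] H; first by rewrite muln0 mul0r addr0.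
  rewrite /= [lam n k](_ : _ = 0) ?mulr0 ?addr0//.
  case: H => [?|H]; [apply: lam_lt; lia|apply: lam_odd; lia].
rewrite lamE.
have T1 : ((k + j.*2) * (k + j.*2).-1)%:R * lam (k + j.*2).-2 k =
    j.*2%:R * (k + j.*2 + k + d - 2)%:R * lamj k j.
  case: j => [|j].
    rewrite double0 mul0r mul0r addn0; case: k => [|[|k]]; rewrite ?mul0n ?muln0 ?mul0r//.
    by rewrite lam_lt ?mulr0//=; lia.
  have -> : ((k + j.+1.*2).-2 = k + j.*2)%N by lia.
  rewrite lamE; have := lamjSr k j.
  have -> : (d + (k + j).*2 = k + j.+1.*2 + k + d - 2)%N by lia.
  move=> ->; rewrite -natrM; congr (_%:R * _); lia.
have T2 : ((k + j.*2) * k).*2%:R * lam (k + j.*2).-1 k.-1 =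
    k.*2%:R * (k + j.*2 + k + d - 2)%:R * lamj k j.
  case: k {T1} => [|k]; first by rewrite muln0 double0 !mul0r.
  have -> : ((k.+1 + j.*2).-1 = k + j.*2)%N by lia.
  rewrite lamE -mulrA.
  have -> : (k.+1 + j.*2 + k.+1 + d - 2 = d + (k + j).*2)%N by lia.
  rewrite lamjSl mulrA -natrM; congr (_%:R * _); lia.
rewrite T1 T2 -mulrDl -mulrDl -natrD; congr (_%:R * _ * _); lia.
Qed.

(** Downward coefficient for multiplication by [t] on zonal polynomials. At [k = 1] the quotient
    would read 0/0 when [d = 2], so the value 1 is set by hand. *)
Definition Bk (k : nat) : R :=
  if (k <= 1)%N then 1 else (k + d - 3)%:R / (k.*2 + d - 4)%:R.

(** Effect of one more factor [t]. The weights are nonnegative with sum 1, so [lam n k] is the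
    probability that a certain walk on the naturals started at [k] sits at 0 after [n] steps; hence
    [lam_le1]. *)
Lemma lam_walk n k : lam n.+1 k =
  (if k is k'.+1 then k%:R / (d + k'.*2)%:R * lam n k' else 0) + Bk k.+1 * lam n k.+1.
Proof.
case: (lam_cases n.+1 k) => [[j E]|H]; last first.
  have -> : lam n.+1 k = 0 by case: H => [/lam_lt//|/lam_odd//].
  have -> : lam n k.+1 = 0 by case: H => H; [apply: lam_lt; lia|apply: lam_odd; lia].
  rewrite mulr0 addr0; case: k H => [//|k H].
  have -> : lam n k = 0 by case: H => H; [apply: lam_lt; lia|apply: lam_odd; lia].
  by rewrite mulr0.
rewrite E lamE.
case: j E => [|j] E.
  have nk : k = n.+1 by rewrite E double0 addn0.
  rewrite nk (@lam_lt n n.+2)// mulr0 addr0.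
  have := lamjSl n 0; rewrite double0 addn0 -[in lamj n 0]lamE double0 addn0 => H.
  apply: (mulfI (dpos n.*2)).
  by rewrite H mulrA [X in _ = X * _]mulrC divfK.
have L1 : lam n k.+1 = lamj k.+1 j.
  by rewrite -lamE; congr lam; lia.
rewrite L1; have hr := lamjSr k j; have hl := lamjSl k j.
have D1 := dpos (k + j).*2.
have J1 : (j.+1.*2)%:R != 0 :> R by rewrite pnatr_eq0.
case: k E L1 hr hl D1 => [|k] E L1 hr hl D1.
  rewrite add0r /Bk /= mul1r.
  apply: (mulfI D1); rewrite hl; apply: (mulfI J1); rewrite mulrA hr.
  by rewrite [RHS]mulrA [X in _ = X * _]mulrC; congr (_%:R * _%:R * _); lia.
have -> : lam n k = lamj k j.+1 by rewrite -lamE; congr lam; lia.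
have hl2 := lamjSl k j.+1.
rewrite /Bk /=.
have -> : (k.+2 + d - 3 = k + d - 1)%N by lia.
have -> : (k.+2.*2 + d - 4 = d + k.*2)%N by lia.
have D2 : (d + (k + j.+1).*2)%:R != 0 :> R by exact: dpos.
have D3 : (k + j.+1.*2).+1%:R != 0 :> R by rewrite pnatr_eq0.
have e1 : lamj k j.+1 = (d + (k + j.+1).*2)%:R / (k + j.+1.*2).+1%:R * lamj k.+1 j.+1.
  by apply: (mulfI D3); rewrite -hl2; field.
have D4 : (d + (k.+1 + j).*2)%:R != 0 :> R by exact: dpos.
have P1 : (k.+1 + j.*2).+1%:R != 0 :> R by rewrite pnatr_eq0.
have P2 : (k.+1 + j.*2).+2%:R != 0 :> R by rewrite pnatr_eq0.
have e2 : lamj k.+2 j = (j.+1.*2)%:R / (k.+1 + j.*2).+2%:R * lamj k.+1 j.+1.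
  apply: (mulfI D1); rewrite hl; apply: (mulfI P2).
  have -> : (k.+1 + j.*2).+2%:R * ((k.+1 + j.*2).+1%:R * lamj k.+1 j) =
    (k.+1 + j.*2).+1%:R * (k.+1 + j.*2).+2%:R * lamj k.+1 j by ring.
  by rewrite -hr; field.
rewrite e1 e2.
have D5 : (d + k.*2)%:R != 0 :> R by exact: dpos.
have -> : (k.+1 + j.*2).+2 = (k + j.+1.*2).+1 by lia.
have Hn : k.+1%:R * (d + (k + j.+1).*2)%:R + (k + d - 1)%:R * (j.+1.*2)%:R =
    (d + k.*2)%:R * (k + j.+1.*2).+1%:R :> R.
  rewrite -!natrM -!natrD; congr _%:R.
  have -> : d = (d - 1).+1 by lia.
  by move: (d - 1)%N => e; nia.
move: Hn D3 D5; move: (lamj _ _) k.+1%:R (d + (k + j.+1).*2)%:R (k + d - 1)%:R.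
move: (j.+1.*2)%:R (d + k.*2)%:R (k + j.+1.*2).+1%:R => J v u L k1 a q Hn u0 v0.
have -> : k1 / v * (a / u * L) + q / v * (J / u * L) = (k1 * a + q * J) / (v * u) * L.
  by field; rewrite u0 v0.
by rewrite Hn divff ?mul1r// mulf_neq0.
Qed.

Lemma lam_le1 n k : lam n k <= 1.
Proof.
elim: n k => [|n IH] k.
  by case: k => [|k]; [rewrite lam00|rewrite lam_lt].
rewrite lam_walk; case: k => [|k].
  by rewrite add0r /Bk /= mul1r.
rewrite /Bk /=.
have -> : (k.+2 + d - 3 = k + d - 1)%N by lia.
have -> : (k.+2.*2 + d - 4 = d + k.*2)%N by lia.
have D5 : (d + k.*2)%:R != 0 :> R by exact: dpos.
apply: (@le_trans _ _ (k.+1%:R / (d + k.*2)%:R * 1 + (k + d - 1)%:R / (d + k.*2)%:R * 1)).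
  by apply: lerD; apply: ler_wpM2l.
rewrite !mulr1 -mulrDl -natrD (_ : (k.+1 + (k + d - 1) = d + k.*2)%N); last by lia.
by rewrite divff.
Qed.

(** Together with [lam_shiftn] it reduces every term of [T_telescope] to a multiple of [lam n k]. *)
Lemma lam_shiftk n k : (n + k + d)%:R * lam n k.+2 = (n - k)%:R * lam n k.
Proof.
case: (lam_cases n k) => [[j E]|H]; last first.
  have -> : lam n k = 0 by case: H => [/lam_lt//|/lam_odd//].
  rewrite [lam n _](_ : _ = 0) ?mulr0//.
  by case: H => H; [apply: lam_lt; lia|apply: lam_odd; lia].
case: j E => [|j] E.
  by rewrite E double0 addn0 subnn mul0r lam_lt ?mulr0.
rewrite E lamE (_ : lam _ k.+2 = lamj k.+2 j); last by rewrite -lamE; congr lam; lia.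
have hr := lamjSr k j; have hl := lamjSl k j; have hl1 := lamjSl k.+1 j.
have D1 := dpos (k + j).*2.
rewrite addKn (_ : (k + j.+1.*2 + k + d = d + (k.+1 + j).*2)%N); last by lia.
rewrite hl1; apply: (mulfI D1); rewrite [RHS]mulrCA [RHS]mulrA hr mulrCA hl.
by rewrite mulrA [X in X * _ = _]mulrC; congr (_%:R * _%:R * _); lia.
Qed.

Lemma lam_shiftn n k : (k <= n)%N ->
  (n.+2 - k)%:R * (n + k + d)%:R * lam n.+2 k = n.+1%:R * n.+2%:R * lam n k.
Proof.
move=> kn; case: (lam_cases n k) => [[j E]|H]; last first.
  have -> : lam n k = 0 by case: H => [/lam_lt//|/lam_odd//].
  rewrite [lam _ _](_ : _ = 0) ?mulr0//.
  by case: H => H; [lia|apply: lam_odd; lia].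
rewrite E lamE (_ : lam _ k = lamj k j.+1); last by rewrite -lamE; congr lam; lia.
rewrite -lamjSr; congr (_%:R * _%:R * _); lia.
Qed.

End Lam.

(** * Harmonic polynomials *)

Section Rep.
Context {R : realType} (d : nat).
Notation rep := (seq (R * ('I_d -> nat))).
Implicit Types (c : rep) (x z : 'I_d -> R) (al : 'I_d -> nat) (i j : 'I_d).

Definition inc al i : 'I_d -> nat := fun j => if j == i then (al j).+1 else al j.
Definition dec al i : 'I_d -> nat := fun j => if j == i then (al j).-1 else al j.

Definition mulv i c : rep := [seq (t.1, inc t.2 i) | t <- c].
Definition scal (a : R) c : rep := [seq (a * t.1, t.2) | t <- c].
(** On values, [dotmul x] multiplies by [dotv x z] and [nmul] by [dotv z z]; [derx x] and [lapr] are
    the derivative along [x] and the Laplacian. All act on term lists, since [sph_harm] speaks of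
    such lists. *)
Definition dotmul x c : rep := flatten [seq scal (x i) (mulv i c) | i <- enum 'I_d].
Definition nmul c : rep := flatten [seq mulv i (mulv i c) | i <- enum 'I_d].
Definition derx x c : rep :=
  flatten [seq [seq (x i * (t.1 * (t.2 i)%:R), dec t.2 i) | t <- c] | i <- enum 'I_d].
Definition lapr c : rep :=
  flatten [seq [seq (t.1 * (t.2 i * (t.2 i).-1)%:R, lowal t.2 i) | t <- c] | i <- enum 'I_d].

Definition dcoord i c z : R := \sum_(t <- c) t.1 * ((t.2 i)%:R * monom (dec t.2 i) z).
Definition dirder x c z : R := \sum_i x i * dcoord i c z.

(** Terms with coefficient 0 are exempt: [derx] produces them, with an exponent of the wrong degree,
    where the truncated [dec] acts on exponent 0. *)
Definition whom (k : nat) c := forall t, t \in c -> t.1 != 0 -> (\sum_i t.2 i)%N = k.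

Lemma big_enum_ord (F : 'I_d -> R) : \sum_(i <- enum 'I_d) F i = \sum_i F i.
Proof. by rewrite big_enum. Qed.

Lemma polyfun_cat c c' z : polyfun (c ++ c') z = polyfun c z + polyfun c' z.
Proof. by rewrite /polyfun big_cat. Qed.

Lemma polyfun_lap_cat c c' z : polyfun_lap (c ++ c') z = polyfun_lap c z + polyfun_lap c' z.
Proof. by rewrite /polyfun_lap big_cat. Qed.

Lemma dcoord_cat i c c' z : dcoord i (c ++ c') z = dcoord i c z + dcoord i c' z.
Proof. by rewrite /dcoord big_cat. Qed.

Lemma polyfun_flatten (f : 'I_d -> rep) z :
  polyfun (flatten [seq f i | i <- enum 'I_d]) z = \sum_i polyfun (f i) z.
Proof. by rewrite /polyfun big_flatten/= big_map big_enum_ord. Qed.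

Lemma polyfun_lap_flatten (f : 'I_d -> rep) z :
  polyfun_lap (flatten [seq f i | i <- enum 'I_d]) z = \sum_i polyfun_lap (f i) z.
Proof. by rewrite /polyfun_lap big_flatten/= big_map big_enum_ord. Qed.

Lemma dcoord_flatten j (f : 'I_d -> rep) z :
  dcoord j (flatten [seq f i | i <- enum 'I_d]) z = \sum_i dcoord j (f i) z.
Proof. by rewrite /dcoord big_flatten/= big_map big_enum_ord. Qed.

Lemma polyfun_scal a c z : polyfun (scal a c) z = a * polyfun c z.
Proof. by rewrite /polyfun big_map mulr_sumr; apply: eq_bigr => t _; rewrite mulrA. Qed.

Lemma polyfun_lap_scal a c z : polyfun_lap (scal a c) z = a * polyfun_lap c z.
Proof. by rewrite /polyfun_lap big_map mulr_sumr; apply: eq_bigr => t _; rewrite -mulrA. Qed.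

Lemma dcoord_scal i a c z : dcoord i (scal a c) z = a * dcoord i c z.
Proof. by rewrite /dcoord big_map mulr_sumr; apply: eq_bigr => t _; rewrite -mulrA. Qed.

Lemma monomD1 i al z : monom al z = z i ^+ al i * \prod_(j | j != i) z j ^+ al j.
Proof. by rewrite /monom (bigD1 i). Qed.

Lemma monom_inc i al z : monom (inc al i) z = z i * monom al z.
Proof.
rewrite !(monomD1 i) /inc eqxx exprS -mulrA; congr (_ * (_ * _)).
by apply: eq_bigr => j /negbTE ->.
Qed.

Lemma monom_dec i al z : (al i)%:R * (z i * monom (dec al i) z) = (al i)%:R * monom al z.
Proof.
case: (posnP (al i)) => [->|a0]; first by rewrite !mul0r.
rewrite !(monomD1 i) /dec eqxx [z i * (_ * _)]mulrA -exprS prednK//; congr (_ * (_ * _)).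
by apply: eq_bigr => j /negbTE ->.
Qed.

Lemma monom_ext al al' z : al =1 al' -> monom al z = monom al' z.
Proof. by move=> /funext ->. Qed.

Lemma polyfun_mulv i c z : polyfun (mulv i c) z = z i * polyfun c z.
Proof.
rewrite /polyfun big_map mulr_sumr; apply: eq_bigr => t _ /=.
by rewrite monom_inc mulrCA.
Qed.

Lemma dcoord_mulv i j c z :
  dcoord j (mulv i c) z = (i == j)%:R * polyfun c z + z i * dcoord j c z.
Proof.
rewrite /dcoord /polyfun big_map !mulr_sumr -big_split/=; apply: eq_bigr => -[a al] _ /=.
rewrite [X in _ = X + _]mulrCA [X in _ = _ + X]mulrCA -mulrDr; congr (_ * _).
case: eqVneq => [<-|ij].
  rewrite /inc eqxx (@monom_ext _ al); last first.
    by move=> k; rewrite /dec; case: eqP => // ->; rewrite eqxx.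
  by rewrite mul1r mulrCA monom_dec -natr1 mulrDl mul1r addrC.
rewrite mul0r add0r {1}/inc eq_sym (negbTE ij) mulrCA; congr (_ * _).
rewrite -monom_inc; apply: monom_ext => k; rewrite /inc /dec.
case: (eqVneq k j) => // ->; by rewrite eq_sym (negbTE ij).
Qed.

Lemma lap_mulv i c z :
  polyfun_lap (mulv i c) z = z i * polyfun_lap c z + 2 * dcoord i c z.
Proof.
rewrite /dcoord /polyfun_lap big_map !mulr_sumr -big_split/=; apply: eq_bigr => -[a al] _ /=.
rewrite [X in _ = X + _]mulrCA [X in _ = _ + X]mulrCA -mulrDr; congr (_ * _).
rewrite (bigD1 i)//= [X in _ = _ * X + _](bigD1 i)//= mulrDr addrAC; congr (_ + _); last first.
  rewrite mulr_sumr; apply: eq_bigr => k ki.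
  rewrite /inc (negbTE ki) mulrCA; congr (_ * _); rewrite -monom_inc.
  apply: monom_ext => l; rewrite /inc; case: (eqVneq l k) => // ->.
  by rewrite (negbTE ki).
rewrite {1 2}/inc eqxx /=.
rewrite (@monom_ext _ (dec al i)); last first.
  by move=> l; rewrite /inc /dec; case: eqP => // ->; rewrite eqxx.
have E : (al i * (al i).-1)%:R * (z i * monom (fun j => if j == i then (al j).-2 else al j) z)
    = (al i * (al i).-1)%:R * monom (dec al i) z.
  have dE : dec al i i = (al i).-1 by rewrite /dec eqxx.
  have := monom_dec i (dec al i) z; rewrite dE => H.
  rewrite natrM -!mulrA; congr (_ * _); rewrite -H; congr (_ * (_ * _)).
  by apply: monom_ext => l; rewrite /dec; case: eqP.
rewrite [X in _ = X + _]mulrCA E mulrA -natrM -mulrDl -natrD; congr (_%:R * _).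
by case: (al i) => [|m] /=; lia.
Qed.

Lemma polyfun_dotmul x c z : polyfun (dotmul x c) z = dotv x z * polyfun c z.
Proof.
rewrite /dotmul (polyfun_flatten (fun i => scal (x i) (mulv i c))) /dotv mulr_suml.
by apply: eq_bigr => i _; rewrite polyfun_scal polyfun_mulv mulrA.
Qed.

Lemma lap_dotmul x c z :
  polyfun_lap (dotmul x c) z = dotv x z * polyfun_lap c z + 2 * dirder x c z.
Proof.
rewrite /dotmul (polyfun_lap_flatten (fun i => scal (x i) (mulv i c))) /dotv mulr_suml.
rewrite /dirder mulr_sumr -big_split/=; apply: eq_bigr => i _.
by rewrite polyfun_lap_scal lap_mulv; ring.
Qed.

Lemma dirder_dotmul x x' c z :
  dirder x (dotmul x' c) z = dotv x x' * polyfun c z + dotv x' z * dirder x c z.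
Proof.
rewrite /dirder mulr_sumr.
under eq_bigr => j _.
  rewrite /dotmul (dcoord_flatten j (fun i => scal (x' i) (mulv i c))).
  under eq_bigr do rewrite dcoord_scal dcoord_mulv mulrDr.
  rewrite big_split/= (bigD1 j)//= eqxx mul1r big1 ?addr0; last first.
    by move=> i /negbTE ->; rewrite mul0r mulr0.
  under eq_bigr do rewrite mulrA.
  rewrite -mulr_suml -/(dotv x' z) mulrDr.
  over.
rewrite big_split/= /dotv mulr_suml; congr (_ + _); apply: eq_bigr => i _; first by rewrite mulrA.
by rewrite mulrCA.
Qed.

Lemma polyfun_nmul c z : polyfun (nmul c) z = dotv z z * polyfun c z.
Proof.
rewrite /nmul (polyfun_flatten (fun i => mulv i (mulv i c))) /dotv mulr_suml.
by apply: eq_bigr => i _; rewrite !polyfun_mulv mulrA.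
Qed.

Lemma lap_nmul c z : polyfun_lap (nmul c) z =
  dotv z z * polyfun_lap c z + 4 * dirder z c z + (2 * d)%:R * polyfun c z.
Proof.
rewrite /nmul (polyfun_lap_flatten (fun i => mulv i (mulv i c))).
transitivity (\sum_i (z i * z i * polyfun_lap c z + 4 * (z i * dcoord i c z) + 2 * polyfun c z)).
  by apply: eq_bigr => i _; rewrite !lap_mulv dcoord_mulv eqxx mulr1n; ring.
rewrite !big_split/= -mulr_suml -mulr_sumr sumr_const card_ord; congr (_ + _).
by rewrite natrM -mulr_natl; ring.
Qed.

Lemma dirder_nmul x c z :
  dirder x (nmul c) z = 2 * dotv x z * polyfun c z + dotv z z * dirder x c z.
Proof.
have E i j : dcoord j (mulv i (mulv i c)) z =
    (i == j)%:R * (2 * (z i * polyfun c z)) + z i * z i * dcoord j c z.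
  by rewrite !dcoord_mulv polyfun_mulv; ring.
rewrite /dirder [X in _ = _ + X]mulr_sumr {1}/dotv [2 * _]mulr_sumr mulr_suml -big_split/=.
apply: eq_bigr => j _; rewrite /nmul (dcoord_flatten j (fun i => mulv i (mulv i c))).
under eq_bigr do rewrite E.
rewrite big_split/= -mulr_suml (bigD1 j)//= eqxx big1; last first.
  by move=> i /negbTE ->; rewrite mul0r.
by rewrite mulr1n -/(dotv z z); ring.
Qed.

Lemma dirder_euler k c z : whom k c -> dirder z c z = k%:R * polyfun c z.
Proof.
move=> hc; rewrite /dirder /dcoord /polyfun mulr_sumr.
under eq_bigr do rewrite mulr_sumr.
rewrite exchange_big/=; apply: eq_big_seq => -[a al] /hc /= h.
have [->|a0] := eqVneq a 0; first by rewrite mul0r mulr0 big1// => i _; rewrite mul0r mulr0.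
rewrite -(h a0) natr_sum [in RHS]mulr_suml; apply: eq_bigr => i _.
by rewrite mulrCA (mulrCA (z i)) monom_dec mulrCA.
Qed.

Lemma polyfun_derx x c z : polyfun (derx x c) z = dirder x c z.
Proof.
rewrite /derx (polyfun_flatten (fun i => [seq (x i * (t.1 * (t.2 i)%:R), dec t.2 i) | t <- c])).
apply: eq_bigr => i _; rewrite /polyfun big_map /dcoord mulr_sumr.
by apply: eq_bigr => t _ /=; rewrite !mulrA.
Qed.

Lemma polyfun_lapr c z : polyfun (lapr c) z = polyfun_lap c z.
Proof.
rewrite /lapr (polyfun_flatten (fun i => [seq (t.1 * (t.2 i * (t.2 i).-1)%:R, lowal t.2 i) | t <- c])).
rewrite /polyfun_lap; under [RHS]eq_bigr do rewrite mulr_sumr.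
rewrite exchange_big/=; apply: eq_bigr => i _; rewrite /polyfun big_map.
by apply: eq_bigr => t _ /=; rewrite !mulrA.
Qed.

Lemma lap_derx x c z : polyfun_lap (derx x c) z = dirder x (lapr c) z.
Proof.
rewrite /derx (polyfun_lap_flatten (fun i => [seq (x i * (t.1 * (t.2 i)%:R), dec t.2 i) | t <- c])).
apply: eq_bigr => j _.
rewrite /lapr (dcoord_flatten j (fun i => [seq (t.1 * (t.2 i * (t.2 i).-1)%:R, lowal t.2 i) | t <- c])).
rewrite /polyfun_lap /dcoord big_map.
under [in RHS]eq_bigr do rewrite big_map.
rewrite exchange_big/= mulr_sumr; apply: eq_bigr => -[a al] _ /=.
rewrite -!mulrA; congr (_ * _); rewrite mulr_sumr.
rewrite [in RHS](eq_bigr (fun i => a * ((al i * (al i).-1)%:R * ((lowal al i j)%:R * monom (dec (lowal al i) j) z)))); last first.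
  by move=> i _; rewrite -mulrA.
rewrite -mulr_sumr -mulr_sumr; congr (_ * _); rewrite mulr_sumr; apply: eq_bigr => i _.
rewrite !mulrA -!natrM (@monom_ext _ (dec (lowal al i) j)); last first.
  by move=> l; rewrite /dec /lowal; case: (eqVneq l i) => [->|//]; case: eqP.
congr (_%:R * _); rewrite /dec /lowal eq_sym; case: (eqVneq i j) => [->|_]; last by lia.
by case: (al j) => [|[|m]] //=; lia.
Qed.

Lemma big_prod_deriv (I : eqType) (r : seq I) (p : I -> {poly R}) : uniq r ->
  (\prod_(i <- r) p i)^`() = \sum_(i <- r) (p i)^`() * \prod_(j <- r | j != i) p j.
Proof.
elim: r => [_|a r IH /= /andP[ar ur]]; first by rewrite !big_nil -polyC1 derivC.
rewrite !big_cons derivM IH// eqxx/=; congr (_ * _ + _).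
  rewrite big_seq_cond [in RHS]big_seq_cond; apply: eq_bigl => j.
  by case: (boolP (j \in r)) => //= jr; apply/esym; apply: contraNneq ar => <-.
rewrite mulr_sumr; apply: eq_big_seq => i ir; rewrite big_cons mulrCA.
by rewrite ifT//; apply: contraNneq ar => ->.
Qed.

Definition linep x z c : {poly R} :=
  \sum_(t <- c) t.1 *: \prod_i ((z i)%:P + x i *: 'X) ^+ t.2 i.

Lemma linepE x z c s : (linep x z c).[s] = polyfun c (fun i => z i + s * x i).
Proof.
rewrite /linep horner_sum; apply: eq_bigr => t _; rewrite hornerZ horner_prod; congr (_ * _).
by apply: eq_bigr => i _; rewrite !hornerE mulrC.
Qed.

Lemma linep_deriv x z c : (linep x z c)^`().[0] = dirder x c z.
Proof.
rewrite /linep linear_sum/= horner_sum /dirder /dcoord.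
under [RHS]eq_bigr do rewrite mulr_sumr.
rewrite exchange_big/=; apply: eq_bigr => -[a al] _ /=.
rewrite derivZ hornerZ big_prod_deriv; last exact: index_enum_uniq.
rewrite horner_sum mulr_sumr; apply: eq_bigr => i _.
rewrite [RHS]mulrCA; congr (_ * _); rewrite hornerM horner_prod deriv_exp.
rewrite derivD derivC derivZ derivX add0r.
have lin j : ((z j)%:P + x j *: 'X).[0] = z j by rewrite !hornerE.
rewrite hornerMn hornerM hornerZ hornerC mulr1 horner_exp lin.
rewrite (monomD1 i) [dec al i i]/dec eqxx (eq_bigr (fun j => z j ^+ dec al i j)); last first.
  by move=> j /negbTE ji; rewrite horner_exp lin /dec ji.
by rewrite -[X in X * _]mulr_natr; ring.
Qed.

(** A term list can vanish as a function without visible cancellation, so the derivative is not read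
    off termwise. Restricted to the line [z + s x] it is a univariate polynomial with more roots
    than its size allows, hence zero together with its derivative. *)
Lemma dirder_eq0 x c : (forall z, polyfun c z = 0) -> forall z, dirder x c z = 0.
Proof.
move=> c0 z; rewrite -linep_deriv.
suff -> : linep x z c = 0 by rewrite raddf0 horner0.
have := @roots_geq_poly_eq0 R (linep x z c) [seq m%:R | m <- iota 0 (size (linep x z c)).+1].
apply.
- by apply/allP => s _; rewrite /root linepE c0.
- by rewrite map_inj_uniq ?iota_uniq// => m n /eqP; rewrite eqr_nat => /eqP.
- by rewrite size_map size_iota.
Qed.

Lemma whom_dotmul x k c : whom k c -> whom k.+1 (dotmul x c).
Proof.
move=> hc t /flatten_mapP[i _ /mapP[s /mapP[u uc ->] ->]] /=.
rewrite mulf_eq0 negb_or => /andP[_ u0]; rewrite -(hc u uc u0).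
rewrite (bigD1 i)//= [in RHS](bigD1 i)//= /inc eqxx addSn; congr (_ + _).+1.
by apply: eq_bigr => j /negbTE ->.
Qed.

Lemma whom_derx x k c : whom k c -> whom k.-1 (derx x c).
Proof.
move=> hc t /flatten_mapP[i _ /mapP[u uc ->]] /=.
rewrite !mulf_eq0 !negb_or pnatr_eq0 -lt0n => /and3P[_ u0 ui]; rewrite -(hc u uc u0).
rewrite (bigD1 i)//= [in RHS](bigD1 i)//= /dec eqxx.
rewrite (eq_bigr u.2); first by case: (u.2 i) ui.
by move=> j /negbTE ->.
Qed.

(** The one-coordinate recurrences, weighted by [al i] and summed over [i], produce the total degree
    [m]. *)
Lemma sphere_green m c (hd : (1 < d)%N) : whom m c ->
  m%:R * (m + d - 2)%:R * sphere_int (polyfun c) = sphere_int (polyfun_lap c).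
Proof.
move=> hc; have d0 := ltnW hd.
rewrite /polyfun /polyfun_lap !sphere_int_sum//; last 2 first.
- move=> t; apply: sniceM; first exact: snice_cst.
  by apply: snice_sum => i; apply: sniceM; [exact: snice_cst|exact: snice_monom].
- by move=> t; apply: sniceM; [exact: snice_cst|exact: snice_monom].
rewrite mulr_sumr; apply: eq_big_seq => -[a al] /hc /= h.
rewrite !sphere_intZ//; last 2 first.
- by apply: snice_sum => i; apply: sniceM; [exact: snice_cst|exact: snice_monom].
- exact: snice_monom.
have [->|a0] := eqVneq a 0; first by rewrite !mul0r mulr0.
rewrite mulrCA; congr (_ * _); rewrite sphere_int_sum//; last first.
  by move=> i; apply: sniceM; [exact: snice_cst|exact: snice_monom].
rewrite -{1}(h a0) natr_sum !mulr_suml; apply: eq_bigr => i _.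
rewrite sphere_intZ; last exact: snice_monom.
case: (posnP (al i)) => [->|ai]; first by rewrite !mul0r.
have := @sphere_int_monom_rec R d d0 al i ai; rewrite (h a0) => E.
by rewrite -mulrA E natrM mulrA.
Qed.

Definition dotpow x n c : rep := iter n (dotmul x) c.

Lemma polyfun_dotpow x n c z : polyfun (dotpow x n c) z = dotv x z ^+ n * polyfun c z.
Proof.
by elim: n => [|n IH]; rewrite ?mul1r//= polyfun_dotmul IH exprS mulrA.
Qed.

Lemma whom_dotpow x n k c : whom k c -> whom (n + k) (dotpow x n c).
Proof. by move=> hc; elim: n => [//|n IH]; exact: whom_dotmul. Qed.

Lemma dirder_dotpow x n c z : dotv x x = 1 ->
  dirder x (dotpow x n c) z =
  n%:R * (dotv x z ^+ n.-1 * polyfun c z) + dotv x z ^+ n * dirder x c z.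
Proof.
move=> x1; elim: n => [|n IH]; first by rewrite mul0r add0r mul1r.
rewrite /= dirder_dotmul x1 mul1r -/(dotpow x n c) IH polyfun_dotpow.
case: n {IH} => [|n]; rewrite ?mul0r ?add0r ?expr0 ?expr1 ?mul1r//.
have -> : n.+2%:R = n.+1%:R + 1 :> R by rewrite natr1.
by rewrite /= !exprS; ring.
Qed.

Lemma lap_dotpow x n c z : dotv x x = 1 -> polyfun_lap c z = 0 ->
  polyfun_lap (dotpow x n c) z =
  (n * n.-1)%:R * (dotv x z ^+ n.-2 * polyfun c z) + n.*2%:R * (dotv x z ^+ n.-1 * dirder x c z).
Proof.
move=> x1 l0; elim: n => [|n IH]; first by rewrite !mul0r add0r.
rewrite /= lap_dotmul -/(dotpow x n c) IH dirder_dotpow//.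
case: n {IH} => [|[|n]].
- by rewrite /= !mul0n !muln0 double0 !mulr0n expr0 (_ : 1.*2%:R = 2 :> R)//; ring.
- rewrite /= !muln0 ?muln1 !mulr0n !expr0 (_ : 1.*2%:R = 2 :> R)//.
  by rewrite (_ : 2.*2%:R = 4 :> R)//; ring.
- rewrite /= !exprS.
  have -> : (n.+3 * n.+2)%:R = (n.+2 * n.+1)%:R + 2 * n.+2%:R :> R.
    by rewrite -natrM -natrD; congr _%:R; lia.
  have -> : n.+3.*2%:R = n.+2.*2%:R + 2 :> R by rewrite -natrD; congr _%:R; lia.
  ring.
Qed.

Lemma funk_hecke_pow (hd : (1 < d)%N) x n k c : on_sphere x -> whom k c ->
  (forall z, polyfun_lap c z = 0) ->
  sphere_int (fun z => dotv x z ^+ n * polyfun c z) = lam d n k * polyfun c x.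
Proof.
move=> x1; have d0 := ltnW hd.
have [N] := ubnP (n + k)%N; elim: N n k c => // N IH n k c nkN hc lc.
have snp n' c' : snice (fun z => dotv x z ^+ n' * polyfun c' z).
  by apply: sniceM; [apply: sniceX; exact: snice_dot|exact: snice_polyfun].
case: (posnP (n + k)) => [/eqP|nk0].
  rewrite addn_eq0 => /andP[/eqP n0 /eqP k0]; subst n k.
  rewrite lam00// mul1r -[RHS](sphere_int_cst d); congr sphere_int; apply/funext => z.
  rewrite expr0 mul1r /polyfun; apply: eq_big_seq => -[a al] /hc /= h.
  have [->|a0] := eqVneq a 0; first by rewrite !mul0r.
  have al0 i : al i = 0%N.
    by have /eqP := h a0; rewrite sum_nat_eq0 => /forallP/(_ i)/eqP.
  by congr (_ * _); rewrite /monom !big1// => i _; rewrite al0.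
(* As [n + k > 0] and [d >= 2], Green's identity can be solved for the integral in terms of smaller
   [n + k]. *)
have D0 : (n + k)%:R * (n + k + d - 2)%:R != 0 :> R.
  by rewrite mulf_neq0// pnatr_eq0; lia.
apply: (mulfI D0); rewrite [RHS]mulrA lam_green//.
rewrite (_ : (fun z => _) = polyfun (dotpow x n c)); last first.
  by apply/funext => z; rewrite polyfun_dotpow.
rewrite (sphere_green hd (@whom_dotpow x n k c hc)).
rewrite (_ : polyfun_lap _ = fun z => (n * n.-1)%:R * (dotv x z ^+ n.-2 * polyfun c z) +
    n.*2%:R * (dotv x z ^+ n.-1 * polyfun (derx x c) z)); last first.
  by apply/funext => z; rewrite lap_dotpow// polyfun_derx.
rewrite sphere_intD//; try by apply: sniceM; [exact: snice_cst|exact: snp].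
rewrite !sphere_intZ; try exact: snp.
rewrite mulrDl; congr (_ + _).
  case: n nkN nk0 D0 => [|[|n]] nkN nk0 D0; rewrite ?mul0n ?muln0 ?mul0r//.
  by rewrite /= (IH n k c)// ?mulrA//; lia.
case: n nkN nk0 D0 => [|n] nkN nk0 D0; first by rewrite !mul0r.
(* The derivative along [x] is harmonic of degree [k - 1], and Euler's identity evaluates it at [x]
   itself as [k] times the polynomial. *)
rewrite /= (IH n k.-1 (derx x c)) ?polyfun_derx; last first.
- by move=> z; rewrite lap_derx; apply: dirder_eq0 => w; rewrite polyfun_lapr.
- exact: whom_derx.
- by lia.
rewrite (dirder_euler x hc) -muln2 -[in RHS]muln2 !natrM; ring.
Qed.

End Rep.

(** * Zonal polynomials *)

Section Zonal.
Context {R : realType} (d : nat) (hd : (1 < d)%N).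
Implicit Types (x z : 'I_d -> R).

(** Upward coefficient for multiplication by [t]; it equals the downward weight in [lam_walk] at
    [k + 1]. *)
Definition Ak (k : nat) : R := k.+1%:R / (d + k.*2)%:R.

Lemma Ak_neq0 k : Ak k != 0.
Proof. by rewrite mulf_neq0 ?invr_eq0 ?pnatr_eq0//; lia. Qed.

(* The zonal polynomials: [G k (x . z)] is the reproducing kernel of the
   spherical harmonics of degree [k]. *)
Fixpoint G (n : nat) (t : R) : R :=
  match n with
  | 0 => 1
  | m.+1 => match m with
            | 0 => (Ak 0)^-1 * t
            | k.+1 => (Ak m)^-1 * (t * G m t - Bk d m * G k t)
            end
  end.

Lemma G_rec k (t : R) :
  t * G k t = Ak k * G k.+1 t + (if k is k'.+1 then Bk d k * G k' t else 0).
Proof.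
case: k => [|k]; first by rewrite /= addr0 mulr1 mulrA divff ?mul1r// Ak_neq0.
by rewrite [G k.+2 t]/= mulrA divff ?mul1r ?Ak_neq0// subrK.
Qed.

(** [G_rec] and [lam_walk] use the same coefficients, transposed, so multiplying the expansion by
    [t] moves the coefficients as the walk does. *)
Lemma pow_G n (t : R) : t ^+ n = \sum_(k < n.+1) lam d n k * G k t.
Proof.
elim: n => [|n IH]; first by rewrite big_ord1 lam00// mulr1.
rewrite exprS IH mulr_sumr.
rewrite (eq_bigr (fun k : 'I_n.+1 => Ak k * lam d n k * G k.+1 t +
  (if k : nat is k'.+1 then Bk d k * lam d n k * G k' t else 0))); last first.
  by move=> k _; rewrite mulrCA G_rec; case: (k : nat) => [|m]; ring.
rewrite big_split/=.
rewrite [RHS](eq_bigr (fun k : 'I_n.+2 =>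
  (if k : nat is k'.+1 then Ak k' * lam d n k' * G k t else 0) +
  Bk d k.+1 * lam d n k.+1 * G k t)); last first.
  by move=> k _; rewrite lam_walk//; case: (k : nat) => [|m]; rewrite /Ak; ring.
rewrite big_split/=; congr (_ + _).
  by rewrite [RHS]big_ord_recl/= add0r.
rewrite big_ord_recl/= add0r !big_ord_recr/= (@lam_lt _ d n n.+1)// (@lam_lt _ d n n.+2)//.
by rewrite !mulr0 !mul0r !addr0; apply: eq_bigr => i _.
Qed.

(** Homogeneous lift of [G]: the factor [|z|^2] in the lower term is 1 on the sphere and makes up
    the two missing degrees. *)
Fixpoint Gr x (n : nat) : seq (R * ('I_d -> nat)) :=
  match n with
  | 0 => [:: (1, fun=> 0%N)]
  | m.+1 => match m with
            | 0 => scal (Ak 0)^-1 (dotmul x [:: (1, fun=> 0%N)])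
            | k.+1 => scal (Ak m)^-1 (dotmul x (Gr x m)) ++
                      scal (- ((Ak m)^-1 * Bk d m)) (nmul (Gr x k))
            end
  end.

Lemma Gr1E x : Gr x 1 = scal (Ak 0)^-1 (dotmul x (Gr x 0)).
Proof. by []. Qed.

Lemma polyfun_Gr0 x z : polyfun (Gr x 0) z = 1.
Proof. by rewrite /polyfun big_seq1 mul1r /monom big1. Qed.

Lemma polyfun_GrSS x k z : polyfun (Gr x k.+2) z =
  (Ak k.+1)^-1 * (dotv x z * polyfun (Gr x k.+1) z - Bk d k.+1 * (dotv z z * polyfun (Gr x k) z)).
Proof.
by rewrite [Gr x k.+2]/= polyfun_cat !polyfun_scal polyfun_dotmul polyfun_nmul; ring.
Qed.

Lemma polyfun_Gr x k z : on_sphere z -> polyfun (Gr x k) z = G k (dotv x z).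
Proof.
move=> z1; suff : polyfun (Gr x k) z = G k (dotv x z) /\
  polyfun (Gr x k.+1) z = G k.+1 (dotv x z) by case.
elim: k => [|k [IH1 IH2]].
  split; first by rewrite polyfun_Gr0.
  by rewrite Gr1E polyfun_scal polyfun_dotmul polyfun_Gr0 mulr1.
by split=> //; rewrite polyfun_GrSS IH1 IH2 z1 mul1r.
Qed.

Lemma deg_inc (al : 'I_d -> nat) i : (\sum_j inc al i j = (\sum_j al j).+1)%N.
Proof.
rewrite (bigD1 i)//= [in RHS](bigD1 i)//= /inc eqxx addSn; congr (_ + _).+1.
by apply: eq_bigr => j /negbTE ->.
Qed.

Lemma Gr_hom x k t : t \in Gr x k -> (\sum_i t.2 i)%N = k.
Proof.
suff : (forall t, t \in Gr x k -> (\sum_i t.2 i)%N = k) /\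
       (forall t, t \in Gr x k.+1 -> (\sum_i t.2 i)%N = k.+1) by case=> h _; exact: h.
have D m c : (forall t, t \in c -> (\sum_i t.2 i)%N = m) -> forall a t,
    t \in scal a (dotmul x c) -> (\sum_i t.2 i)%N = m.+1.
  move=> hc a u /mapP[v /flatten_mapP[i _ /mapP[w /mapP[s sc ->] ->]] ->] /=.
  by rewrite deg_inc hc.
elim: k {t} => [|k [IH1 IH2]].
  have h0 t : t \in Gr x 0 -> (\sum_i t.2 i)%N = 0%N.
    by rewrite inE => /eqP ->; rewrite big1.
  by split=> // t; apply: D.
split=> // t; rewrite [Gr x k.+2]/= mem_cat => /orP[|]; first exact: D.
move=> /mapP[v /flatten_mapP[i _ /mapP[w /mapP[s sc ->] ->]] ->] /=.
by rewrite !deg_inc IH1.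
Qed.

Lemma Gr_whom x k : whom k (Gr x k).
Proof. by move=> t /Gr_hom. Qed.

(** The derivative of a zonal harmonic along its axis is a multiple of the zonal harmonic one degree
    lower; this is the multiple. *)
Definition betak (k : nat) : R := Bk d k.+1 * (d + k.*2)%:R.

Lemma dirder_cat x c c' z : dirder x (c ++ c') z = dirder x c z + dirder x c' z.
Proof. by rewrite -big_split/=; apply: eq_bigr => i _; rewrite dcoord_cat mulrDr. Qed.

Lemma dirder_scal x a c z : dirder x (scal a c) z = a * dirder x c z.
Proof. by rewrite /dirder mulr_sumr; apply: eq_bigr => i _; rewrite dcoord_scal mulrCA. Qed.

Lemma dirder_Gr0 x z : dirder x (Gr x 0) z = 0.
Proof. by apply: big1 => i _; rewrite /dcoord big_seq1 mul0r !mulr0. Qed.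

Lemma betak_rec k : k.+2%:R * Bk d k.+2 =
  1 + Bk d k.+1 * ((d + k.*2)%:R - 2) * (k.+1%:R / (d + k.*2)%:R) :> R.
Proof.
have D0 : (d + k.*2)%:R != 0 :> R by rewrite pnatr_eq0; lia.
have -> : (d + k.*2)%:R - 2 = (d + k.*2 - 2)%:R :> R by rewrite natrB//; lia.
rewrite /Bk /=; have -> : (k.+2.*2 + d - 4 = d + k.*2)%N by lia.
case: k D0 => [|k] D0.
  rewrite /= mul1r.
  have : (d - 1)%:R *+ 2 = d%:R + (d - 2)%:R :> R by rewrite -mulr_natr -natrM -natrD; congr _%:R; lia.
  have -> : (2 + d - 3 = d - 1)%N by lia.
  have -> : (d + 0.*2 - 2 = d - 2)%N by lia.
  move: D0; rewrite double0 addn0.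
  move: (d%:R) (d - 1)%:R (d - 2)%:R => a b c a0 E.
  rewrite -[b]mulr1 -(mulrC 1) mul1r; apply: (mulfI a0).
  transitivity (b *+ 2); first by field.
  by rewrite E; field.
have -> : (k.+2.*2 + d - 4 = d + k.+1.*2 - 2)%N by lia.
have D1 : (d + k.+1.*2 - 2)%:R != 0 :> R by rewrite pnatr_eq0; lia.
rewrite /= divfK//.
have : (k.+3 * (k.+3 + d - 3))%:R = (d + k.+1.*2)%:R + (k.+2 + d - 3)%:R * k.+2%:R :> R.
  by rewrite -natrM -natrD; congr _%:R; nia.
rewrite natrM; move: D0; move: (d + k.+1.*2)%:R (k.+2 + d - 3)%:R (k.+3 + d - 3)%:R => a b c a0 E.
by rewrite mulrA E; field.
Qed.

Lemma Gr_rec x k z : dotv x z * polyfun (Gr x k) z = Ak k * polyfun (Gr x k.+1) z +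
  (if k is k'.+1 then Bk d k * (dotv z z * polyfun (Gr x k') z) else 0).
Proof.
case: k => [|k].
  by rewrite Gr1E polyfun_scal polyfun_dotmul addr0 (mulVKf (Ak_neq0 0)).
by rewrite polyfun_GrSS (mulVKf (Ak_neq0 _)) subrK.
Qed.

(** Harmonicity and the axis derivative need each other. The Laplacian of [(x . z) Gr_(k+1)] is
    twice the axis derivative, that of [|z|^2 Gr_k] is [(4k + 2d) Gr_k], and the definition of
    [betak] makes them cancel. *)
Lemma Gr_harmonic_aux x : on_sphere x -> forall k,
  [/\ (forall z, polyfun_lap (Gr x k) z = 0),
      (forall z, polyfun_lap (Gr x k.+1) z = 0),
      (forall z, dirder x (Gr x k) z = (if k is k'.+1 then betak k' * polyfun (Gr x k') z else 0)) &
      (forall z, dirder x (Gr x k.+1) z = betak k * polyfun (Gr x k) z)].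
Proof.
move=> x1; elim=> [|k [L0 L1 D0 D1]].
  have l0 z : polyfun_lap (Gr x 0) z = 0.
    by rewrite /polyfun_lap big_seq1 big1 ?mulr0// => i _; rewrite mul0n mul0r.
  split=> // z; first by rewrite Gr1E polyfun_lap_scal lap_dotmul l0 dirder_Gr0 !mulr0 addr0 mulr0.
    exact: dirder_Gr0.
  rewrite Gr1E dirder_scal dirder_dotmul x1 dirder_Gr0 mulr0 addr0 mul1r.
  by rewrite /betak /Bk /Ak /= !mul1r invrK.
split=> // z.
  rewrite [Gr x k.+2]/= polyfun_lap_cat !polyfun_lap_scal lap_dotmul lap_nmul L0 L1 D1.
  rewrite (dirder_euler z (@Gr_whom x k)).
  have -> : (2 * d)%:R = 2 * d%:R :> R by rewrite natrM.
  by rewrite /betak natrD -muln2 natrM; ring.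
rewrite [Gr x k.+2]/= dirder_cat !dirder_scal dirder_dotmul dirder_nmul x1 D1 mul1r D0.
have -> : (Ak k.+1)^-1 * (polyfun (Gr x k.+1) z + dotv x z * (betak k * polyfun (Gr x k) z)) +
    - ((Ak k.+1)^-1 * Bk d k.+1) * (2 * dotv x z * polyfun (Gr x k) z + dotv z z *
      (if k is k'.+1 then betak k' * polyfun (Gr x k') z else 0)) =
    (Ak k.+1)^-1 * (polyfun (Gr x k.+1) z + (betak k - 2 * Bk d k.+1) * (dotv x z * polyfun (Gr x k) z)
      - Bk d k.+1 * (dotv z z * (if k is k'.+1 then betak k' * polyfun (Gr x k') z else 0))) by ring.
rewrite Gr_rec.
have -> : polyfun (Gr x k.+1) z + (betak k - 2 * Bk d k.+1) * (Ak k * polyfun (Gr x k.+1) z +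
    (if k is k'.+1 then Bk d k * (dotv z z * polyfun (Gr x k') z) else 0)) -
    Bk d k.+1 * (dotv z z * (if k is k'.+1 then betak k' * polyfun (Gr x k') z else 0)) =
    (1 + (betak k - 2 * Bk d k.+1) * Ak k) * polyfun (Gr x k.+1) z.
  case: k {L0 L1 D0 D1} => [|k]; first by rewrite !mulr0 subr0 addr0; ring.
  rewrite /betak (_ : (d + k.+1.*2)%:R = (d + k.*2)%:R + 2 :> R); first by ring.
  by rewrite -natrD; congr _%:R; lia.
rewrite mulrA; congr (_ * _).
have -> : 1 + (betak k - 2 * Bk d k.+1) * Ak k = k.+2%:R * Bk d k.+2.
  by rewrite betak_rec /betak /Ak; ring.
by rewrite /betak /Ak invf_div mulrA divfK ?pnatr_eq0// mulrC.
Qed.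

Lemma G_sph_harm x k : on_sphere x -> sph_harm k (fun z => G k (dotv x z)).
Proof.
move=> x1; exists (Gr x k); split; first by move=> t /Gr_hom.
split; first by case: (Gr_harmonic_aux x1 k).
by move=> z z1; rewrite polyfun_Gr.
Qed.

Lemma sph_harm_snice k (Y : ('I_d -> R) -> R) : sph_harm k Y -> snice Y.
Proof. by move=> [c [_ [_ Yc]]]; apply: snice_eq Yc _; exact: snice_polyfun. Qed.

Lemma sph_harm_pow n k (Y : ('I_d -> R) -> R) x : sph_harm k Y -> on_sphere x ->
  sphere_int (fun z => dotv x z ^+ n * Y z) = lam d n k * Y x.
Proof.
move=> [c [hc [lc Yc]]] x1; have d0 := ltnW hd.
rewrite (Yc x x1) -(funk_hecke_pow hd n x1 (k := k))//; last by move=> t tc _; exact: hc.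
apply: sphere_int_eq => // [z z1|]; first by rewrite Yc.
by apply: sniceM; [apply: sniceX; exact: snice_dot|exact: snice_polyfun].
Qed.

Lemma snice_G x k : on_sphere x -> snice (fun z => G k (dotv x z)).
Proof. by move=> x1; apply: sph_harm_snice (G_sph_harm k x1). Qed.

(** Substitute [pow_G] into [sph_harm_pow]: this is a triangular system with nonzero diagonal
    [lam n n], solved by strong induction. *)
Lemma funk_hecke_G k l (Y : ('I_d -> R) -> R) x : sph_harm l Y -> on_sphere x ->
  sphere_int (fun z => G k (dotv x z) * Y z) = (k == l)%:R * Y x.
Proof.
move=> hY x1; have d0 := ltnW hd; have nY := sph_harm_snice hY.
elim/ltn_ind: k => n IH.
have nG k : snice (fun z => G k (dotv x z) * Y z) by apply: sniceM => //; exact: snice_G.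
have E : lam d n l * Y x = \sum_(k < n.+1) lam d n k * sphere_int (fun z => G k (dotv x z) * Y z).
  rewrite -sph_harm_pow//.
  rewrite (_ : (fun z => _) = fun z => \sum_(k < n.+1) lam d n k * (G k (dotv x z) * Y z)); last first.
    by apply/funext => z; rewrite pow_G mulr_suml; apply: eq_bigr => k _; rewrite mulrA.
  rewrite sphere_int_sum; last by move=> k; apply: sniceM => //; exact: snice_cst.
  by apply: eq_bigr => k _; rewrite sphere_intZ.
have l0 : lam d n n != 0 :> R by rewrite gt_eqF// lam_diag_gt0.
rewrite big_ord_recr/= in E.
rewrite (eq_bigr (fun k : 'I_n => lam d n k * ((k : nat) == l)%:R * Y x)) in E; last first.
  by move=> k _; rewrite IH// mulrA.
apply: (mulfI l0); have [ln|nl|nl] := ltngtP l n.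
- rewrite (bigD1 (Ordinal ln))//= eqxx mulr1 in E.
  rewrite big1 in E; last first.
    by move=> k /negbTE kl; rewrite -(inj_eq val_inj)/= in kl; rewrite kl mulr0 mul0r.
  rewrite addr0 in E.
  have /eqP := E; rewrite -subr_eq0 opprD addrA subrr sub0r oppr_eq0 => /eqP ->.
  by rewrite mulr0n mul0r mulr0.
- rewrite big1 in E; last by move=> k _; rewrite ltn_eqF ?mulr0 ?mul0r// (ltn_trans _ nl).
  by rewrite mulr0n -[LHS]add0r -E lam_lt// !mul0r mulr0.
- subst l; rewrite big1 in E; last by move=> k _; rewrite ltn_eqF ?mulr0 ?mul0r.
  by rewrite mulr1n mul1r E add0r.
Qed.

(** The spanning property expands [G k (x . z)] in the basis; orthonormality and [funk_hecke_G]
    identify the coefficients as the values at [x]. *)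
Lemma reproducing k (B : seq (('I_d -> R) -> R)) x z : sph_harm_onb k B ->
  on_sphere x -> on_sphere z -> \sum_(Y <- B) Y x * Y z = G k (dotv x z).
Proof.
move=> [hB [ortho span]] x1 z1; have d0 := ltnW hd.
have hn j : (j < size B)%N -> sph_harm k (nth (fun=> 0) B j) by move=> jB; apply/hB/mem_nth.
have [c cE] := span _ (G_sph_harm k x1).
have nj (j : 'I_(size B)) : snice (nth (fun=> 0) B j) by apply: sph_harm_snice (hn j _).
rewrite (big_nth (fun=> 0)) big_mkord cE//; apply: eq_bigr => i _; congr (_ * _).
have := funk_hecke_G k (hn i (ltn_ord i)) x1; rewrite eqxx mul1r => <-.
rewrite (sphere_int_eq d0 (g := fun w => \sum_(j < size B)
    c j * (nth (fun=> 0) B j w * nth (fun=> 0) B i w))); last 2 first.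
- by move=> w w1; rewrite cE// mulr_suml; apply: eq_bigr => j _; rewrite mulrA.
- by apply: snice_sum => j; apply: sniceM; [exact: snice_cst|apply: sniceM].
rewrite sphere_int_sum; last by move=> j; apply: sniceM; [exact: snice_cst|apply: sniceM].
rewrite (bigD1 i)//= big1 ?addr0.
  by rewrite sphere_intZ; [have := ortho i i; rewrite /l2dot eqxx => -> //; rewrite mulr1|exact: sniceM].
move=> j ji; rewrite sphere_intZ; last exact: sniceM.
have := ortho j i; rewrite /l2dot (inj_eq val_inj) (negbTE ji) => -> //.
by rewrite mulr0.
Qed.

(** The inequality [2ab <= a^2 + b^2] on the reproducing sum; it supplies the dominating series for
    the expansion. *)
Lemma G_le k (B : seq (('I_d -> R) -> R)) x z : sph_harm_onb k B ->
  on_sphere x -> on_sphere z -> `|G k (dotv x z)| <= G k 1.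
Proof.
move=> hB x1 z1; rewrite -(reproducing hB x1 z1).
apply: le_trans (ler_norm_sum _ _ _) _.
apply: (@le_trans _ _ (\sum_(Y <- B) (Y x * Y x + Y z * Y z) / 2)).
  apply: ler_sum => Y _; rewrite ler_norml.
  have := sqr_ge0 (Y x - Y z); have := sqr_ge0 (Y x + Y z).
  by move=> h1 h2; apply/andP; split; nra.
rewrite -mulr_suml big_split/= !(reproducing hB)//.
rewrite (_ : dotv x x = 1)// (_ : dotv z z = 1)//.
by rewrite mulrDl -splitr.
Qed.

End Zonal.

(** * Power series with nonnegative coefficients *)

Section Series.
Context {R : realType}.
Implicit Types (a b : nat -> R).

Definition sums a (l : R) : Prop := (fun n => \sum_(0 <= k < n) a k) @ \oo --> l.

Lemma sums_unique a l l' : sums a l -> sums a l' -> l = l'.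
Proof. by move=> h h'; rewrite -(cvg_lim _ h)// -(cvg_lim _ h'). Qed.

Lemma eq_sums a b l : (forall n, a n = b n) -> sums a l -> sums b l.
Proof. by move=> /funext ->. Qed.

Lemma sums0 : sums (fun=> 0) 0.
Proof. by rewrite /sums; under eq_fun do rewrite big1//; exact: cvg_cst. Qed.

Lemma sumsD a b l l' : sums a l -> sums b l' -> sums (fun n => a n + b n) (l + l').
Proof. by move=> h h'; rewrite /sums; under eq_fun do rewrite big_split; exact: cvgD. Qed.

Lemma sumsZ a l (c : R) : sums a l -> sums (fun n => c * a n) (c * l).
Proof.
move=> h; rewrite /sums; under eq_fun do rewrite -mulr_sumr.
by apply: cvgM => //; exact: cvg_cst.
Qed.

Arguments sumsZ {a l} c _.

Lemma sumsB a b l l' : sums a l -> sums b l' -> sums (fun n => a n - b n) (l - l').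
Proof.
move=> h h'; have := sumsD h (sumsZ (-1) h'); rewrite mulN1r.
by apply: eq_sums => n; rewrite mulN1r.
Qed.

Lemma sums_sum K (a : nat -> nat -> R) (l : nat -> R) : (forall k, sums (a k) (l k)) ->
  sums (fun n => \sum_(0 <= k < K) a k n) (\sum_(0 <= k < K) l k).
Proof.
move=> h; elim: K => [|K IH].
  by rewrite big_nil; under eq_fun do rewrite big_nil; exact: sums0.
rewrite big_nat_recr//=; under eq_fun do rewrite big_nat_recr//=.
exact: sumsD.
Qed.

Lemma sums_le a b l l' : (forall n, a n <= b n) -> sums a l -> sums b l' -> l <= l'.
Proof.
move=> ab h h'; apply: ler_cvg_to h h' _.
by near=> n; apply: ler_sum.
Unshelve. all: by end_near. Qed.

Lemma sums_ge0 a l : (forall n, 0 <= a n) -> sums a l -> 0 <= l.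
Proof. by move=> a0 h; apply: sums_le sums0 h. Qed.

Lemma psum_le a N M : (forall n, 0 <= a n) -> (N <= M)%N ->
  \sum_(0 <= k < N) a k <= \sum_(0 <= k < M) a k.
Proof.
by move=> a0 NM; rewrite (big_cat_nat (leq0n N) NM)/= lerDl sumr_ge0.
Qed.

Lemma sums_psum_le a l N : (forall n, 0 <= a n) -> sums a l -> \sum_(0 <= k < N) a k <= l.
Proof.
move=> a0 h; apply: cvgr_to_ge h _.
by near=> n; apply: psum_le => //; near: n; exact: nbhs_infty_ge.
Unshelve. all: by end_near. Qed.

Lemma sums_bounded a (B : R) : (forall n, 0 <= a n) ->
  (forall N, \sum_(0 <= k < N) a k <= B) -> exists2 l, sums a l & l <= B.
Proof.
move=> a0 aB.
have nd : nondecreasing_seq (fun n => \sum_(0 <= k < n) a k).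
  by move=> n m nm; apply: psum_le.
have ub : has_ubound (range (fun n => \sum_(0 <= k < n) a k)).
  by exists B => _ [n _ <-]; exact: aB.
exists (sup (range (fun n => \sum_(0 <= k < n) a k))); first exact: nondecreasing_cvgn.
by apply: ge_sup => [|_ [n _ <-]]; [exists (\sum_(0 <= k < 0) a k), 0%N|exact: aB].
Qed.

Lemma sums_dom a b l : (forall n, 0 <= a n <= b n) -> sums b l -> exists2 l', sums a l' & l' <= l.
Proof.
move=> ab h; apply: sums_bounded => [n|N]; first by have /andP[] := ab n.
apply: le_trans (sums_psum_le N _ h); last by move=> n; have /andP[] := ab n; exact: le_trans.
by apply: ler_sum => n _; have /andP[] := ab n.
Qed.

(** Each finite block of columns is bounded by the total of the rows and conversely, so both
    iterated sums agree. *)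
Lemma double_series_ge0 (a : nat -> nat -> R) (A : nat -> R) (S : R) :
  (forall n k, 0 <= a n k) -> (forall n, sums (a n) (A n)) -> sums A S ->
  exists2 C : nat -> R, (forall k, sums (a ^~ k) (C k)) & sums C S.
Proof.
move=> a0 aA AS.
have akA n k : a n k <= A n.
  apply: le_trans (sums_psum_le k.+1 (a0 n) (aA n)).
  by rewrite big_nat_recr//= lerDr sumr_ge0.
have /choice[C CE] k : exists c, sums (a ^~ k) c.
  have [|l hl _] := @sums_dom (a ^~ k) A S _ AS; last by exists l.
  by move=> n; rewrite a0 akA.
exists C => //.
have C0 k : 0 <= C k by apply: sums_ge0 (CE k) => n.
have [S' CS' S'S] : exists2 l, sums C l & l <= S.
  apply: sums_bounded => // K.
  apply: (sums_le _ (@sums_sum K (fun k n => a n k) C CE) AS) => n.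
  exact: sums_psum_le (a0 n) (aA n).
suff -> : S = S' by [].
apply/eqP; rewrite eq_le S'S andbT.
have h N : \sum_(0 <= k < N) A k <= S'.
  apply: (sums_le _ (@sums_sum N a A aA) CS') => k.
  exact: (@sums_psum_le (a ^~ k) _ N (a0 ^~ k) (CE k)).
by apply: cvgr_to_le AS _; near=> n; exact: h.
Unshelve. all: by end_near. Qed.

(** The signed case is the difference of two nonnegative ones: [w + v] and [w]. *)
Lemma double_series (v w : nat -> nat -> R) (V W : nat -> R) (S T : R) :
  (forall n k, `|v n k| <= w n k) -> (forall n, sums (w n) (W n)) -> sums W S ->
  (forall n, sums (v n) (V n)) -> sums V T ->
  exists2 C : nat -> R, (forall k, sums (v ^~ k) (C k)) & sums C T.
Proof.
move=> vw wW WS vV VT.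
have [Cw hw hwS] : exists2 C : nat -> R, (forall k, sums (w ^~ k) (C k)) & sums C S.
  by apply: (double_series_ge0 _ wW WS) => n k; exact: le_trans (normr_ge0 _) (vw n k).
have u0 n k : 0 <= w n k + v n k.
  by have := vw n k; rewrite ler_norml => /andP[h _]; rewrite -lerBlDl sub0r.
have [Cu hu huS] := double_series_ge0 u0 (fun n => sumsD (wW n) (vV n)) (sumsD WS VT).
exists (fun k => Cu k - Cw k) => [k|].
  by apply: eq_sums (sumsB (hu k) (hw k)) => n; rewrite addrC addKr.
by have := sumsB huS hwS; rewrite addrC addKr.
Qed.

(** Convergence includes the endpoint 1, so the coefficients are summable with sum [f 1], which
    dominates the series on the whole interval. *)
Definition PS (f : R -> R) a : Prop :=
  (forall n, 0 <= a n) /\ forall t, `|t| <= 1 -> sums (fun n => a n * t ^+ n) (f t).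

Definition isPS f : Prop := exists a, PS f a.

Lemma PS_ext f g a : (forall t, `|t| <= 1 -> f t = g t) -> PS f a -> PS g a.
Proof. by move=> fg [a0 h]; split=> // t t1; rewrite -fg//; exact: h. Qed.

Lemma PS_norm_le f a t : PS f a -> `|t| <= 1 -> `|f t| <= f 1.
Proof.
move=> [a0 h] t1.
have h1 : sums a (f 1).
  by apply: eq_sums (h 1 _) => [n|]; rewrite ?expr1n ?mulr1// normr1.
have le n : `|a n * t ^+ n| <= a n.
  by rewrite normrM ger0_norm// ler_piMr// normrX exprn_ile1.
rewrite ler_norml; apply/andP; split.
  rewrite -mulN1r; apply: sums_le (sumsZ (-1) h1) (h t t1) => n.
  by rewrite mulN1r; have := le n; rewrite ler_norml => /andP[].
by apply: sums_le (h t t1) h1 => n; exact: le_trans (ler_norm _) (le n).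
Qed.

Lemma PS_sums1 f a : PS f a -> sums a (f 1).
Proof.
by move=> [a0 h]; apply: eq_sums (h 1 _) => [n|]; rewrite ?expr1n ?mulr1// normr1.
Qed.

Lemma PSD f g a b : PS f a -> PS g b -> PS (fun t => f t + g t) (fun n => a n + b n).
Proof.
move=> [a0 ha] [b0 hb]; split=> [n|t t1]; first by rewrite addr_ge0.
by apply: eq_sums (sumsD (ha t t1) (hb t t1)) => n; rewrite mulrDl.
Qed.

Lemma PSZ f a (c : R) : 0 <= c -> PS f a -> PS (fun t => c * f t) (fun n => c * a n).
Proof.
move=> c0 [a0 ha]; split=> [n|t t1]; first by rewrite mulr_ge0.
by apply: eq_sums (sumsZ c (ha t t1)) => n; rewrite mulrA.
Qed.

Lemma sums_shift a l : sums a l -> sums (fun n => if n is m.+1 then a m else 0) l.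
Proof.
move=> h; rewrite /sums -(cvg_shiftn 1) /=.
rewrite (_ : (fun n => _) = (fun n => \sum_(0 <= k < n) a k)); first exact: h.
by apply/funext => n; rewrite addn1 big_nat_recl//= add0r.
Qed.

Lemma PS_X f a : PS f a -> PS (fun t => t * f t) (fun n => if n is m.+1 then a m else 0).
Proof.
move=> [a0 ha]; split=> [[|n]//|t t1].
apply: eq_sums (sums_shift (sumsZ t (ha t t1))) => -[|n]; first by rewrite mul0r.
by rewrite exprS mulrCA.
Qed.

Lemma PS_cst (c : R) : 0 <= c -> PS (fun=> c) (fun n => (n == 0)%:R * c).
Proof.
move=> c0; split=> [n|t t1]; first by rewrite mulr_ge0.
rewrite /sums -(cvg_shiftn 1) /=.
rewrite (_ : (fun n => _) = (fun=> c)); first exact: cvg_cst.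
apply/funext => n; rewrite addn1 big_nat_recl//= mul1r mulr1 big1 ?addr0// => i _.
by rewrite !mul0r.
Qed.

(** Summing power series reduces to one exchange of sums dominated at [t = 1]. Products and
    compositions are the instances [a n t^n g] and [a n g^n]. *)
Lemma isPS_countable (f : nat -> R -> R) (F : R -> R) : (forall n, isPS (f n)) ->
  (forall t, `|t| <= 1 -> sums (fun n => f n t) (F t)) -> isPS F.
Proof.
move=> /choice[a ha] hF.
have a0 n k : 0 <= a n k by have [] := ha n.
have h1 n := PS_sums1 (ha n).
have F1 : sums (fun n => f n 1) (F 1) by apply: hF; rewrite normr1.
have [c hc _] := double_series_ge0 a0 h1 F1.
exists c; split=> [k|t t1]; first by apply: sums_ge0 (hc k) => n.
have [|C hC hCF] := @double_series (fun n k => a n k * t ^+ k) a _ _ _ _ _ h1 F1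
  (fun n => (ha n).2 t t1) (hF t t1).
  by move=> n k; rewrite normrM ger0_norm// ler_piMr// normrX exprn_ile1.
apply: eq_sums hCF => k; apply: sums_unique (hC k) _.
by rewrite mulrC; apply: eq_sums (sumsZ (t ^+ k) (hc k)) => n; rewrite mulrC.
Qed.

Lemma isPSD f g : isPS f -> isPS g -> isPS (fun t => f t + g t).
Proof. by move=> [a ha] [b hb]; eexists; exact: PSD ha hb. Qed.

Lemma isPSZ f (c : R) : 0 <= c -> isPS f -> isPS (fun t => c * f t).
Proof. by move=> c0 [a ha]; eexists; exact: PSZ c0 ha. Qed.

Lemma isPS_cst (c : R) : 0 <= c -> isPS (fun=> c).
Proof. by move=> c0; eexists; exact: PS_cst. Qed.

Lemma isPS_Xn f n : isPS f -> isPS (fun t => t ^+ n * f t).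
Proof.
move=> hf; elim: n => [|n [a ha]].
  by case: hf => a ha; exists a; apply: PS_ext ha => t _; rewrite mul1r.
by eexists; apply: PS_ext (PS_X ha) => t _; rewrite exprS mulrA.
Qed.

Lemma isPSM f g : isPS f -> isPS g -> isPS (fun t => f t * g t).
Proof.
move=> [a [a0 ha]] hg.
apply: (@isPS_countable (fun n t => a n * (t ^+ n * g t))) => [n|t t1].
  by apply: isPSZ => //; exact: isPS_Xn.
by rewrite mulrC; apply: eq_sums (sumsZ (g t) (ha t t1)) => n; ring.
Qed.

Lemma isPSX f n : isPS f -> isPS (fun t => f t ^+ n).
Proof.
move=> hf; elim: n => [|n [a ha]].
  by under eq_fun do rewrite expr0; exact: isPS_cst.
by under eq_fun do rewrite exprS; apply: isPSM => //; exists a.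
Qed.

Lemma isPS_comp f g : isPS f -> isPS g -> (forall t, `|t| <= 1 -> `|g t| <= 1) ->
  isPS (fun t => f (g t)).
Proof.
move=> [a [a0 ha]] hg g1.
apply: (@isPS_countable (fun n t => a n * g t ^+ n)) => [n|t t1].
  by apply: isPSZ => //; exact: isPSX.
by apply: ha; exact: g1.
Qed.

End Series.

Arguments sumsZ {R a l} c _.

(** * The arcsine series *)

Section Arcsine.
Context {R : realType}.

(* Maclaurin coefficients of arcsine. *)
Fixpoint asc (n : nat) : R :=
  match n with
  | 0 => 0
  | m.+1 => match m with
            | 0 => 1
            | k.+1 => k%:R ^+ 2 / (k.+1%:R * k.+2%:R) * asc k
            end
  end.

Lemma ascSS k : asc k.+2 = k%:R ^+ 2 / (k.+1%:R * k.+2%:R) * asc k.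
Proof. by []. Qed.

Lemma asc_ge0 n : 0 <= asc n.
Proof.
elim/ltn_ind: n => -[|[|n]] IH//.
by rewrite ascSS mulr_ge0 ?IH// divr_ge0 ?exprn_ge0 ?mulr_ge0.
Qed.

Lemma asc_even n : ~~ odd n -> asc n = 0.
Proof.
elim/ltn_ind: n => -[|[|n]] IH// no.
by rewrite ascSS IH ?mulr0//; rewrite /= negbK in no.
Qed.

Lemma asc_rec k : k.+2%:R * (k.+1%:R * asc k.+2) = k%:R ^+ 2 * asc k.
Proof.
have h1 : k.+1%:R != 0 :> R by rewrite pnatr_eq0.
have h2 : k.+2%:R != 0 :> R by rewrite pnatr_eq0.
rewrite ascSS; move: h1 h2; move: (k.+1%:R) (k.+2%:R) => a b a0 b0.
by field; rewrite a0 b0.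
Qed.

(** Bounds the first omitted terms of the differentiated series by plain powers, which gives
    geometric decay in [ra_bound]. *)
Lemma asc_le n : n%:R * asc n <= 1.
Proof.
elim/ltn_ind: n => -[|[|n]] IH//; rewrite ?mul0r ?mulr1//.
have h1 : 0 < n.+1%:R :> R by rewrite ltr0n.
rewrite -(ler_pM2l h1) mulrCA asc_rec expr2 -mulrA mulr1.
apply: (@le_trans _ _ (n%:R * 1)); first by rewrite ler_wpM2l// IH//; lia.
by rewrite mulr1 ler_nat.
Qed.

Definition Sa (N : nat) (x : R) : R := \sum_(0 <= n < N) asc n * x ^+ n.
Definition Sa1 (N : nat) (x : R) : R := \sum_(0 <= n < N) asc n * (n%:R * x ^+ n.-1).
Definition Sa2 (N : nat) (x : R) : R :=
  \sum_(0 <= n < N) asc n * (n%:R * (n.-1%:R * x ^+ n.-2)).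
Definition Si (N : nat) (x : R) : R := \sum_(0 <= n < N) asc n * (x ^+ n.+1 / n.+1%:R).
Definition ua (n : nat) (x : R) : R := asc n * (n%:R * (n.-1%:R * x ^+ n.-2)).

Lemma is_derive_pow (n : nat) (x : R) : is_derive x 1 (fun y : R => y ^+ n) (n%:R * x ^+ n.-1).
Proof.
have := @is_deriveX _ _ (id : R -> R) n x 1 _ (is_derive_id _ _).
rewrite (_ : (id : R -> R) ^+ n = (fun y => y ^+ n)); last by apply/funext => y; rewrite exprfctE.
by move=> dd; apply: (is_derive_eq dd); rewrite /GRing.scale/= mulr1.
Qed.

Lemma is_derive_nsum (f df : nat -> R -> R) N (x : R) :
  (forall n, is_derive x 1 (f n) (df n x)) ->
  is_derive x 1 (fun y => \sum_(0 <= n < N) f n y) (\sum_(0 <= n < N) df n x).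
Proof.
move=> h; elim: N => [|N IH].
  by rewrite big_nil; under eq_fun do rewrite big_nil; exact: is_derive_cst.
rewrite big_nat_recr//=; under eq_fun do rewrite big_nat_recr//=.
exact: is_deriveD.
Qed.

Lemma is_derive_cmul (f : R -> R) (c df x : R) : is_derive x 1 f df ->
  is_derive x 1 (fun y => c * f y) (c * df).
Proof. by move=> h; exact: is_deriveZ. Qed.

Lemma is_derive_Sa N (x : R) : is_derive x 1 (Sa N) (Sa1 N x).
Proof.
by apply: (is_derive_nsum (df := fun n x => asc n * (n%:R * x ^+ n.-1))) => n;
  apply: is_derive_cmul; exact: is_derive_pow.
Qed.

Lemma is_derive_Sa1 N (x : R) : is_derive x 1 (Sa1 N) (Sa2 N x).
Proof.
apply: (is_derive_nsum (df := fun n x => asc n * (n%:R * (n.-1%:R * x ^+ n.-2)))) => n.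
by do 2 apply: is_derive_cmul; exact: is_derive_pow.
Qed.

Lemma is_derive_Si N (x : R) : is_derive x 1 (Si N) (Sa N x).
Proof.
apply: (is_derive_nsum (df := fun n x => asc n * x ^+ n)) => n; apply: is_derive_cmul.
under eq_fun do rewrite mulrC.
apply: (is_derive_eq (is_derive_cmul _ (is_derive_pow _ _))) => /=.
by rewrite mulrA mulVf ?mul1r// pnatr_eq0.
Qed.

(** Arcsine solves [(1 - x^2) y'' = x y']; truncating the series leaves only two boundary terms, of
    known sign. *)
Lemma Sa_ode N x : (1 - x ^+ 2) * Sa2 N x - x * Sa1 N x = - (ua N x + ua N.+1 x).
Proof.
elim: N => [|N IH].
  by rewrite /Sa2 /Sa1 !big_nil /ua /= !mul0r !mulr0 subr0 addr0 oppr0.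
have -> : Sa2 N.+1 x = Sa2 N x + ua N x by rewrite /Sa2 big_nat_recr.
have -> : Sa1 N.+1 x = Sa1 N x + asc N * (N%:R * x ^+ N.-1) by rewrite /Sa1 big_nat_recr.
rewrite mulrDr mulrDr opprD addrACA IH.
have -> : ua N.+2 x = N%:R ^+ 2 * asc N * x ^+ N.
  by rewrite -asc_rec /ua /=; ring.
have -> : (1 - x ^+ 2) * ua N x = ua N x - asc N * (N%:R * (N.-1%:R * x ^+ N)).
  rewrite /ua; case: N {IH} => [|[|N]] /=; rewrite ?mul0r ?mulr0 ?subr0//.
  by rewrite !exprS; ring.
have -> : x * (asc N * (N%:R * x ^+ N.-1)) = asc N * (N%:R * x ^+ N).
  by case: N {IH} => [|N] /=; rewrite ?mul0r ?mulr0 ?exprS//; ring.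
case: N {IH} => [|N] /=; first by rewrite !mul0r; ring.
by rewrite -(natr1 N); ring.
Qed.

Lemma derive_le (f df : R -> R) (a b : R) : (forall x : R, is_derive x 1 f (df x)) -> a <= b ->
  (forall x, a <= x <= b -> 0 <= df x) -> f a <= f b.
Proof.
move=> hf ab df0.
have cf : continuous f.
  by move=> x; apply/differentiable_continuous/derivable1_diffP; have [] := hf x.
have [|c] := @MVT_segment _ f df a b ab (fun x _ => hf x); first exact: continuous_subspaceT.
rewrite in_itv/= => /df0 c0 E.
by rewrite -subr_ge0 E mulr_ge0// subr_ge0.
Qed.

Let pih : R := pi / 2.
Let pih0 : 0 <= pih. Proof. by rewrite divr_ge0// pi_ge0. Qed.

(** In the angle, arcsine becomes the identity. [qa] is the derivative of [Sa N (sin th)], expected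
    to approach 1; [ra] and [Wa] are the remainders for arcsine and for its primitive
    [x asin x + sqrt (1 - x^2) - 1]. *)
Definition qa N th : R := cos th * Sa1 N (sin th).
Definition ra N th : R := th - Sa N (sin th).
Definition Wa N th : R := th * sin th + cos th - 1 - Si N (sin th).

Lemma is_derive_comp_sin (f : R -> R) (df th : R) :
  is_derive (sin th) 1 f df -> is_derive th 1 (fun y => f (sin y)) (df * cos th).
Proof. by move=> h; exact: (@is_derive1_comp _ f sin th df (cos th) h (is_derive_sin _)). Qed.

Lemma is_derive_qa N (th : R) :
  is_derive th 1 (qa N) (- (ua N (sin th) + ua N.+1 (sin th))).
Proof.
have h1 := is_derive_comp_sin (is_derive_Sa1 N (sin th)).
have := is_deriveM (is_derive_cos th) h1 => dd; apply: (is_derive_eq dd).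
rewrite -Sa_ode /GRing.scale/=.
have -> : 1 - sin th ^+ 2 = cos th ^+ 2 by rewrite cos2sin2.
by ring.
Qed.

Lemma is_derive_ra N (th : R) : is_derive th 1 (ra N) (1 - qa N th).
Proof.
have h1 := is_derive_comp_sin (is_derive_Sa N (sin th)).
have := is_deriveB (is_derive_id th (1 : R)) h1 => dd; apply: (is_derive_eq dd).
by rewrite /qa mulrC.
Qed.

Lemma is_derive_Wa N (th : R) : is_derive th 1 (Wa N) (cos th * ra N th).
Proof.
have h1 := is_derive_comp_sin (is_derive_Si N (sin th)).
have h2 := is_deriveM (is_derive_id th (1 : R)) (is_derive_sin th).
have h3 := is_deriveB (is_deriveB (is_deriveD h2 (is_derive_cos th)) (is_derive_cst (1 : R) th (1 : R))) h1.
apply: (is_derive_eq h3).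
by rewrite /ra /GRing.scale/=; ring.
Qed.

Lemma sin_ge0_pih th : 0 <= th <= pih -> 0 <= sin th.
Proof.
move=> /andP[h0 h1]; apply: sin_ge0_pi; rewrite h0 (le_trans h1)//.
by rewrite ler_pdivrMr// mulr_natr mulr2n lerDl pi_ge0.
Qed.

Lemma cos_ge0_pih th : 0 <= th <= pih -> 0 <= cos th.
Proof.
by move=> /andP[h0 h1]; apply: cos_ge0_pihalf; rewrite h1 andbT (le_trans _ h0)// oppr_le0.
Qed.

Lemma ua_ge0 n x : 0 <= x -> 0 <= ua n x.
Proof. by move=> x0; rewrite !mulr_ge0 ?asc_ge0// exprn_ge0. Qed.

Lemma qa0 N : qa N.+2 0 = 1.
Proof.
rewrite /qa cos0 sin0 mul1r /Sa1 big_nat_recl// big_nat_recl//= big1_seq; last first.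
  by move=> i _; rewrite expr0n /= !mulr0.
by rewrite !mul0r !mulr1 add0r addr0.
Qed.

(** [qa] decreases from the value 1 at angle 0. Hence [ra] is nondecreasing, and its value at
    [pi / 2] controls all smaller angles. *)
Lemma qa_le1 N th : 0 <= th <= pih -> qa N.+2 th <= 1.
Proof.
move=> /andP[h0 h1]; rewrite -(qa0 N) -lerN2.
apply: (derive_le (f := fun y => - qa N.+2 y) (df := fun y => ua N.+2 (sin y) + ua N.+3 (sin y))) => //.
  by move=> x; have := is_deriveN (is_derive_qa N.+2 x); rewrite opprK.
move=> x /andP[x0 x1]; have s0 : 0 <= sin x by apply: sin_ge0_pih; rewrite x0 (le_trans x1).
by rewrite addr_ge0// ua_ge0.
Qed.

Lemma qa_ge0 N th : 0 <= th <= pih -> 0 <= qa N th.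
Proof.
move=> h; rewrite mulr_ge0 ?cos_ge0_pih// sumr_ge0// => n _.
by rewrite !mulr_ge0 ?asc_ge0// exprn_ge0// sin_ge0_pih.
Qed.

Lemma ra0 N : ra N 0 = 0.
Proof.
rewrite /ra sin0 sub0r; apply/eqP; rewrite oppr_eq0; apply/eqP.
by apply: big1 => -[|n] _; rewrite ?mul0r// expr0n mulr0.
Qed.

Lemma ra_le N th ph : 0 <= th -> th <= ph -> ph <= pih -> ra N.+2 th <= ra N.+2 ph.
Proof.
move=> h0 h1 h2; apply: derive_le (is_derive_ra N.+2) h1 _ => x /andP[x0 x1].
by rewrite subr_ge0 qa_le1// (le_trans h0 x0) (le_trans x1 h2).
Qed.

Lemma ra_ge0 N th : 0 <= th <= pih -> 0 <= ra N.+2 th.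
Proof. by move=> /andP[h0 h1]; rewrite -(ra0 N.+2) ra_le. Qed.

Lemma ra_lip N th ph : 0 <= th -> th <= ph -> ph <= pih -> ra N th <= ra N ph ->
  ra N ph <= ra N th + (ph - th).
Proof.
move=> h0 h1 h2 _.
have : (fun y => y - ra N y) th <= (fun y => y - ra N y) ph.
  apply: (@derive_le (fun y => y - ra N y) (fun y => qa N y) th ph _ h1).
    move=> x; have := is_deriveB (is_derive_id x (1 : R)) (is_derive_ra N x).
    by move=> dd; apply: (is_derive_eq dd); rewrite opprB addrC subrK.
  by move=> x /andP[x0 x1]; apply: qa_ge0; rewrite (le_trans h0 x0) (le_trans x1 h2).
by rewrite /=; lra.
Qed.

(** The two first omitted terms of the differentiated series: an antiderivative of the boundary
    terms of [Sa_ode] times [cos th]. *)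
Definition ea N th : R := asc N.+2 * (N.+2%:R * sin th ^+ N.+1) + asc N.+3 * (N.+3%:R * sin th ^+ N.+2).

Lemma is_derive_ea N (th : R) :
  is_derive th 1 (ea N) ((ua N.+2 (sin th) + ua N.+3 (sin th)) * cos th).
Proof.
pose f x : R := asc N.+2 * (N.+2%:R * x ^+ N.+1) + asc N.+3 * (N.+3%:R * x ^+ N.+2).
have h : is_derive (sin th) 1 f (ua N.+2 (sin th) + ua N.+3 (sin th)).
  by apply: is_deriveD; do 2 apply: is_derive_cmul; exact: is_derive_pow.
exact: is_derive_comp_sin h.
Qed.

(** Both sides vanish at 0. The derivative of the right is that of [1 - qa] times [cos y], and
    [cos y >= cos th] up to [th]. *)
Lemma qa_gap N th ph : 0 <= ph -> ph <= th -> th <= pih ->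
  cos th * (1 - qa N.+2 ph) <= ea N ph.
Proof.
move=> h0 h1 h2.
suff : (fun y => ea N y - cos th * (1 - qa N.+2 y)) 0 <= (fun y => ea N y - cos th * (1 - qa N.+2 y)) ph.
  by rewrite /= qa0 subrr mulr0 subr0 {1}/ea sin0 !expr0n !mulr0 addr0 subr_ge0.
apply: (@derive_le (fun y => ea N y - cos th * (1 - qa N.+2 y))
  (fun y => (ua N.+2 (sin y) + ua N.+3 (sin y)) * (cos y - cos th)) 0 ph _ h0).
  move=> x; have d1 := is_deriveB (is_derive_cst (1 : R) x (1 : R)) (is_derive_qa N.+2 x).
  have := is_deriveB (is_derive_ea N x) (is_derive_cmul (cos th) d1).
  by move=> dd; apply: (is_derive_eq dd); ring.
move=> x /andP[x0 x1]; have s0 : 0 <= sin x.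
  by apply: sin_ge0_pih; rewrite x0 (le_trans x1)// (le_trans h1).
apply: mulr_ge0; first by rewrite addr_ge0// ua_ge0.
rewrite subr_ge0.
have pp : pih <= pi by rewrite ler_pdivrMr// mulr_natr mulr2n lerDl pi_ge0.
have xth := le_trans x1 h1.
rewrite leNgt ltr_cos ?in_itv/= ?x0 ?(le_trans x0 xth)//=; last 2 first.
- exact: le_trans h2 pp.
- exact: le_trans xth (le_trans h2 pp).
by rewrite -leNgt.
Qed.

Lemma ra_bound N th : 0 <= th -> th < pih -> ra N.+2 th <= th * (2 * sin th ^+ N.+1 / cos th).
Proof.
move=> h0 h1.
have c0 : 0 < cos th by apply: cos_gt0_pihalf; rewrite h1 andbT (lt_le_trans _ h0)// oppr_lt0 divr_gt0// pi_gt0.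
have hh : 0 <= th <= pih by rewrite h0 ltW.
set C := 2 * sin th ^+ N.+1 / cos th.
have : (fun y => C * y - ra N.+2 y) 0 <= (fun y => C * y - ra N.+2 y) th.
  apply: (@derive_le (fun y => C * y - ra N.+2 y) (fun y => C - (1 - qa N.+2 y)) 0 th _ h0).
    move=> x; have := is_deriveB (is_derive_cmul C (is_derive_id x (1 : R))) (is_derive_ra N.+2 x).
    by move=> dd; apply: (is_derive_eq dd); rewrite mulr1.
  move=> x /andP[x0 x1]; rewrite subr_ge0 /C ler_pdivlMr// mulrC.
  apply: le_trans (qa_gap N x0 x1 (ltW h1)) _.
  have hx : 0 <= x <= pih by rewrite x0 (le_trans x1)// ltW.
  have sx : 0 <= sin x by apply: sin_ge0_pih.
  have sle : sin x <= sin th.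
    rewrite leNgt ltr_sin ?in_itv/= -?leNgt//.
      by rewrite (ltW h1) andbT (le_trans _ h0)// oppr_le0.
    by rewrite (le_trans x1 (ltW h1)) andbT (le_trans _ x0)// oppr_le0.
  have s1 : sin th <= 1 by have := sin_max th; rewrite ler_norml => /andP[].
  have sth := le_trans sx sle.
  have b1 : asc N.+2 * (N.+2%:R * sin x ^+ N.+1) <= sin th ^+ N.+1.
    rewrite mulrA (mulrC (asc _)) -[leRHS]mul1r; apply: ler_pM => //.
    - by rewrite mulr_ge0// asc_ge0.
    - by rewrite exprn_ge0.
    - exact: asc_le.
    - by rewrite lerXn2r// nnegrE.
  have b2 : asc N.+3 * (N.+3%:R * sin x ^+ N.+2) <= sin th ^+ N.+1.
    rewrite mulrA (mulrC (asc _)) -[leRHS]mul1r; apply: ler_pM => //.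
    - by rewrite mulr_ge0// asc_ge0.
    - by rewrite exprn_ge0.
    - exact: asc_le.
    - apply: (@le_trans _ _ (sin th ^+ N.+2)); first by rewrite lerXn2r// nnegrE.
      by rewrite exprS ler_piMl// exprn_ge0.
  by move: b1 b2; rewrite /ea; lra.
by rewrite /= ra0 mulr0 subr0 subr_ge0 mulrC.
Qed.

(** The geometric bound degenerates at [pi / 2], where the cosine vanishes. It is applied at an
    angle [e / 2] earlier, and the remainder grows with slope at most 1 over the gap. *)
Lemma ra_pih_cvg : (fun n => ra n.+2 pih) @ \oo --> 0.
Proof.
apply/cvgrPdist_le => e e0.
(* The maximum with 0 keeps the angle in range when [e] is large. *)
pose ph := Num.max 0 (pih - e / 2).
have ph0 : 0 <= ph by rewrite le_max lexx.
have pp : 0 < pih by rewrite divr_gt0// pi_gt0.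
have ph1 : ph < pih by rewrite /ph gt_max pp/= ltrBlDr ltrDl divr_gt0.
have c0 : 0 < cos ph by apply: cos_gt0_pihalf; rewrite ph1 andbT (lt_le_trans _ ph0)// oppr_lt0.
have s0 : 0 <= sin ph by apply: sin_ge0_pih; rewrite ph0 ltW.
have s1 : sin ph < 1.
  rewrite -sin_pihalf ltr_sin ?in_itv/= ?lexx//.
    by rewrite (le_trans _ ph0) ?oppr_le0//= ltW.
  by rewrite andbT (le_trans _ pih0)// oppr_le0.
have cv : (fun n => ph * (2 * (sin ph * sin ph ^+ n) / cos ph)) @ \oo -->
    ph * (2 * (sin ph * 0) / cos ph).
  apply: cvgM; first exact: cvg_cst.
  apply: cvgM; last exact: cvg_cst.
  apply: cvgM; first exact: cvg_cst.
  apply: cvgM; first exact: cvg_cst.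
  by apply: cvg_expr; rewrite ger0_norm.
rewrite !(mulr0, mul0r) in cv.
have e20 : 0 < e / 2 by rewrite divr_gt0.
move/cvgrPdist_le: cv => /(_ _ e20) cv.
near=> n; rewrite sub0r normrN ger0_norm; last by rewrite ra_ge0// pih0 lexx.
have hb := ra_bound n ph0 ph1.
have hm : `|0 - ph * (2 * (sin ph * sin ph ^+ n) / cos ph)| <= e / 2 by near: n.
rewrite sub0r normrN -exprS in hm; have hm' := le_trans (ler_norm _) hm.
have hl := ra_lip ph0 (ltW ph1) (lexx _) (ra_le n ph0 (ltW ph1) (lexx _)).
have hp : pih - ph <= e / 2 by rewrite lerBlDr -lerBlDl /ph le_max lexx orbT.
by lra.
Unshelve. all: by end_near. Qed.

Lemma cvg_shift2 (u : nat -> R) (l : R) : (fun n => u n.+2) @ \oo --> l -> u @ \oo --> l.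
Proof.
move=> h; rewrite -(cvg_shiftn 2) /=.
by rewrite (_ : (fun n => _) = (fun n => u n.+2))//; apply/funext => n; rewrite addn2.
Qed.

Lemma sums_asc_sin th : 0 <= th <= pih -> sums (fun n => asc n * sin th ^+ n) th.
Proof.
move=> /andP[h0 h1]; apply: cvg_shift2.
have h : (fun n => ra n.+2 th) @ \oo --> 0.
  apply: (@squeeze_cvgr _ _ _ _ (fun=> 0) (fun n => ra n.+2 pih)); [|exact: cvg_cst|exact: ra_pih_cvg].
  by near=> n; rewrite ra_ge0 ?h0// ra_le.
rewrite (_ : (fun n => _) = (fun n => th - ra n.+2 th)); last first.
  by apply/funext => n; rewrite /ra opprB addrC subrK.
by rewrite -[X in _ --> X]subr0; apply: cvgB => //; exact: cvg_cst.
Unshelve. all: by end_near. Qed.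

(** The derivative of [Wa] is [cos] times [ra], so the convergence at [pi / 2] integrates to that of
    the primitive. *)
Lemma sums_Si_sin th : 0 <= th <= pih ->
  sums (fun n => asc n * (sin th ^+ n.+1 / n.+1%:R)) (th * sin th + cos th - 1).
Proof.
move=> /andP[h0 h1]; apply: cvg_shift2.
have W0 N : Wa N 0 = 0.
  rewrite /Wa sin0 cos0 mul0r add0r subrr sub0r /Si big1 ?oppr0// => n _.
  by rewrite expr0n /= mul0r mulr0.
have W1 N : 0 <= Wa N.+2 th.
  rewrite -(W0 N.+2); apply: derive_le (is_derive_Wa N.+2) h0 _ => x /andP[x0 x1].
  by rewrite mulr_ge0 ?cos_ge0_pih ?ra_ge0// x0 (le_trans x1).
have W2 N : Wa N.+2 th <= ra N.+2 pih * th.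
  have : (fun y => ra N.+2 pih * y - Wa N.+2 y) 0 <= (fun y => ra N.+2 pih * y - Wa N.+2 y) th.
    apply: (@derive_le (fun y => ra N.+2 pih * y - Wa N.+2 y)
      (fun y => ra N.+2 pih - cos y * ra N.+2 y) 0 th _ h0).
      move=> x; have := is_deriveB (is_derive_cmul (ra N.+2 pih) (is_derive_id x (1 : R))) (is_derive_Wa N.+2 x).
      by move=> dd; apply: (is_derive_eq dd); rewrite mulr1.
    move=> x /andP[x0 x1]; rewrite subr_ge0.
    have hx : 0 <= x <= pih by rewrite x0 (le_trans x1).
    apply: le_trans (ra_le N x0 (le_trans x1 h1) (lexx _)).
    by rewrite ler_piMl ?ra_ge0 ?cos_le1.
  by rewrite /= W0 mulr0 subr0 subr_ge0.
have h : (fun n => Wa n.+2 th) @ \oo --> 0.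
  apply: (@squeeze_cvgr _ _ _ _ (fun=> 0) (fun n => ra n.+2 pih * th)); [|exact: cvg_cst|].
    by near=> n; rewrite W1 W2.
  by rewrite -[X in _ --> X](mul0r th); apply: cvgM; [exact: ra_pih_cvg|exact: cvg_cst].
rewrite (_ : (fun n => _) = (fun n => th * sin th + cos th - 1 - Wa n.+2 th)); last first.
  by apply/funext => n; rewrite /Wa opprB addrC subrK.
by rewrite -[X in _ --> X]subr0; apply: cvgB => //; exact: cvg_cst.
Unshelve. all: by end_near. Qed.

Lemma asinN (t : R) : `|t| <= 1 -> asin (- t) = - asin t.
Proof.
rewrite ler_norml => t1.
have tI : t \in `[(-1), 1] by rewrite in_itv/=.
rewrite -[in LHS](asinK tI) -sinN sinK// in_itv/= lerN2 lerNl.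
by rewrite asin_geNpi2 ?asin_lepi2.
Qed.

Lemma asin_itv (t : R) : 0 <= t <= 1 -> 0 <= asin t <= pih.
Proof.
move=> /andP[t0 t1].
have t11 : -1 <= t <= 1 by rewrite t1 andbT (le_trans _ t0)// oppr_le0.
have tI : t \in `[(-1), 1] by rewrite in_itv/=.
rewrite asin_lepi2// andbT leNgt -(@ltr_sin R) ?in_itv/= ?asin_geNpi2 ?asin_lepi2//; last first.
  by rewrite oppr_le0 pih0.
by rewrite asinK// sin0 -leNgt.
Qed.

Lemma PS_asin : PS asin asc.
Proof.
split=> [|t t1]; first exact: asc_ge0.
wlog t0 : t t1 / 0 <= t.
  move=> W; have [/W|t0] := leP 0 t; first exact.
  have := W (- t); rewrite normrN oppr_ge0 asinN// => /(_ t1 (ltW t0)) h.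
  have := sumsZ (-1) h; rewrite mulN1r opprK; apply: eq_sums => n.
  have [on|/asc_even ->] := boolP (odd n); last by rewrite !mul0r mulr0.
  by rewrite exprNn -signr_odd on expr1; ring.
have t01 : 0 <= t <= 1 by rewrite t0 -(ger0_norm t0).
have tI : t \in `[(-1), 1] by rewrite in_itv/= -ler_norml.
by have := sums_asc_sin (asin_itv t01); rewrite asinK.
Qed.

Lemma PS_asin_int : PS (fun t => t * asin t + Num.sqrt (1 - t ^+ 2) - 1)
  (fun n => if n is m.+1 then asc m / n%:R else 0).
Proof.
split=> [[|n]//|t t1]; first by rewrite divr_ge0// asc_ge0.
wlog t0 : t t1 / 0 <= t.
  move=> W; have [/W|t0] := leP 0 t; first exact.
  have := W (- t); rewrite normrN oppr_ge0 asinN// sqrrN mulrNN => /(_ t1 (ltW t0)).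
  apply: eq_sums => -[|n]; first by rewrite !mul0r.
  have [on|/asc_even ->] := boolP (odd n); last by rewrite !mul0r.
  by rewrite exprNn -signr_odd /= on expr0 mul1r.
have t01 : 0 <= t <= 1 by rewrite t0 -(ger0_norm t0).
have tI : t \in `[(-1), 1] by rewrite in_itv/= -ler_norml.
have t11 : -1 <= t <= 1 by rewrite -ler_norml.
have := sums_shift (sums_Si_sin (asin_itv t01)); rewrite asinK// cos_asin// mulrC.
by apply: eq_sums => -[|n]; [rewrite mul0r|rewrite mulrA mulrAC].
Qed.

Lemma acos_asin (t : R) : `|t| <= 1 -> acos t = pi / 2 - asin t.
Proof.
rewrite ler_norml => t1.
have tI : t \in `[(-1), 1] by rewrite in_itv/=.
have E : cos (pi / 2 - asin t) = t.
  by rewrite -cosN opprB cosBpihalf asinK.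
rewrite -{1}E cosK// in_itv/= subr_ge0 asin_lepi2//= lerBlDr -lerBlDl.
by rewrite (le_trans _ (asin_geNpi2 t1))//; lra.
Qed.

End Arcsine.

(** * Asymptotics *)

Section Asymptotics.
Context {R : realType}.

(* A sequence comparable to [n ^ (-3/2)] for which the eigenvalue series below
   satisfies a two-term recurrence in [k]. *)
Fixpoint bq (n : nat) : R :=
  match n with
  | 0 => 1
  | m.+1 => match m with
            | 0 => 1
            | k.+1 => if (k <= 1)%N then 1 else k.-1%:R / k.+2%:R * bq k
            end
  end.

Lemma bqE k : (1 < k)%N -> bq k.+2 = k.-1%:R / k.+2%:R * bq k.
Proof. by move=> k1 /=; rewrite leqNgt k1. Qed.

Lemma bq_rec k : (1 < k)%N -> k.+2%:R * bq k.+2 = k.-1%:R * bq k.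
Proof.
by move=> k1; rewrite bqE// mulrA mulrCA divff ?mulr1// pnatr_eq0.
Qed.

Lemma bq_gt0 n : 0 < bq n.
Proof.
elim/ltn_ind: n => -[|[|n]] IH//; case: (leqP n 1) => n1; first by rewrite /= n1.
by rewrite bqE// mulr_gt0 ?IH// divr_gt0// ltr0n; lia.
Qed.

Lemma step2_ind (P : nat -> Prop) a : P a -> P a.+1 ->
  (forall n, (a <= n)%N -> P n -> P n.+2) -> forall n, (a <= n)%N -> P n.
Proof.
move=> pa pa1 st n; elim/ltn_ind: n => n IH an.
have [<-//|na] := eqVneq a n; have [<-//|na1] := eqVneq a.+1 n.
have E : n = n.-2.+2 by lia.
by rewrite E; apply: st; [lia|apply: IH; lia].
Qed.

(** The decay of order [n^(-3/2)], squared to stay polynomial. The quantity decreases in steps of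
    two because [(n+2)(n-1)^2 <= n^3]; its starting values are 8 and 27. *)
Lemma bq_bound n : (2 <= n)%N -> n%:R ^+ 3 * bq n ^+ 2 <= 27.
Proof.
move: n; apply: step2_ind; first by rewrite /=; lra.
  by rewrite /=; lra.
move=> n n2 IH; apply: le_trans IH.
have E := bq_rec n2.
have -> : n.+2%:R ^+ 3 * bq n.+2 ^+ 2 = n.+2%:R * (n.+2%:R * bq n.+2) ^+ 2 by ring.
rewrite E; have b0 := bq_gt0 n.
have -> : n.+2%:R * (n.-1%:R * bq n) ^+ 2 = n.+2%:R * n.-1%:R ^+ 2 * bq n ^+ 2 by ring.
rewrite ler_wpM2r ?sqr_ge0//.
by rewrite -!natrX -natrM ler_nat; nia.
Qed.

Lemma nbq_cvg : (fun n => n%:R * bq n) @ \oo --> (0 : R).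
Proof.
apply/cvgrPdist_le => e e0; near=> n.
have n2 : (2 <= n)%N by near: n; exact: nbhs_infty_ge.
have nb : 0 <= n%:R * bq n by rewrite mulr_ge0// ltW// bq_gt0.
rewrite sub0r normrN ger0_norm//.
have hb := bq_bound n2.
have ne : 27 / e ^+ 2 <= n%:R.
  by near: n; exact: nbhs_infty_ger.
rewrite ler_pdivrMr ?exprn_gt0// in ne.
rewrite -(@ler_pXn2r _ 2)// ?nnegrE ?(ltW e0)//.
have n0 : 0 < n%:R :> R by rewrite ltr0n; lia.
rewrite -(ler_pM2l n0); apply: le_trans ne.
by apply: le_trans hb; rewrite le_eqVlt; apply/orP; left; apply/eqP; ring.
Unshelve. all: by end_near. Qed.

(** At even indices from 2 on, [bq n] is minus twice the Maclaurin coefficient of [sqrt (1 - t^2)],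
    which explains the exact equality. *)
Lemma asc_even_bq n : (2 <= n)%N -> ~~ odd n -> 2 * (n.-1%:R * asc n.-1) = n%:R * bq n.
Proof.
move: n; apply: step2_ind => //; first by rewrite /=; lra.
move=> n n2 IH /=; rewrite negbK => on.
rewrite bq_rec// /=.
have := asc_rec (R := R) n.-1; rewrite prednK; last by lia.
move=> E; have n0 : n%:R != 0 :> R by rewrite pnatr_eq0; lia.
apply: (mulfI n0); rewrite mulrCA (mulrCA n%:R n.+1%:R) E.
rewrite [RHS]mulrCA -IH//; ring.
Qed.

(** Along odd [n], [asc n / bq n] increases while [n asc n / ((n-1) bq n)] decreases; both constants
    are attained at [n = 3]. *)
Lemma asc_odd_bq n : (2 <= n)%N -> odd n -> bq n <= 6 * asc n /\ 4 * (n%:R * asc n) <= n.-1%:R * bq n.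
Proof.
move: n; apply: step2_ind => //.
  by move=> _; rewrite ascSS /=; split; lra.
move=> n n2 IH; rewrite [odd n.+2]/= negbK [n.+2.-1]/= => /IH[h1 h2].
have A := asc_rec (R := R) n; have B := bq_rec n2.
have a0 := asc_ge0 (R := R) n; have b0 := bq_gt0 n.
have E0 : n.-1%:R = n%:R - 1 :> R by rewrite -subn1 natrB//; lia.
have E1 : n.+1%:R = n%:R + 1 :> R by rewrite natr1.
have E2 : n.+2%:R = n%:R + 2 :> R by rewrite -natrD addn2.
have nn : 2 <= n%:R :> R by rewrite ler_nat.
move: A B h2; rewrite E0 E1 E2; move: (n%:R) nn h1 a0 b0 => x x2 h1 a0 b0 A B h2.
have x0 : 0 < x by lra. have x10 : 0 < x + 1 by lra. have x20 : 0 < x + 2 by lra.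
split.
  have c0 : 0 < (x + 2) * (x + 1) by nra.
  rewrite -(ler_pM2l c0).
  have -> : (x + 2) * (x + 1) * bq n.+2 = (x + 1) * ((x + 2) * bq n.+2) by ring.
  rewrite B.
  have -> : (x + 2) * (x + 1) * (6 * asc n.+2) = 6 * ((x + 2) * ((x + 1) * asc n.+2)) by ring.
  rewrite A; apply: (@le_trans _ _ ((x + 1) * ((x - 1) * (6 * asc n)))).
    by rewrite ler_wpM2l ?(ltW x10)// ler_wpM2l//; lra.
  have -> : 6 * (x ^+ 2 * asc n) = (x + 1) * ((x - 1) * (6 * asc n)) + 6 * asc n by ring.
  by rewrite lerDl; lra.
have c0 : 0 < (x + 2) * (x + 1) by nra.
rewrite -(ler_pM2l c0).
have -> : (x + 2) * (x + 1) * (4 * ((x + 2) * asc n.+2)) = (x + 2) * 4 * ((x + 2) * ((x + 1) * asc n.+2)) by ring.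
have -> : (x + 2) * (x + 1) * ((x + 1) * bq n.+2) = (x + 1) ^+ 2 * ((x + 2) * bq n.+2) by ring.
rewrite A B.
have -> : (x + 2) * 4 * (x ^+ 2 * asc n) = (x + 2) * x * (4 * (x * asc n)) by ring.
apply: le_trans (_ : (x + 2) * x * ((x - 1) * bq n) <= _).
  by rewrite ler_wpM2l//; nra.
have -> : (x + 1) ^+ 2 * ((x - 1) * bq n) = (x + 2) * x * ((x - 1) * bq n) + (x - 1) * bq n by ring.
by rewrite lerDl mulr_ge0 ?(ltW b0)//; lra.
Qed.

Lemma bq_le_asc n : (2 <= n)%N -> bq n <= 6 * (asc n + asc n.-1).
Proof.
move=> n2; have a0 := asc_ge0 (R := R) n; have a1 := asc_ge0 (R := R) n.-1.
have [on|en] := boolP (odd n); first by have [h _] := asc_odd_bq n2 on; lra.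
have := asc_even_bq n2 en.
have E0 : n.-1%:R = n%:R - 1 :> R by rewrite -subn1 natrB//; lia.
have nn : 2 <= n%:R :> R by rewrite ler_nat.
by rewrite E0 => h; nra.
Qed.

Lemma asc_le_bq n : (2 <= n)%N -> asc n <= bq n /\ asc n.-1 <= bq n.
Proof.
move=> n2; have b0 := bq_gt0 n.
have E0 : n.-1%:R = n%:R - 1 :> R by rewrite -subn1 natrB//; lia.
have nn : 2 <= n%:R :> R by rewrite ler_nat.
have a0 := asc_ge0 (R := R) n; have a1 := asc_ge0 (R := R) n.-1.
have [on|en] := boolP (odd n).
  have [_] := asc_odd_bq n2 on; rewrite E0 => h.
  rewrite (@asc_even _ n.-1); last by lia.
  by split; [nra|exact: ltW].
have := asc_even_bq n2 en; rewrite E0 (asc_even en) => h.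
by split; [exact: ltW|nra].
Qed.

(** * The comparison series and its decay *)

Section Tk.
Variables (d : nat) (hd : (1 < d)%N) (Sb : R) (hb : sums bq Sb).

Lemma sums_T k : exists2 T, sums (fun n => bq n * lam d n k) T & 0 < T.
Proof.
have [|T hT _] := @sums_dom _ (fun n => bq n * lam d n k) bq Sb _ hb.
  move=> n; rewrite mulr_ge0 ?(ltW (bq_gt0 n)) ?lam_ge0//=.
  by rewrite ler_piMr ?lam_le1// ltW// bq_gt0.
exists T => //.
apply: lt_le_trans (sums_psum_le k.+1 _ hT).
  rewrite big_nat_recr//= ltr_wpDl ?mulr_gt0 ?bq_gt0 ?lam_diag_gt0//.
  by apply: sumr_ge0 => n _; rewrite mulr_ge0 ?(ltW (bq_gt0 n)) ?lam_ge0.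
by move=> n; rewrite mulr_ge0 ?(ltW (bq_gt0 n)) ?lam_ge0.
Qed.

Definition Rt (k n : nat) : R := (n%:R - k%:R) * (bq n * lam d n k).

(** After clearing [n + k + d], [lam_shiftk] expresses [lam n k.+2] by [lam n k], and [lam_shiftn]
    with [bq_rec] turns [bq n.+2 * lam n.+2 k] into [(n-1)(n+1) bq n * lam n k]. What remains is a
    polynomial identity in [n], [k], [d]. *)
Lemma T_telescope k n : (2 <= k)%N ->
  ((k + d)%:R ^+ 2 - 1) * (bq n * lam d n k.+2) - (k%:R ^+ 2 - 1) * (bq n * lam d n k) =
  (k + k + d)%:R * (Rt k n - Rt k n.+2).
Proof.
move=> k2; rewrite /Rt.
(* Below the diagonal [Rt k n.+2] also vanishes: through its factor when [n + 2 = k], by support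
   when it is smaller, by parity otherwise. *)
case: (ltnP n k) => [nk|kn].
  rewrite (@lam_lt _ d n k)// (@lam_lt _ d n k.+2); last by lia.
  have -> : (n.+2%:R - k%:R) * (bq n.+2 * lam d n.+2 k) = 0.
    have [->|nk2] := eqVneq n.+2 k; first by rewrite subrr mul0r.
    rewrite [lam _ _ _](_ : _ = 0) ?mulr0//.
    case: (ltnP n.+2 k) => h; first exact: lam_lt.
    by apply: lam_odd; lia.
  by rewrite !mulr0 subrr mulr0.
have hk := lam_shiftk (R := R) hd n k; have hn := lam_shiftn (R := R) hd kn.
have hq := bq_rec (leq_trans k2 kn).
have E0 : n.-1%:R = n%:R - 1 :> R by rewrite -subn1 natrB//; lia.
have E1 : n.+1%:R = n%:R + 1 :> R by rewrite natr1.
have E2 : n.+2%:R = n%:R + 2 :> R by rewrite -natrD addn2.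
rewrite (natrB _ kn) in hk.
rewrite (natrB R (leq_trans kn (leqW (leqnSn n)))) in hn.
rewrite E0 E2 in hq; rewrite E1 E2 in hn; rewrite E2.
rewrite !natrD in hk hn *.
have nk0 : n%:R + k%:R + d%:R != 0 :> R by rewrite -!natrD pnatr_eq0; lia.
move: hk hn hq nk0.
move: (lam d n k.+2) (lam d n k) (lam d n.+2 k) (bq n) (bq n.+2) => l2 l l' b b'.
move: (n%:R) (k%:R) (d%:R) => x y z hk hn hq nk0.
apply: (mulfI nk0).
have -> : (x + y + z) * (((y + z) ^+ 2 - 1) * (b * l2) - (y ^+ 2 - 1) * (b * l)) =
  ((y + z) ^+ 2 - 1) * b * ((x + y + z) * l2) - (x + y + z) * (y ^+ 2 - 1) * (b * l) by ring.
have -> : (x + y + z) * ((y + y + z) * ((x - y) * (b * l) - (x + 2 - y) * (b' * l'))) =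
  (y + y + z) * ((x + y + z) * (x - y) * (b * l) - b' * ((x + 2 - y) * (x + y + z) * l')) by ring.
rewrite hk hn.
have -> : b' * ((x + 1) * (x + 2) * l) = (x + 1) * l * ((x + 2) * b') by ring.
rewrite hq; ring.
Qed.

Lemma Rt_cvg k : Rt k @ \oo --> 0.
Proof.
apply: (@squeeze_cvgr _ _ _ _ (fun=> 0) (fun n => n%:R * bq n)); [|exact: cvg_cst|exact: nbq_cvg].
near=> n; have nk : (k <= n)%N by near: n; exact: nbhs_infty_ge.
rewrite /Rt; have b0 := bq_gt0 n; have l0 := lam_ge0 (R := R) hd n k.
have l1 := lam_le1 (R := R) hd n k.
have nk' : 0 <= n%:R - k%:R :> R by rewrite subr_ge0 ler_nat.
rewrite !mulr_ge0 ?(ltW b0)//=; apply: ler_pM => //.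
- by rewrite mulr_ge0// ltW.
- by rewrite lerBlDr lerDl.
- by rewrite ler_piMr// ltW.
Unshelve. all: by end_near. Qed.

Lemma T_rec k T T2 : (2 <= k)%N -> sums (fun n => bq n * lam d n k) T ->
  sums (fun n => bq n * lam d n k.+2) T2 ->
  ((k + d)%:R ^+ 2 - 1) * T2 = (k%:R ^+ 2 - 1) * T.
Proof.
move=> k2 hT hT2; apply/eqP; rewrite -subr_eq0; apply/eqP.
apply: (sums_unique (sumsB (sumsZ _ hT2) (sumsZ _ hT))).
apply: (@eq_sums _ (fun n => (k + k + d)%:R * (Rt k n - Rt k n.+2))).
  by move=> n; rewrite T_telescope.
rewrite -[X in sums _ X](mulr0 (k + k + d)%:R); apply: sumsZ.
(* The step is two, so two boundary terms remain at the far end; those at 0 and 1 vanish because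
   [k >= 2]. *)
have E N : \sum_(0 <= n < N) (Rt k n - Rt k n.+2) = - (Rt k N + Rt k N.+1).
  elim: N => [|N IH].
    by rewrite big_nil /Rt !lam_lt ?mulr0 ?addr0 ?oppr0//; lia.
  by rewrite big_nat_recr//= IH; ring.
rewrite /sums (_ : (fun n => _) = (fun N => - (Rt k N + Rt k N.+1))); last exact/funext.
rewrite -oppr0 -[X in - X]addr0; apply: cvgN; apply: cvgD; first exact: Rt_cvg.
have := Rt_cvg k; rewrite -(cvg_shiftn 1) /=.
by rewrite (_ : (fun n => Rt k (n + 1)) = (fun n => Rt k n.+1))//; apply/funext => n; rewrite addn1.
Qed.

(** The rising factorial [m (m+1) ... (m+d-1)], a stand-in for [m^d] whose quotients are rational
    like those of [T]. *)
Definition Pd (m : nat) : R := \prod_(i < d) (m + i)%:R.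

Lemma Pd_rec m : m%:R * Pd m.+1 = (m + d)%:R * Pd m.
Proof.
rewrite /Pd; elim: d => [|e IH]; first by rewrite !big_ord0 addn0.
rewrite !big_ord_recr/= mulrA IH addSnnS; ring.
Qed.

Lemma Pd_gt0 m : (0 < m)%N -> 0 < Pd m.
Proof. by move=> m0; apply: prodr_gt0 => i _; rewrite ltr0n addn_gt0 m0. Qed.

Lemma Pd_ge m : m%:R ^+ d <= Pd m.
Proof.
rewrite -[X in _ ^+ X]card_ord -prodr_const; apply: ler_prod => i _.
by rewrite ler0n/= ler_nat leq_addr.
Qed.

Lemma Pd_le m : Pd m <= (m + d)%:R ^+ d.
Proof.
rewrite -[X in _ ^+ X]card_ord -prodr_const; apply: ler_prod => i _.
by rewrite ler0n/= ler_nat leq_add2l ltnW.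
Qed.

(** The ratio of [T (k+2)] to [T k] is [(k-1)(k+1) / ((k+d-1)(k+d+1))]. It lies between
    [Pd (k-2) / Pd k] and [Pd k / Pd (k+2)], so in steps of two [T k * Pd (k-2)] increases and
    [T k * Pd k] decreases. *)
Lemma T_bounds : exists c C : R, [/\ 0 < c, 0 < C &
  forall k T, (3 <= k)%N -> sums (fun n => bq n * lam d n k) T ->
    c * k%:R ^- d <= T <= C * k%:R ^- d].
Proof.
have /choice[T hT] k : exists T, sums (fun n => bq n * lam d n k) T.
  by have [T h _] := sums_T k; exists T.
have T0 k : 0 < T k.
  by have [T' h T'0] := sums_T k; rewrite (sums_unique (hT k) h).
have TR k : (2 <= k)%N -> ((k + d)%:R ^+ 2 - 1) * T k.+2 = (k%:R ^+ 2 - 1) * T k.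
  by move=> k2; apply: T_rec (hT k) (hT k.+2).
(* One starting value for each parity, here and in [C] below. *)
pose c := Num.min (T 3 * Pd 1) (T 4 * Pd 2).
have lo m : (1 <= m)%N -> c <= T m.+2 * Pd m.
  move: m; apply: step2_ind; rewrite ?ge_min ?lexx ?orbT// => m m1 IH.
  apply: le_trans IH _.
  have r1 := Pd_rec m; have r2 := Pd_rec m.+1; have tr := TR m.+2 isT.
  have m0 : 1 <= m%:R :> R by rewrite ler1n.
  have d2 : 2 <= d%:R :> R by rewrite ler_nat.
  have P0 := Pd_gt0 m1; have t0 := T0 m.+2.
  have E1 : m.+1%:R = m%:R + 1 :> R by rewrite natr1.
  have E2 : m.+2%:R = m%:R + 2 :> R by rewrite -natrD addn2.
  rewrite !natrD E1 in r1 r2; rewrite natrD E2 in tr.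
  move: r1 r2 tr m0 d2 P0 t0; move: (Pd m) (Pd m.+1) (Pd m.+2) (T m.+2) (T m.+4) (m%:R) (d%:R).
  move=> p p1 p2 t t2 x y r1 r2 tr m0 d2 P0 t0.
  have c0 : 0 < x * (x + 1) * (x + y + 3) * (x + y + 1) by rewrite !mulr_gt0//; lra.
  rewrite -(ler_pM2l c0).
  have -> : x * (x + 1) * (x + y + 3) * (x + y + 1) * (t2 * p2) =
    x * ((x + 1) * p2) * (((x + 2 + y) ^+ 2 - 1) * t2) by ring.
  rewrite r2 tr.
  have -> : x * ((x + 1 + y) * p1) * (((x + 2) ^+ 2 - 1) * t) =
     (x + 1 + y) * (x * p1) * ((x + 1) * (x + 3) * t) by ring.
  rewrite r1 -subr_ge0.
  have -> : (x + 1 + y) * ((x + y) * p) * ((x + 1) * (x + 3) * t) -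
    x * (x + 1) * (x + y + 3) * (x + y + 1) * (t * p) = 3 * y * (x + 1) * (x + y + 1) * (t * p) by ring.
  by rewrite !mulr_ge0//; lra.
pose C := Num.max (T 2 * Pd 2) (T 3 * Pd 3).
have hi k : (2 <= k)%N -> T k * Pd k <= C.
  move: k; apply: step2_ind; rewrite ?le_max ?lexx ?orbT// => m m1 IH.
  apply: le_trans _ IH.
  have r1 := Pd_rec m; have r2 := Pd_rec m.+1; have tr := TR m m1.
  have m0 : 2 <= m%:R :> R by rewrite ler_nat.
  have d2 : 2 <= d%:R :> R by rewrite ler_nat.
  have P0 : 0 < Pd m by apply: Pd_gt0; lia.
  have t0 := T0 m.
  have E1 : m.+1%:R = m%:R + 1 :> R by rewrite natr1.
  rewrite !natrD E1 in r1 r2; rewrite natrD in tr.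
  move: r1 r2 tr m0 d2 P0 t0; move: (Pd m) (Pd m.+1) (Pd m.+2) (T m) (T m.+2) (m%:R) (d%:R).
  move=> p p1 p2 t t2 x y r1 r2 tr m0 d2 P0 t0.
  have c0 : 0 < x * (x + 1) * (x + y - 1) * (x + y + 1) by rewrite !mulr_gt0//; lra.
  rewrite -(ler_pM2l c0).
  have -> : x * (x + 1) * (x + y - 1) * (x + y + 1) * (t2 * p2) =
    x * ((x + 1) * p2) * (((x + y) ^+ 2 - 1) * t2) by ring.
  rewrite r2 tr.
  have -> : x * ((x + 1 + y) * p1) * ((x ^+ 2 - 1) * t) =
     (x + 1 + y) * (x * p1) * ((x + 1) * (x - 1) * t) by ring.
  rewrite r1 -subr_ge0.
  have -> : x * (x + 1) * (x + y - 1) * (x + y + 1) * (t * p) -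
    (x + 1 + y) * ((x + y) * p) * ((x + 1) * (x - 1) * t) = y * (x + 1) * (x + y + 1) * (t * p) by ring.
  by rewrite !mulr_ge0//; lra.
have c0 : 0 < c by rewrite lt_min !mulr_gt0// Pd_gt0.
have d1 : 0 < d.+1%:R ^+ d :> R by rewrite exprn_gt0.
(* The power of [d + 1] comes from [Pd (k-2) <= (k-2+d)^d <= ((d+1) k)^d]. *)
exists (c / d.+1%:R ^+ d), C; split.
- by rewrite divr_gt0.
- by rewrite lt_max mulr_gt0// Pd_gt0.
move=> k T' k3 hT'; rewrite -(sums_unique (hT k) hT').
have k0 : 0 < k%:R ^+ d :> R by rewrite exprn_gt0// ltr0n; lia.
apply/andP; split.
  rewrite -mulrA -invfM ler_pdivrMr ?mulr_gt0//.
  have k22 : (k = k.-2.+2)%N by lia.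
  have km : (1 <= k.-2)%N by lia.
  apply: le_trans (lo _ km) _; rewrite -k22 ler_wpM2l ?(ltW (T0 k))//.
  apply: le_trans (Pd_le _) _; rewrite -exprMn lerXn2r ?nnegrE ?mulr_ge0//.
  by rewrite -natrM ler_nat; nia.
rewrite ler_pdivlMr//; apply: le_trans (hi k _); last by lia.
by rewrite ler_wpM2l ?Pd_ge// ltW.
Qed.

End Tk.
End Asymptotics.

(** * The kernel on the sphere *)

Section Kernel.
Context {R : realType}.

Definition kap0 (t : R) : R := (pi - acos t) / pi.
Definition kap1 (t : R) : R := (t * (pi - acos t) + Num.sqrt (1 - t ^+ 2)) / pi.
(** A plain iterate suffices: [kap1] fixes 1, so on the sphere the normalising square roots of
    [Sigma] are all 1. *)
Definition sig (h : nat) (t : R) : R := iter h kap1 t.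
Fixpoint tha (beta : R) (h : nat) (t : R) : R :=
  match h with
  | 0 => t + beta ^+ 2
  | h'.+1 => tha beta h' t * kap0 (sig h' t) + sig h t + beta ^+ 2
  end.

Let pi0 : 0 < pi :> R := pi_gt0 R.
Let pin0 : pi != 0 :> R. Proof. by rewrite gt_eqF. Qed.

Lemma kap11 : kap1 1 = 1.
Proof. by rewrite /kap1 acos1 subr0 expr1n subrr sqrtr0 addr0 mul1r divff. Qed.

Lemma sig1 h : sig h 1 = 1.
Proof. by elim: h => //= h IH; rewrite /sig/= -/(sig h 1) IH kap11. Qed.

Lemma Sigma_refl d h (x : 'I_d -> R) : on_sphere x -> Sigma h x x = 1.
Proof.
move=> x1; elim: h => //= h ->.
by rewrite mulr1 sqrtr1 divr1 mulr1 -/(kap1 1) kap11.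
Qed.

Lemma Sigma_sphere d h (x z : 'I_d -> R) : on_sphere x -> on_sphere z ->
  Sigma h x z = sig h (dotv x z).
Proof.
move=> x1 z1; elim: h => //= h ->.
by rewrite !Sigma_refl// mulr1 sqrtr1 divr1 mulr1.
Qed.

Lemma Theta_sphere d beta h (x z : 'I_d -> R) : on_sphere x -> on_sphere z ->
  Theta beta h x z = tha beta h (dotv x z).
Proof.
move=> x1 z1; elim: h => // h IH.
have D : Sigmadot h.+1 x z = kap0 (sig h (dotv x z)).
  by rewrite /Sigmadot Sigma_sphere// !Sigma_refl// mulr1 sqrtr1 divr1.
have -> : Theta beta h.+1 x z = Theta beta h x z * Sigmadot h.+1 x z + Sigma h.+1 x z + beta ^+ 2 by [].
by rewrite IH D (Sigma_sphere h.+1 x1 z1).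
Qed.

Lemma kap0E t : `|t| <= 1 -> kap0 t = 2^-1 + pi^-1 * asin t.
Proof.
move=> t1; rewrite /kap0 acos_asin//; move: (asin t) => s.
by move: (pin0); move: (@pi R) => p p0; field.
Qed.

Lemma kap1E t : `|t| <= 1 -> kap1 t = pi^-1 + t * 2^-1 +
  pi^-1 * (t * asin t + Num.sqrt (1 - t ^+ 2) - 1).
Proof.
move=> t1; rewrite /kap1 acos_asin//; move: (asin t) (Num.sqrt _) => s w.
by move: (pin0); move: (@pi R) => p p0; field.
Qed.

Let pV0 : 0 <= pi^-1 :> R. Proof. by rewrite invr_ge0 ltW. Qed.

Lemma isPS_kap1 : isPS kap1.
Proof.
have h2 : 0 <= 2^-1 :> R by rewrite invr_ge0.
have := PSD (PSD (PS_cst pV0) (PS_X (PS_cst h2))) (PSZ pV0 PS_asin_int).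
move=> P; eexists; apply: PS_ext P => t t1; by rewrite kap1E.
Qed.

Lemma isPS_sig h : isPS (sig h) /\ forall t : R, `|t| <= 1 -> `|sig h t| <= 1.
Proof.
suff hh : isPS (sig h).
  split=> // t t1; case: hh => a ha.
  by have := PS_norm_le ha t1; rewrite sig1.
elim: h => [|h IH].
  have := PS_X (PS_cst (@ler01 R)) => P; eexists; apply: PS_ext P => t _.
  by rewrite mulr1.
have b t : `|t| <= 1 -> `|sig h t| <= 1.
  by move=> t1; case: IH => a ha; have := PS_norm_le ha t1; rewrite sig1.
exact: isPS_comp isPS_kap1 IH b.
Qed.

(** Expansion of [(t + beta^2) kap0 t + kap1 t + beta^2] after [acos = pi / 2 - asin]; the linear
    coefficient 1 is one half from each of [kap0] and [kap1]. *)
Definition tha1c (beta : R) (n : nat) : R :=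
  beta ^+ 2 / pi * asc n + pi^-1 * (if n is m.+1 then asc m else 0) +
  ((n == 0)%:R * (beta ^+ 2 * 2^-1 + pi^-1 + beta ^+ 2) +
   (if n is m.+1 then (m == 0)%:R * 1 else 0) +
   pi^-1 * (if n is m.+1 then asc m / n%:R else 0)).

Lemma PS_tha1 beta : PS (tha beta 1) (tha1c beta).
Proof.
have b0 : 0 <= beta ^+ 2 / pi by rewrite mulr_ge0// sqr_ge0.
have c0 : 0 <= beta ^+ 2 * 2^-1 + pi^-1 + beta ^+ 2.
  by rewrite !addr_ge0// ?sqr_ge0// mulr_ge0// ?sqr_ge0// invr_ge0.
have := PSD (PSD (PSZ b0 PS_asin) (PSZ pV0 (PS_X PS_asin)))
  (PSD (PSD (PS_cst c0) (PS_X (PS_cst (@ler01 R)))) (PSZ pV0 PS_asin_int)).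
apply: PS_ext => t t1; rewrite [RHS]/= /sig/= kap0E// kap1E//.
move: (asin t) (Num.sqrt _) => s w; move: (pin0); move: (@pi R) => p p0; field.
exact: p0.
Qed.

(** Odd [n] are carried by [beta^2 asc n], even [n] by [asc n.-1]; the minimum serves both, and 6 is
    the constant of [bq_le_asc]. *)
Lemma tha1c_ge beta : 0 < beta -> exists2 c, 0 < c & forall n, c * bq n <= tha1c beta n.
Proof.
move=> b0; have p2 := pi_ge2 R.
pose m := Num.min (beta ^+ 2) 1.
have bb : 0 < beta ^+ 2 by rewrite exprn_gt0.
have m0 : 0 < m by rewrite lt_min bb ltr01.
have mb : m <= beta ^+ 2 by rewrite ge_min lexx.
have m1 : m <= 1 by rewrite ge_min lexx orbT.
have pp : 0 < pi^-1 :> R by rewrite invr_gt0.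
have p1 : pi^-1 <= 1 :> R by rewrite invf_le1//; lra.
exists (pi^-1 * (m / 6)); first by rewrite mulr_gt0// divr_gt0.
have cm : pi^-1 * (m / 6) <= m.
  apply: (@le_trans _ _ (1 * (m / 6))); last by lra.
  by rewrite ler_wpM2r//; lra.
case=> [|[|n]].
- rewrite /tha1c /= !mulr0 !add0r mul1r !addr0 mulr1.
  apply: le_trans cm _; apply: le_trans mb _.
  rewrite lerDr addr_ge0// mulr_ge0// ?sqr_ge0//; lra.
- rewrite /tha1c /= !mulr1 mul0r add0r !mulr0 mul0r mulr0 !addr0.
  by apply: le_trans cm _; apply: le_trans m1 _; rewrite lerDr mulr_ge0// ltW.
have hb := bq_le_asc (R := R) (n := n.+2) isT.
rewrite /tha1c; set q := bq n.+2 in hb *; rewrite [n.+2.-1]/= in hb.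
have a1 := asc_ge0 (R := R) n.+1; have a2 := asc_ge0 (R := R) n.+2.
set s1 := asc n.+1 in a1 hb *; set s2 := asc n.+2 in a2 hb *.
apply: (@le_trans _ _ (pi^-1 * (m * (s2 + s1)))).
  by rewrite -mulrA ler_wpM2l// -mulrA ler_wpM2l ?(ltW m0)//; lra.
rewrite -[leLHS]addr0; apply: lerD; last first.
  by rewrite !mul0r !add0r mulr_ge0// divr_ge0.
have -> : beta ^+ 2 / pi * s2 + pi^-1 * s1 = pi^-1 * (beta ^+ 2 * s2 + s1).
  by move: (@pi R)^-1 => p; ring.
rewrite ler_wpM2l// mulrDr; apply: lerD.
  by rewrite ler_wpM2r.
by rewrite ler_piMl.
Qed.

Lemma tha1c_le beta : exists2 C, 0 < C & forall n, (2 <= n)%N -> tha1c beta n <= C * bq n.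
Proof.
have pp : 0 < pi^-1 :> R by rewrite invr_gt0.
exists (pi^-1 * (beta ^+ 2 + 2)).
  by rewrite mulr_gt0// ltr_wpDl ?sqr_ge0.
move=> [|[|n]]// n2.
have [h2 h1] := asc_le_bq (R := R) n2; rewrite [n.+2.-1]/= in h1.
rewrite /tha1c; have a1 := asc_ge0 (R := R) n.+1.
set q := bq n.+2 in h1 h2 *; set s1 := asc n.+1 in a1 h1 *; set s2 := asc n.+2 in h2 *.
rewrite !mul0r !add0r.
have h3 : s1 / n.+2%:R <= q.
  by apply: le_trans h1; rewrite ler_piMr// invf_le1// ?ler1n// ltr0n.
have -> : beta ^+ 2 / pi * s2 + pi^-1 * s1 + pi^-1 * (s1 / n.+2%:R) =
  pi^-1 * (beta ^+ 2 * s2 + s1 + s1 / n.+2%:R).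
  by move: (@pi R)^-1 (n.+2%:R^-1) => p v; ring.
rewrite -[leRHS]mulrA; apply: ler_wpM2l; first exact: ltW.
rewrite [leRHS]mulrDl.
have hh : beta ^+ 2 * s2 <= beta ^+ 2 * q by rewrite ler_wpM2l// sqr_ge0.
by apply: le_trans (lerD (lerD hh h1) h3) _; rewrite -addrA lerD2l mulr_natl mulr2n.
Qed.

Lemma isPS_tha beta h : isPS (tha beta h).
Proof.
elim: h => [|h IH].
  have := PSD (PS_X (PS_cst (@ler01 R))) (PS_cst (sqr_ge0 beta)) => P.
  by eexists; apply: PS_ext P => t _; rewrite /= mulr1.
have [hs sb] := isPS_sig h; have [hs1 _] := isPS_sig h.+1.
have ha : isPS (fun t => asin (sig h t)) by apply: isPS_comp => //; exists asc; exact: PS_asin.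
have h2 : 0 <= 2^-1 :> R by rewrite invr_ge0.
have := isPSD (isPSD (isPSM IH (isPSD (isPS_cst h2) (isPSZ pV0 ha))) hs1) (isPS_cst (sqr_ge0 beta)).
by move=> [a P]; exists a; apply: PS_ext P => t t1; rewrite [RHS]/= kap0E ?sb.
Qed.

(** Each layer keeps half of the previous coefficients and adds nonnegative ones, so the constant is
    halved at each layer. *)
Lemma tha_coef beta h : 0 < beta -> exists a, PS (tha beta h.+1) a /\
  exists2 c, 0 < c & forall n, c * bq n <= a n.
Proof.
move=> b0; elim: h => [|h [a [ha [c c0 hc]]]].
  by exists (tha1c beta); split; [exact: PS_tha1|exact: tha1c_ge].
have [hs sb] := isPS_sig h.+1; have [hs1 _] := isPS_sig h.+2.
have hA : isPS (fun t => asin (sig h.+1 t)) by apply: isPS_comp => //; exists asc; exact: PS_asin.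
have h2 : 0 <= 2^-1 :> R by rewrite invr_ge0.
have [e he] := isPSD (isPSD (isPSM (isPS_tha beta h.+1) (isPSZ pV0 hA)) hs1) (isPS_cst (sqr_ge0 beta)).
exists (fun n => 2^-1 * a n + e n); split.
  apply: PS_ext (PSD (PSZ h2 ha) he) => t t1.
  have -> : tha beta h.+2 t = tha beta h.+1 t * kap0 (sig h.+1 t) + sig h.+2 t + beta ^+ 2 by [].
  rewrite kap0E ?sb//; move: (tha _ _ _) (asin _) (sig h.+2 t) (@pi R)^-1 => u v w p.
  by ring.
exists (2^-1 * c) => [|n]; first by rewrite mulr_gt0// invr_gt0.
rewrite -mulrA -[leLHS]addr0; apply: lerD; last by case: he.
by rewrite ler_wpM2l.
Qed.

End Kernel.

(** * Eigenvalues and expansion of power-series kernels *)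

Section Mercer.
Context {R : realType} (d : nat) (hd : (1 < d)%N) (f : R -> R) (a : nat -> R) (hf : PS f a).

Let a0 n : 0 <= a n. Proof. by have [] := hf. Qed.

Lemma sums_fin (b : nat -> R) N : (forall n, (N <= n)%N -> b n = 0) ->
  sums b (\sum_(0 <= n < N) b n).
Proof.
move=> hb; rewrite /sums -(cvg_shiftn N) /=.
rewrite (_ : (fun n => _) = (fun=> \sum_(0 <= n < N) b n)); first exact: cvg_cst.
apply/funext => n; rewrite (big_cat_nat (leq0n N) (leq_addl n N))/=.
have -> : \sum_(N <= i < n + N) b i = 0.
  by rewrite big_nat_cond big1// => i /andP[/andP[/hb]].
by rewrite addr0.
Qed.

(** Tails remain in the class, so their value at 1 bounds them uniformly; this allows passing to the
    limit under the sphere integral. *)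
Lemma PS_tail N : PS (fun t => f t - \sum_(0 <= n < N) a n * t ^+ n)
  (fun n => if (n < N)%N then 0 else a n).
Proof.
split=> [n|t t1]; first by case: ifP.
have E : sums (fun n => if (n < N)%N then a n * t ^+ n else 0) (\sum_(0 <= n < N) a n * t ^+ n).
  rewrite (eq_big_nat _ _ (F2 := fun n => if (n < N)%N then a n * t ^+ n else 0)).
    by apply: sums_fin => n nN; rewrite ltnNge nN.
  by move=> n /andP[_ ->].
apply: eq_sums (sumsB (hf.2 t t1) E) => n.
by case: ifP; rewrite ?subr0// subrr mul0r.
Qed.

Lemma dotv_le1 (x z : 'I_d -> R) : dotv x x <= 1 -> dotv z z <= 1 -> `|dotv x z| <= 1.
Proof.
move=> x1 z1; rewrite /dotv; apply: le_trans (ler_norm_sum _ _ _) _.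
apply: (@le_trans _ _ (\sum_i (x i * x i + z i * z i) / 2)).
  apply: ler_sum => i _; rewrite ler_norml.
  have h1 := sqr_ge0 (x i - z i); have h2 := sqr_ge0 (x i + z i).
  by apply/andP; split; nra.
by rewrite -mulr_suml big_split/= -/(dotv x x) -/(dotv z z); lra.
Qed.

Lemma polyfun_bound (c : seq (R * ('I_d -> nat))) : exists2 B, 0 <= B &
  forall z, dotv z z <= 1 -> `|polyfun c z| <= B.
Proof.
exists (\sum_(t <- c) `|t.1|); first by apply: sumr_ge0 => t _.
move=> z z1; apply: le_trans (ler_norm_sum _ _ _) _; apply: ler_sum => t _.
rewrite normrM ler_piMr// /monom normr_prod; apply: prodr_ile1 => i _.
by rewrite normr_ge0/= normrX exprn_ile1// ball_coord.
Qed.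

(** Measurable as a pointwise limit of polynomial kernels. *)
Lemma snice_zonal (x : 'I_d -> R) : on_sphere x -> snice (fun z => f (dotv x z)).
Proof.
move=> x1.
have db y : `|dotv x (dirv y)| <= 1.
  by apply: dotv_le1; [rewrite (x1 : dotv x x = 1)|exact: dotv_dirv_le1].
split; last by exists (f 1) => y; apply: PS_norm_le hf (db y).
apply: (@mfam_cvg _ (fun N y => \sum_(0 <= n < N) a n * dotv x (dirv y) ^+ n)).
  move=> N; apply: mfam_sum => n; apply: mfamM; first exact: mfam_cst.
  by have [+ _] := sniceX n (snice_dot x).
by move=> y; exact: hf.2.
Qed.

Lemma funk_hecke k (Y : ('I_d -> R) -> R) x l : sph_harm k Y -> on_sphere x ->
  sums (fun n => a n * lam d n k) l ->
  sphere_int (fun z => f (dotv x z) * Y z) = l * Y x.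
Proof.
move=> hY x1 hl; have d0 := ltnW hd.
have [c [hc [lc Yc]]] := hY.
have [B B0 hB] := polyfun_bound c.
pose FN N z := \sum_(0 <= n < N) a n * (dotv x z ^+ n * polyfun c z).
have nf : snice (fun z => f (dotv x z) * polyfun c z).
  by apply: sniceM; [exact: snice_zonal|exact: snice_polyfun].
have nt n : snice (fun z => dotv x z ^+ n * polyfun c z).
  by apply: sniceM; [apply: sniceX; exact: snice_dot|exact: snice_polyfun].
have nN N : snice (FN N) by apply: snice_sum => n; apply: sniceM; [exact: snice_cst|exact: nt].
have hp : sph_harm k (polyfun c) by exists c; split.
have -> : sphere_int (fun z => f (dotv x z) * Y z) = sphere_int (fun z => f (dotv x z) * polyfun c z).
  by apply: sphere_int_eq => // z z1; rewrite Yc.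
have EN N : sphere_int (FN N) = (\sum_(0 <= n < N) a n * lam d n k) * Y x.
  rewrite /FN sphere_int_sum; last by move=> n; apply: sniceM; [exact: snice_cst|exact: nt].
  rewrite mulr_suml; apply: eq_bigr => n _.
  by rewrite sphere_intZ// (sph_harm_pow hd n hp x1) (Yc x x1) mulrA.
have c1 : (fun N => sphere_int (FN N)) @ \oo --> l * Y x.
  rewrite (_ : (fun N => _) = (fun N => (\sum_(0 <= n < N) a n * lam d n k) * Y x)); last exact/funext.
  by apply: cvgM; [exact: hl|exact: cvg_cst].
have c2 : (fun N => sphere_int (FN N)) @ \oo --> sphere_int (fun z => f (dotv x z) * polyfun c z).
  have tl N : `|sphere_int (fun z => f (dotv x z) * polyfun c z) - sphere_int (FN N)| <=
      (f 1 - \sum_(0 <= n < N) a n) * B.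
    rewrite -mulN1r -sphere_intZ// -sphere_intD//; last first.
      by apply: sniceM; [exact: snice_cst|exact: nN].
    apply: sphere_int_bound.
      by apply: sniceD => //; apply: sniceM; [exact: snice_cst|exact: nN].
    move=> z z1.
    have -> : f (dotv x z) * polyfun c z + -1 * FN N z =
        (f (dotv x z) - \sum_(0 <= n < N) a n * dotv x z ^+ n) * polyfun c z.
      rewrite /FN mulN1r mulrBl mulr_suml; congr (_ - _).
      by apply: eq_bigr => n _; rewrite mulrA.
    rewrite normrM; apply: ler_pM => //; last exact: hB.
    have db : `|dotv x z| <= 1 by apply: dotv_le1 => //; rewrite (x1 : dotv x x = 1).
    have := PS_norm_le (PS_tail N) db.
    by rewrite [X in _ <= _ - X](eq_bigr a)// => n _; rewrite expr1n mulr1.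
  apply/cvgrPdist_le => e e0.
  have ct : (fun N => (f 1 - \sum_(0 <= n < N) a n) * B) @ \oo --> (f 1 - f 1) * B.
    apply: cvgM; last exact: cvg_cst.
    by apply: cvgB; [exact: cvg_cst|exact: PS_sums1 hf].
  rewrite subrr mul0r in ct; move/cvgrPdist_le: ct => /(_ _ e0) ct.
  near=> N; apply: le_trans (tl N) _; apply: le_trans (ler_norm _) _.
  by rewrite -normrN -sub0r; near: N.
by rewrite -(cvg_lim _ c2)// -(cvg_lim _ c1).
Unshelve. all: by end_near. Qed.

(** The double series [a n * lam n k * G k t] is dominated by its value at [t = 1], whose rows sum
    to [a n]. Summing rows gives [f t], summing columns the eigenvalue times the zonal
    polynomial. *)
Lemma mercer (lamk : nat -> R) (B : nat -> seq (('I_d -> R) -> R)) x z :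
  (forall k, sums (fun n => a n * lam d n k) (lamk k)) ->
  (forall k, sph_harm_onb k (B k)) -> on_sphere x -> on_sphere z ->
  sums (fun k => lamk k * \sum_(Y <- B k) Y x * Y z) (f (dotv x z)).
Proof.
move=> hl hB x1 z1; set t := dotv x z.
have t1 : `|t| <= 1 by apply: dotv_le1; rewrite ?(x1 : dotv x x = 1) ?(z1 : dotv z z = 1).
have fin s n : sums (fun k => a n * (lam d n k * G d k s)) (a n * s ^+ n).
  apply: sumsZ; rewrite (pow_G hd) -(big_mkord xpredT (fun k => lam d n k * G d k s)).
  by apply: sums_fin => k nk; rewrite lam_lt// mul0r.
have fin1 n : sums (fun k => a n * (lam d n k * G d k 1)) (a n).
  by have := fin 1 n; rewrite expr1n mulr1.
have [|C hC hCf] := double_series _ fin1 (PS_sums1 hf) (fin t) (hf.2 t t1).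
  move=> n k; rewrite !normrM ger0_norm// ger0_norm ?lam_ge0//.
  by rewrite ler_wpM2l// ler_wpM2l ?lam_ge0// (G_le hd (hB k)).
apply: eq_sums hCf => k; rewrite (reproducing hd (hB k))// -/t.
apply: sums_unique (hC k) _.
by rewrite mulrC; apply: eq_sums (sumsZ (G d k t) (hl k)) => n; rewrite /=; ring.
Qed.

End Mercer.

Unset Implicit Arguments.

Theorem theorem2 (R : realType) (d : nat) (beta : R) (L : nat)
  (hd : (2 <= d)%N) (hbeta : 0 < beta) (hL : (2 <= L)%N) :
  exists lam : nat -> R,
    (* (1) eigenvalues: positivity, eigen-relation on degree-k harmonics,
       and the Mercer / spherical-harmonic expansion *)
    (forall k, 0 < lam k) /\
    (forall k (Y : ('I_d -> R) -> R), sph_harm k Y ->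
       forall x, on_sphere x ->
         sphere_int (fun z => kFC beta L x z * Y z) = lam k * Y x) /\
    (forall B : nat -> seq (('I_d -> R) -> R),
       (forall k, sph_harm_onb k (B k)) ->
       forall x z, on_sphere x -> on_sphere z ->
         (fun n => \sum_(0 <= k < n) lam k * \sum_(Y <- B k) Y x * Y z)
           @ \oo --> kFC beta L x z) /\
    (* (2) asymptotics *)
    (exists (k0 : nat) (C1 C2 C3 : R), 0 < C1 /\ 0 < C2 /\ 0 < C3 /\
       forall k : nat, (k0 < k)%N ->
         (L = 2%N -> C1 * k%:R ^- d <= lam k <= C2 * k%:R ^- d) /\
         ((3 <= L)%N -> C3 * k%:R ^- d <= lam k)).
Proof.
set h := L.-2.
have LE : L.-1 = h.+1 by rewrite /h; lia.
(* For [L = 2] the coefficients must be the explicit [tha1c], since the upper bound is read off from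
   them. *)
have [a [ha [c c0 hc] hu]] : exists a, [/\ PS (tha beta h.+1) a,
    exists2 c, 0 < c & forall n, c * bq n <= a n &
    L = 2%N -> exists2 C, 0 < C & forall n, (2 <= n)%N -> a n <= C * bq n].
  have [L2|L2] := eqVneq L 2%N.
    exists (tha1c beta); rewrite /h L2; split; [exact: PS_tha1|exact: tha1c_ge|].
    by move=> _; exact: tha1c_le.
  have [a [ha hc]] := tha_coef h hbeta.
  by exists a; split=> // /eqP; rewrite (negbTE L2).
have a0 n : 0 <= a n by have [] := ha.
have /choice[lm hl] k : exists l, sums (fun n => a n * lam d n k) l.
  have [|l h1 _] := @sums_dom _ (fun n => a n * lam d n k) a _ _ (PS_sums1 ha); last by exists l.
  by move=> n; rewrite mulr_ge0 ?lam_ge0//= ler_piMr ?lam_le1.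
have kE x z : on_sphere x -> on_sphere z -> kFC beta L x z = tha beta h.+1 (dotv x z).
  by move=> x1 z1; rewrite /kFC LE Theta_sphere.
have t0 k n : 0 <= a n * lam d n k by rewrite mulr_ge0 ?lam_ge0.
exists lm; split; [|split; [|split]].
- move=> k; apply: lt_le_trans (sums_psum_le k.+1 (t0 k) (hl k)).
  rewrite big_nat_recr//= ltr_wpDl ?sumr_ge0// mulr_gt0 ?lam_diag_gt0//.
  by apply: lt_le_trans (hc k); rewrite mulr_gt0 ?bq_gt0.
- move=> k Y hY x x1; rewrite -(funk_hecke hd ha hY x1 (hl k)).
  apply: sphere_int_eq; first exact: ltnW hd.
    by move=> z z1; rewrite kE.
  by apply: sniceM; [exact: snice_zonal ha _ x1|exact: sph_harm_snice hY].
- by move=> B hB x z x1 z1; rewrite kE//; exact: (mercer hd ha hl hB x1 z1).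
(* The kernel itself proves [bq] summable: [c * bq n] lies below its coefficients. *)
have [Sb hb _] : exists2 l, sums bq l & l <= c^-1 * tha beta h.+1 1.
  apply: sums_dom (sumsZ c^-1 (PS_sums1 ha)) => n.
  by rewrite ltW ?bq_gt0//= ler_pdivlMl.
have [c1 [C1 [c10 C10 hT]]] := T_bounds hd hb.
have lo k : (2 < k)%N -> c * c1 * k%:R ^- d <= lm k.
  move=> k2; have [T hTk _] := sums_T hd hb k.
  have /andP[h1 _] := hT k T k2 hTk.
  rewrite -mulrA; apply: (@le_trans _ _ (c * T)); first by rewrite ler_wpM2l ?(ltW c0).
  apply: sums_le (sumsZ c hTk) (hl k) => n.
  by rewrite mulrA ler_wpM2r ?lam_ge0.
have cc : 0 < c * c1 by rewrite mulr_gt0.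
have [L2|L2] := eqVneq L 2%N.
  have [C C0 hC] := hu L2.
  exists 2%N, (c * c1), (C * C1), (c * c1); do 3 (split; first by rewrite ?mulr_gt0).
  move=> k k2; split=> [_|_]; last exact: lo.
  rewrite lo//=; have [T hTk _] := sums_T hd hb k.
  have /andP[_ h2] := hT k T k2 hTk.
  rewrite -mulrA; apply: (@le_trans _ _ (C * T)); last by rewrite ler_wpM2l ?(ltW C0).
  apply: sums_le (hl k) (sumsZ C hTk) => n.
  (* The upper bound on [a n] starts at [n = 2]; smaller [n] contribute nothing because [k > 2]. *)
  case: (ltnP n 2) => n2; first by rewrite lam_lt ?mulr0//; lia.
  by rewrite mulrA ler_wpM2r ?lam_ge0// hC.
(* The value 1 is arbitrary: here the clause for [L = 2] is vacuous. *)
exists 2%N, (c * c1), 1, (c * c1); do 3 (split; first by rewrite ?mulr_gt0).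
by move=> k k2; split=> [LL|_]; [rewrite LL eqxx in L2|exact: lo].
Qed.
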